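(* Let $n\ge2$, let $\Omega\subset B_R^n$ be open and convex, let $0\le f\in L^1(\Omega)$ with $f\le\Lambda<\infty$, let $\alpha\in(0,1)$ and let $g\in C^{\alpha}(\overline\Omega)$ be convex. Let $u\in C(\overline\Omega)$ be the convex solution of $$\mu_u=f\,dx\ \text{ in }\Omega,\qquad u=g\ \text{ on }\partial\Omega.$$ Then the following holds for the weak derivative $\nabla u$ of $u$. Let $p,\beta\in[0,\infty)$ with $(1-\min\{2/n,\alpha\})p-\beta<1$. Then $$\int_\Omega|\nabla u(x)|^p\operatorname{dist}(x,\partial\Omega)^\beta\,dx\le C(n,R,\Lambda,p,\beta,\omega_g)<\infty,$$ where the constant depends only on $n,R,\Lambda,p,\beta$ and $\omega_g$. In particular, $u\in W^{1,p}(\Omega)$ for all $p<(1-\min\{2/n,\alpha\})^{-1}$.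
   Context: $B_R^n\subset\mathbb{R}^n$ is the open ball of radius $R$ around the origin; $|\cdot|$ is the Euclidean norm of a vector, and the Lebesgue measure of a set. For a convex function $u$ on $\Omega$, $\partial u(x)=\{\xi\in\mathbb{R}^n: u(y)\ge u(x)+\langle\xi,y-x\rangle\ \forall y\in\Omega\}$ and the Monge--Ampère measure is $\mu_u(A)=\big|\bigcup_{x\in A}\partial u(x)\big|$ for Borel $A\subset\Omega$. The modulus of continuity of $g:\overline\Omega\to\mathbb{R}$ is the function $\omega_g(\delta)=\sup\{|g(x)-g(y)|: x,y\in\overline\Omega,\ |x-y|\le\delta\}$. $C^\alpha(\overline\Omega)$ is the space of $\alpha$-Hölder continuous functions on $\overline\Omega$. The Sobolev space $W^{1,p}(\Omega)$ is considered for $p\ge1$. *)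

(* Defs.v *)
From HB Require Import structures.
From mathcomp Require Import all_boot all_order all_algebra.
From mathcomp Require Import all_classical all_reals all_analysis.

Set Implicit Arguments.
Unset Strict Implicit.
Unset Printing Implicit Defensive.

Import Order.TTheory GRing.Theory Num.Theory.
Import numFieldNormedType.Exports.

Local Open Scope classical_set_scope.
Local Open Scope ring_scope.

(* [R^n] is ['rV[R]_n].  The library norm on it is the sup norm, so it is used
   only through the topology it induces; metric notions use [enorm]. *)

Section euclidean.
Context {R : realType} {n : nat}.
Implicit Types (x y : 'rV[R]_n) (A : set 'rV[R]_n).

Definition dotmx x y : R := \sum_(i < n) x 0 i * y 0 i.

Definition enorm x : R := Num.sqrt (dotmx x x).

Definition eball (r : R) : set 'rV[R]_n := [set x | enorm x < r].

Definition boundary A : set 'rV[R]_n := closure A `\` A°.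

Definition edist_to x A : R := inf [set enorm (x - y) | y in A].

End euclidean.

(* Lebesgue measure on [R^n]: the outer measure defined by countable covers by
   boxes, then its restriction to the Caratheodory-measurable sets.  The
   underlying set function is defined on all sets, and equals the Lebesgue
   outer measure on non-measurable ones. *)
Section lebesgue.
Context {R : realType} {n : nat}.
Implicit Types A : set 'rV[R]_n.
Local Open Scope ereal_scope.

Definition box (c : 'rV[R]_n * 'rV[R]_n) : set 'rV[R]_n :=
  [set x | forall i, c.1 0%R i < x 0%R i <= c.2 0%R i]%R.

(* [Num.max 0] gives the empty boxes, where some side is reversed, volume 0. *)
Definition box_volume (c : 'rV[R]_n * 'rV[R]_n) : R :=
  (\prod_(i < n) Num.max 0 (c.2 0 i - c.1 0 i))%R.

Definition box_cover A : set (set ('rV[R]_n * 'rV[R]_n)) :=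
  [set C | countable C /\ A `<=` \bigcup_(c in C) box c].

Definition lebesgue_outer A : \bar R :=
  ereal_inf [set \esum_(c in C) (box_volume c)%:E | C in box_cover A].

Lemma box_volume_ge0 c : 0 <= (box_volume c)%:E.
Proof. by rewrite lee_fin prodr_ge0// => i _; rewrite le_max lexx. Qed.

Lemma lebesgue_outer_ge0 A : 0 <= lebesgue_outer A.
Proof.
apply: le_ereal_inf_tmp => _ [C _ <-].
by apply: esum_ge0 => c _; exact: box_volume_ge0.
Qed.

Lemma lebesgue_outer0 : lebesgue_outer set0 = 0.
Proof.
apply/eqP; rewrite eq_le lebesgue_outer_ge0 andbT.
apply: ereal_inf_lbound; exists set0; last exact: esum_set0.
by split.
Qed.

Lemma le_lebesgue_outer : {homo lebesgue_outer : A B / A `<=` B >-> A <= B}.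
Proof.
move=> A B AB; apply: ereal_inf_le_tmp => _ [C [cC BC] <-].
by exists C => //; split => //; exact: subset_trans BC.
Qed.

Lemma lebesgue_outer_sigma_subadditive : sigma_subadditive lebesgue_outer.
Proof.
move=> A.
have [[i ioo]|Aoo] := pselect (exists i, lebesgue_outer (A i) = +oo).
  rewrite (eseries_pinfty _ _ ioo) ?leey// => k _.
  by rewrite -ltNye (lt_le_trans _ (lebesgue_outer_ge0 _)).
apply/lee_addgt0Pr => e e0.
have [C PC] : {C : (set ('rV[R]_n * 'rV[R]_n))^nat & forall k,
    box_cover (A k) (C k) /\ \esum_(c in C k) (box_volume c)%:E <=
    lebesgue_outer (A k) + (e / (2 ^ k.+1)%:R)%:E}.
  apply: (@choice _ _ (fun k C => box_cover (A k) C /\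
    \esum_(c in C) (box_volume c)%:E <=
    lebesgue_outer (A k) + (e / (2 ^ k.+1)%:R)%:E)) => k.
  have fk : lebesgue_outer (A k) \is a fin_num.
    rewrite ge0_fin_numE ?lebesgue_outer_ge0// ltey.
    by apply/eqP => kk; apply: Aoo; exists k.
  have ek : (0 < e / (2 ^ k.+1)%:R)%R by rewrite divr_gt0// ltr0n expn_gt0.
  have [_ [C AC <-] /ltW leC] := lb_ereal_inf_adherent ek fk.
  by exists C.
apply: (@le_trans _ _ (\sum_(k <oo) (lebesgue_outer (A k) +
    (e / (2 ^ k.+1)%:R)%:E))); last first.
  by apply: epsilon_trick => [k|]; [exact: lebesgue_outer_ge0|exact: ltW].
apply: (@le_trans _ _ (\sum_(k <oo) \esum_(c in C k) (box_volume c)%:E));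
    last first.
  apply: lee_nneseries => k _; last by case: (PC k).
  by move=> _; apply: esum_ge0 => c _; exact: box_volume_ge0.
apply: (@le_trans _ _ (\esum_(c in \bigcup_k C k) (box_volume c)%:E)).
  apply: ereal_inf_lbound; exists (\bigcup_k C k) => //; split.
    by apply: bigcup_countable => // k _; case: (PC k) => -[].
  move=> x [k _ Akx]; have [[_ /(_ _ Akx)[c Ckc cx]] _] := PC k.
  by exists c => //; exists k.
have C0 c : 0 <= (box_volume c)%:E by exact: box_volume_ge0.
rewrite seqDU_bigcup_eq (nneseries_sum_bigcup (trivIset_seqDU C) C0).
apply: lee_nneseries => k _; first by move=> _; exact: esum_ge0.
apply: le_ereal_sup => _ [X [finX XC] <-]; exists X => //; split => //.
by apply: subset_trans XC _; exact: subset_seqDU.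
Qed.

HB.instance Definition _ := isOuterMeasure.Build R 'rV[R]_n lebesgue_outer
  lebesgue_outer0 lebesgue_outer_ge0 le_lebesgue_outer
  lebesgue_outer_sigma_subadditive.

Definition lebesgue_n : set (caratheodory_type lebesgue_outer) -> \bar R :=
  lebesgue_outer.

HB.instance Definition _ := isMeasure.Build _ _ _ lebesgue_n
  (@caratheodory_measure0 _ _ lebesgue_outer)
  (@caratheodory_measure_ge0 _ _ lebesgue_outer)
  (@caratheodory_measure_sigma_additive _ _ lebesgue_outer).

End lebesgue.
Arguments lebesgue_n R n : clear implicits.

Section monge_ampere.
Context {R : realType} {n : nat}.
Implicit Types (Omega A : set 'rV[R]_n) (u g : 'rV[R]_n -> R).

Definition subdifferential Omega u (x : 'rV[R]_n) : set 'rV[R]_n :=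
  [set xi | forall y, Omega y -> u x + dotmx xi (y - x) <= u y].

Definition monge_ampere Omega u A : \bar R :=
  lebesgue_n R n (\bigcup_(x in A) subdifferential Omega u x).

(* [mu_u = f dx] as Borel measures on [Omega]. *)
Definition monge_ampere_eq Omega u (f : 'rV[R]_n -> R) : Prop :=
  forall A, <<s open >> A -> A `<=` Omega ->
    monge_ampere Omega u A = (\int[lebesgue_n R n]_(x in A) (f x)%:E)%E.

(* The supremum is taken in [R]; it is finite when [g] is bounded on [A], and
   it is 0 on the empty set (when [A] is empty or [delta < 0]). *)
Definition modulus_of_continuity A g (delta : R) : R :=
  sup [set t | exists x y,
    [/\ A x, A y, enorm (x - y) <= delta & t = `|g x - g y|]].

Definition hoelder_on (alpha : R) A g : Prop :=
  exists K : R, forall x y, A x -> A y ->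
    `|g x - g y| <= K * enorm (x - y) `^ alpha.

End monge_ampere.

Section sobolev.
Context {R : realType} {n : nat}.
Implicit Types (Omega : set 'rV[R]_n) (u phi : 'rV[R]_n -> R).

Definition unit_vec (i : 'I_n) : 'rV[R]_n := delta_mx 0 i.

Definition iter_partial (s : seq 'I_n) phi : 'rV[R]_n -> R :=
  foldr (fun i psi => 'D_(unit_vec i) psi) phi s.

Definition smooth phi : Prop := forall s : seq 'I_n,
  continuous (iter_partial s phi) /\
  forall i x, derivable (iter_partial s phi) x (unit_vec i).

Definition test_function Omega phi : Prop :=
  [/\ smooth phi, compact (closure [set x | phi x != 0]) &
      closure [set x | phi x != 0] `<=` Omega].

Definition L1loc Omega u : Prop := forall K, compact K -> K `<=` Omega ->
  (lebesgue_n R n).-integrable K (EFin \o u).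

Definition weak_gradient Omega u (v : 'rV[R]_n -> 'rV[R]_n) : Prop :=
  L1loc Omega u /\ forall i : 'I_n, L1loc Omega (fun x => v x 0 i) /\
    forall phi, test_function Omega phi ->
      \int[lebesgue_n R n]_(x in Omega) (u x * 'D_(unit_vec i) phi x) =
      - \int[lebesgue_n R n]_(x in Omega) (v x 0 i * phi x).

(* [u \_ Omega] is [u] extended by 0 outside [Omega]. *)
Definition Lp_on (p : R) Omega u : Prop :=
  (u \_ Omega : caratheodory_type lebesgue_outer -> R)
    \in Lfun (lebesgue_n R n) p%:E.

Definition sobolev_W1 (p : R) Omega u : Prop :=
  Lp_on p Omega u /\ exists v : 'rV[R]_n -> 'rV[R]_n,
    weak_gradient Omega u v /\ forall i, Lp_on p Omega (fun x => v x 0 i).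

End sobolev.

(* Main.v *)
(* With d(x) = dist(x, bd Omega) and gamma = min(2/n, alpha), one shows
   |u(y) - u(x)| <= C d(x)^gamma for |y - x| <= d(x)/2; convexity then bounds the
   difference quotients of u at x by C d(x)^(gamma - 1), and the power of d that
   results from |grad u|^p d^beta is integrable because the layer {d < t} has
   volume O(t).

   From above u is compared with g along a segment ending at the boundary point
   nearest to y.  From below, an affine minorant of g touching (almost) at x
   reduces matters to the barrier t^gamma (|x'|^2 - M), with t the distance to a
   supporting hyperplane of Omega: where u minus the affine function lies furthest
   below the barrier, the barrier gives a paraboloid below u, so that subgradients
   near that point fill more volume than Lambda allows once M is large.

   The weak gradient is the limit of the right difference quotients.  It is unique
   up to null sets: testing against smooth bumps shows that two weak gradients have
   the same integral over boxes, hence over Borel sets. *)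

Require Import Defs.
From HB Require Import structures.
From mathcomp Require Import all_boot all_order all_algebra.
From mathcomp Require Import all_classical all_reals all_analysis.
From mathcomp Require Import measurable_realfun ring lra.
Import Order.TTheory GRing.Theory Num.Theory.
Import numFieldNormedType.Exports.
Local Open Scope classical_set_scope.
Local Open Scope ring_scope.
Set Implicit Arguments.
Unset Strict Implicit.
Unset Printing Implicit Defensive.
(* [spectral] has another [dotmx], which shadows the one of [Defs]. *)
Local Notation dotmx := Defs.dotmx.
Local Ltac rv_ring := apply/rowP => ?; rewrite !mxE; ring.

(** * Lebesgue measure on R^n *)

Section outer_measure.
Context {R : realType} {n : nat}.
Local Notation V := 'rV[R]_n.
Local Notation mu := (@lebesgue_outer R n).
Implicit Types (A : set V) (c : V * V).

(** The exponent [2/n] comes from the determinant of the barrier. At distance [t] from the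
    supporting hyperplane its second derivative is of order [t^(gamma-2)] across the hyperplane and
    of order [t^gamma] in the other [n-1] directions. The product is of order [t^(n gamma - 2)] and
    stays bounded below for small [t] exactly when [gamma <= 2/n]. The mixed derivatives are of
    order [t^(gamma-1)], the geometric mean of these two orders, so a depth [M] proportional to
    [r^2] absorbs them at every [t].

    Since [u] need not have second derivatives, the determinant is replaced by a ratio of volumes: a
    box of points, in suitable linear coordinates, against the box of slopes in the dual coordinates
    that these points must attain. The hyperplane is oblique to the axes. Dividing its normal by its
    largest entry gives a vector [c] with entries at most 1 in absolute value, and [c.z] together
    with the remaining coordinates [z_j] is a coordinate system reached by shears. This is why the
    outer measure is studied under translations, diagonal maps and shears. *)

Lemma lebesgue_outer_box_le c : (mu (box c) <= (box_volume c)%:E)%E.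
Proof.
apply: ereal_inf_lbound; exists [set c]; last by rewrite esum_set1 ?box_volume_ge0.
by split; [exact: countable1|move=> x bx; exists c].
Qed.

Lemma lebesgue_outer_countable_bigcup (T : choiceType) (C : set T)
    (F : T -> set V) : countable C ->
  (mu (\bigcup_(c in C) F c) <= \esum_(c in C) mu (F c))%E.
Proof.
move=> /countable_injP[f fi].
pose D k := [set c | C c /\ f c = k].
have tD : trivIset setT D.
  apply/trivIsetP => i j _ _ ij; rewrite -subset0 => c [[_ ci] [_ cj]].
  by move: ij; rewrite -ci -cj eqxx.
have CE : C = \bigcup_k D k.
  by apply/seteqP; split => [c Cc|c [k _ []]//]; exists (f c).
rewrite {2}CE nneseries_sum_bigcup//; last by move=> c; exact: lebesgue_outer_ge0.
pose G k := \bigcup_(c in D k) F c.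
apply: (@le_trans _ _ (mu (\bigcup_k G k))).
  by apply: le_lebesgue_outer => x [c Cc Fx]; exists (f c) => //; exists c.
apply: le_trans (lebesgue_outer_sigma_subadditive G) _.
apply: lee_nneseries => [k _ _|k _]; first exact: lebesgue_outer_ge0.
rewrite /G; have [->|/set0P[c [Cc fc]]] := eqVneq (D k) set0.
  by rewrite bigcup_set0 lebesgue_outer0 esum_set0.
have -> : D k = [set c].
  apply/seteqP; split => [d [Cd fd]|_ ->//]; apply: fi; rewrite ?inE//.
  by rewrite fd.
by rewrite bigcup_set1 esum_set1// lebesgue_outer_ge0.
Qed.

(** Images of boxes decide the matter because [mu] is an infimum over box covers. Translations,
    diagonal maps and shears are handled by this bound; equality follows from the same bound for the
    inverse map. *)
Lemma lebesgue_outer_image_le (T : V -> V) (k : R) A : 0 < k ->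
  (forall c, mu (T @` box c) <= (k * box_volume c)%:E)%E ->
  (mu (T @` A) <= k%:E * mu A)%E.
Proof.
move=> k0 Tk; rewrite -lee_pdivrMl//; apply: le_ereal_inf_tmp => _ [C [cC AC] <-].
rewrite lee_pdivrMl//.
apply: (@le_trans _ _ (mu (\bigcup_(c in C) (T @` box c)))).
  apply: le_lebesgue_outer => _ [x /AC[c Cc xc] <-]; exists c => //; exists x.
apply: le_trans (lebesgue_outer_countable_bigcup (fun c => T @` box c) cC) _.
apply: ub_ereal_sup => _ [X [finX XC] <-].
apply: (@le_trans _ _ (\sum_(c \in X) (k%:E * (box_volume c)%:E))%E).
  by apply: lee_fsum => // c Xc; rewrite -EFinM.
rewrite -ge0_mule_fsumr; last by move=> c; exact: box_volume_ge0.
rewrite lee_pmul2l ?lte_fin//; apply: ereal_sup_ubound.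
by exists X.
Qed.

(** The hyperplane cuts the box into the half-open boxes [lo] and [hi], whose volumes add up. If it
    misses the box, one of the two has a reversed side and volume 0. *)
Lemma box_halfspaceP (i : 'I_n) (t : R) c :
  (mu (box c `&` [set x : V | (x 0%R i <= t)%R]) + mu (box c `&` ~` [set x : V | (x 0%R i <= t)%R])
   <= (box_volume c)%:E)%E.
Proof.
pose lo := (c.1, \row_j (if j == i then Num.min (c.2 0 j) t else c.2 0 j)).
pose hi := (\row_j (if j == i then Num.max (c.1 0 j) t else c.1 0 j), c.2).
apply: (@le_trans _ _ (mu (box lo) + mu (box hi))%E).
  apply: leeD; apply: le_lebesgue_outer => x [cx /=].
    move=> xt j; rewrite /lo /= mxE; have /andP[-> /= xj] := cx j.
    by case: eqP => // ji; rewrite le_min xj ji.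
  move=> /negP; rewrite -ltNge => xt j; rewrite /hi /= mxE; have /andP[xj -> /=] := cx j.
  by rewrite andbT; case: eqP => // ji; rewrite gt_max xj ji.
apply: le_trans (leeD (lebesgue_outer_box_le lo) (lebesgue_outer_box_le hi)) _.
rewrite -EFinD lee_fin /box_volume /= (bigD1 i)//= [X in _ + X](bigD1 i)//= [leRHS](bigD1 i)//=.
have E1 : \prod_(j < n | j != i) Num.max 0 (lo.2 0 j - c.1 0 j) =
          \prod_(j < n | j != i) Num.max 0 (c.2 0 j - c.1 0 j).
  by apply: eq_bigr => j /negbTE ji; rewrite mxE ji.
have E2 : \prod_(j < n | j != i) Num.max 0 (c.2 0 j - hi.1 0 j) =
          \prod_(j < n | j != i) Num.max 0 (c.2 0 j - c.1 0 j).
  by apply: eq_bigr => j /negbTE ji; rewrite mxE ji.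
rewrite E1 E2 -mulrDl !mxE eqxx ler_wpM2r//.
  by apply: prodr_ge0 => j _; rewrite le_max lexx.
move: (c.1 0 i) (c.2 0 i) => a b {lo hi E1 E2}.
case: (leP b t) => ?; case: (leP a t) => ?; by do ![case: (leP 0 _) => ?]; lra.
Qed.

Lemma caratheodory_halfspace (i : 'I_n) (t : R) :
  mu.-caratheodory [set x : V | (x 0%R i <= t)%R].
Proof.
apply: le_caratheodory_measurable => X.
apply: le_ereal_inf_tmp => _ [C [cC XC] <-].
set H := [set x | _].
have sub Y : (mu (X `&` Y) <= \esum_(c in C) mu (box c `&` Y))%E.
  apply: le_trans (lebesgue_outer_countable_bigcup (fun c => box c `&` Y) cC).
  apply: le_lebesgue_outer => x [/XC[c Cc bx] Yx]; exists c => //.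
apply: le_trans (leeD (sub _) (sub _)) _.
rewrite -esumD; [|by move=> c _; exact: lebesgue_outer_ge0..].
by apply: le_esum => c _; exact: box_halfspaceP.
Qed.

Lemma box_empty c (i : 'I_n) : c.2 0 i <= c.1 0 i -> box c = set0.
Proof.
move=> ci; rewrite -subset0 => x /(_ i)/andP[h1 h2].
by have := lt_le_trans h1 (le_trans h2 ci); rewrite ltxx.
Qed.

Let translate_le (h : V) A : (mu ((+%R h) @` A) <= mu A)%E.
Proof.
rewrite -[leRHS]mul1e; apply: lebesgue_outer_image_le => // c.
rewrite mul1r; apply: (@le_trans _ _ (mu (box (h + c.1, h + c.2)))).
  apply: le_lebesgue_outer => _ [x cx <-] i /=.
  by rewrite !mxE ltrD2l lerD2l cx.
apply: le_trans (lebesgue_outer_box_le _) _.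
by rewrite lee_fin /box_volume/= ler_prod// => i _; rewrite le_max lexx/= !mxE opprD addrACA subrr add0r.
Qed.

Lemma lebesgue_outer_translate (h : V) A : mu ((+%R h) @` A) = mu A.
Proof.
apply/eqP; rewrite eq_le translate_le/=.
have AE : A = (+%R (- h)) @` ((+%R h) @` A).
  by rewrite image_comp -[LHS]image_id; apply: eq_imagel => x _ /=; rewrite addKr.
by rewrite {1}AE; exact: translate_le.
Qed.

Definition diag_scale (l : 'I_n -> R) (x : V) : V := \row_i (l i * x 0 i).

Let diag_scale_le (l : 'I_n -> R) A : (forall i, 0 < l i) ->
  (mu (diag_scale l @` A) <= (\prod_i l i)%:E * mu A)%E.
Proof.
move=> l0; apply: lebesgue_outer_image_le => [|c]; first exact: prodr_gt0.
apply: (@le_trans _ _ (mu (box (diag_scale l c.1, diag_scale l c.2)))).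
  apply: le_lebesgue_outer => _ [x cx <-] i /=.
  by rewrite !mxE ltr_pM2l// ler_pM2l// cx.
apply: le_trans (lebesgue_outer_box_le _) _.
rewrite lee_fin /box_volume/= -big_split/= ler_prod// => i _.
by rewrite le_max lexx/= !mxE -mulrBr maxr_pMr ?mulr0// ltW.
Qed.

Lemma lebesgue_outer_diag_scale (l : 'I_n -> R) A : (forall i, 0 < l i) ->
  mu (diag_scale l @` A) = ((\prod_i l i)%:E * mu A)%E.
Proof.
move=> l0; apply/eqP; rewrite eq_le diag_scale_le//=.
have p0 : 0 < \prod_i l i by exact: prodr_gt0.
have AE : A = diag_scale (fun i => (l i)^-1) @` (diag_scale l @` A).
  rewrite image_comp -[LHS]image_id; apply: eq_imagel => x _ /=.
  by apply/rowP => i; rewrite !mxE mulKf// gt_eqF.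
have : (mu A <= (\prod_i (l i)^-1)%:E * mu (diag_scale l @` A))%E.
  by rewrite {1}AE; apply: diag_scale_le => i; rewrite invr_gt0.
by rewrite prodfV lee_pdivlMl.
Qed.

Definition shear (i j : 'I_n) (s : R) (x : V) : V :=
  x + (s * x 0 j) *: delta_mx 0 i.

Lemma shearE i j s x k : shear i j s x 0 k = x 0 k + (k == i)%:R * (s * x 0 j).
Proof. by rewrite !mxE eqxx/= mulrC. Qed.

Lemma shearK i j s : i != j -> cancel (shear i j s) (shear i j (- s)).
Proof.
move=> ij x; apply/rowP => k; rewrite !shearE [j == i]eq_sym (negbTE ij).
by rewrite mul0r addr0 mulNr mulrN addrK.
Qed.

Lemma box_split c (j : 'I_n) (t : R) : c.1 0 j <= t <= c.2 0 j ->
  box c = box (c.1, \row_k (if k == j then t else c.2 0 k)) `|`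
          box (\row_k (if k == j then t else c.1 0 k), c.2).
Proof.
move=> /andP[at1 tb]; apply/seteqP; split => [x cx|x [cx|cx] k].
- have [xt|tx] := leP (x 0 j) t; [left|right] => k /=; rewrite mxE;
    by case: eqP => [->|_]; rewrite ?xt ?tx ?andbT/=; have := cx _; do ?[by move=> /andP[]]; move=> /(_ j)/andP[].
- have := cx k; rewrite /= mxE; case: eqP => // -> /andP[-> /le_trans]; exact.
- have := cx k; rewrite /= mxE; case: eqP => // -> /andP[/(le_lt_trans at1) -> ->] //.
Qed.

(** Halving the box [m] times along [j] gives slices so thin that each sheared slice fits into a box
    longer along [i] by only [|s|] times the width of the slice. The excess volume is halved at each
    stage. *)
Let shear_box_le i j s (m : nat) c : i != j -> (forall k, c.1 0 k < c.2 0 k) ->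
  (mu (shear i j s @` box c) <=
   ((\prod_(k | k != i) (c.2 0 k - c.1 0 k)) *
    (c.2 0 i - c.1 0 i + `|s| * (c.2 0 j - c.1 0 j) / 2 ^+ m))%:E)%E.
Proof.
move=> ij; elim: m c => [|m IHm] c cc.
  pose a' := Num.min (s * c.1 0 j) (s * c.2 0 j).
  pose b' := Num.max (s * c.1 0 j) (s * c.2 0 j).
  pose d := (c.1 + a' *: delta_mx 0 i, c.2 + b' *: delta_mx 0 i).
  apply: (@le_trans _ _ (mu (box d))).
    apply: le_lebesgue_outer => _ [x cx <-] k /=.
    rewrite shearE !mxE eqxx/= !(mulrC _ (k == i)%:R); have /andP[h1 h2] := cx k.
    case: eqP => [_|_]; last by rewrite !mul0r !addr0 h1.
    rewrite !mul1r; have /andP[h3 h4] := cx j.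
    have h3' := ltW h3.
    rewrite ltr_leD// ?lerD// /a' /b' ?ge_min ?le_max; have [s0|s0] := leP 0 s.
    - by rewrite (ler_wpM2l s0 h4) orbT.
    - by rewrite (ler_wnM2l (ltW s0) h3').
    - by rewrite (ler_wpM2l s0 h3').
    - by rewrite (ler_wnM2l (ltW s0) h4) orbT.
  apply: le_trans (lebesgue_outer_box_le _) _.
  rewrite lee_fin /box_volume (bigD1 i)//= mulrC divr1.
  have ba : b' - a' = `|s| * (c.2 0 j - c.1 0 j).
    have cj := ltW (cc j); rewrite /a' /b'; have [s0|/ltW s0] := ger0P s.
      by rewrite max_r ?min_l ?ler_wpM2l// mulrBr.
    by rewrite max_l ?min_r ?ler_wnM2l// mulrBr; ring.
  have ci := ltW (cc i); have cj := ltW (cc j).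
  have P : \prod_(k < n | k != i) Num.max 0 (d.2 0 k - d.1 0 k) = \prod_(k | k != i) (c.2 0 k - c.1 0 k).
    apply: eq_bigr => k /negbTE ki; rewrite !mxE ki andbF !mulr0 !addr0 max_r// subr_ge0.
    exact/ltW/cc.
  rewrite P !mxE !eqxx !mulr1 opprD addrACA ba max_r// addr_ge0 ?subr_ge0//.
  by rewrite mulr_ge0// subr_ge0.
pose t := (c.1 0 j + c.2 0 j) / 2.
have cj := cc j.
have at1 : c.1 0 j < t by rewrite /t; lra.
have tb : t < c.2 0 j by rewrite /t; lra.
rewrite (@box_split c j t) ?(ltW at1) ?(ltW tb)// image_setU.
apply: le_trans (outer_measureU2 _ _ _) _.
set c1 := (c.1, _); set c2 := (_, c.2).
have c1P k : c1.1 0 k < c1.2 0 k by rewrite /c1/= mxE; case: eqP => [->|].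
have c2P k : c2.1 0 k < c2.2 0 k by rewrite /c2/= mxE; case: eqP => [->|].
apply: le_trans (leeD (IHm _ c1P) (IHm _ c2P)) _.
rewrite -EFinD lee_fin.
have ji : j != i by rewrite eq_sym.
rewrite !(bigD1 (P := fun k => k != i) j)//= !mxE eqxx (negbTE ij).
rewrite (eq_bigr (fun k => c.2 0 k - c.1 0 k)); last first.
  by move=> k /andP[_ /negbTE kj]; rewrite mxE kj.
rewrite [X in _ * X * (_ + _ * (c.2 0 j - t) / _)](eq_bigr (fun k => c.2 0 k - c.1 0 k)); last first.
  by move=> k /andP[_ /negbTE kj]; rewrite mxE kj.
rewrite exprS /t le_eqVlt; apply/orP; left; apply/eqP; field.
by rewrite expf_neq0.
Qed.

Lemma lebesgue_outer_shear_le i j s A : i != j ->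
  (mu (shear i j s @` A) <= mu A)%E.
Proof.
move=> ij; rewrite -[leRHS]mul1e; apply: lebesgue_outer_image_le => // c.
rewrite mul1r.
have [[k /box_empty ->]|cc] := pselect (exists k, c.2 0 k <= c.1 0 k).
  by rewrite image_set0 lebesgue_outer0 box_volume_ge0.
have {}cc k : c.1 0 k < c.2 0 k.
  by rewrite ltNge; apply/negP => ck; apply: cc; exists k.
apply/lee_addgt0Pr => e e0.
pose P := \prod_(k | k != i) (c.2 0 k - c.1 0 k).
have P0 : 0 < P by apply: prodr_gt0 => k _; rewrite subr_gt0.
pose X := P * (`|s| * (c.2 0 j - c.1 0 j)).
pose m := Num.truncn (X / e).
have vE : box_volume c = (c.2 0 i - c.1 0 i) * P.
  rewrite /box_volume (bigD1 i)//= max_r ?subr_ge0 ?ltW//; congr (_ * _).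
  by apply: eq_bigr => k _; rewrite max_r// subr_ge0 ltW.
apply: le_trans (shear_box_le s m ij cc) _.
rewrite -EFinD lee_fin vE -/P mulrDr mulrC lerD2l mulrA -/X.
rewrite ler_pdivrMr ?exprn_gt0//.
rewrite mulrC -ler_pdivrMr//; apply: ltW; apply: lt_le_trans (truncnS_gt _) _.
by rewrite -natrX ler_nat ltn_expl.
Qed.

Lemma lebesgue_outer_shear i j s A : i != j ->
  mu (shear i j s @` A) = mu A.
Proof.
move=> ij; apply/eqP; rewrite eq_le lebesgue_outer_shear_le//=.
have AE : A = shear i j (- s) @` (shear i j s @` A).
  by rewrite image_comp -[LHS]image_id; apply: eq_imagel => x _ /=; rewrite shearK.
by rewrite {1}AE; exact: lebesgue_outer_shear_le.
Qed.
Let in_side (c : V * V) (i : 'I_n) (t : R) : R := (c.1 0%R i < t <= c.2 0%R i)%R%:R.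

Let side_length (c : V * V) (i : 'I_n) : R := Num.max 0 (c.2 0 i - c.1 0 i).

Let set_coord (x : V) (i : 'I_n) (t : R) : V :=
  \row_j (if j == i then t else x 0 j).

(* Fubini one coordinate at a time: the first [m] factors of the indicator of
   each covering box have been integrated. *)
Let cover_volume_aux (a b : V) (w : nat -> R) (c : nat -> V * V) (m : nat) :
  (forall i, a 0 i <= b 0 i) -> (forall k, 0 <= w k) ->
  (forall x, box (a, b) x ->
     (1 <= \sum_(k <oo) (w k * \prod_i in_side (c k) i (x 0 i))%:E)%E) ->
  (m <= n)%N -> forall x, box (a, b) x ->
  ((\prod_(i < n) (if (i < m)%N then b 0 i - a 0 i else 1))%:E <=
   \sum_(k <oo) (w k * \prod_(i < n) (if (i < m)%N then side_length (c k) i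
                                     else in_side (c k) i (x 0 i)))%:E)%E.
Proof.
move=> ab w0 wc; elim: m => [|m IHm] mn x abx.
  rewrite big1//; apply: le_trans (wc _ abx) _.
  by apply: lee_nneseries => // k _; rewrite lee_fin mulr_ge0// prodr_ge0.
pose i0 := Ordinal mn.
have im (i : 'I_n) : (i < m.+1)%N = (i == i0) || (i < m)%N.
  by rewrite ltnS leq_eqVlt.
have i0m : (i0 < m)%N = false by rewrite ltnn.
pose K k := w k * \prod_(i < n | i != i0) (if (i < m)%N then side_length (c k) i
                                     else in_side (c k) i (x 0 i)).
have K0 k : 0 <= K k.
  rewrite mulr_ge0// prodr_ge0// => i _; case: ifP => // _.
  by rewrite le_max lexx.
pose P := \prod_(i < n) (if (i < m)%N then b 0 i - a 0 i else 1).
have step t : `]a 0 i0, b 0 i0]%classic t ->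
    (P%:E <= \sum_(k <oo) ((K k)%:E * (in_side (c k) i0 t)%:E))%E.
  rewrite /= in_itv/= => tab.
  apply: le_trans (IHm (ltnW mn) (set_coord x i0 t) _) _.
    move=> i /=; rewrite mxE; case: eqP => [->//|_]; exact: abx.
  apply: lee_nneseries => k _.
    move=> _; rewrite lee_fin mulr_ge0// prodr_ge0// => i _; case: ifP => // _.
    by rewrite le_max lexx.
  rewrite -EFinM lee_fin (bigD1 i0)//= i0m mxE eqxx /K mulrCA mulrC.
  rewrite le_eqVlt; apply/orP; left; apply/eqP; congr (_ * _ * _).
  by apply: eq_bigr => i /negbTE ii; rewrite mxE ii.
have mD : measurable (`]a 0 i0, b 0 i0]%classic : set R) by exact: measurable_itv.
have mI k : measurable (`](c k).1 0 i0, (c k).2 0 i0]%classic : set R) by exact: measurable_itv.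
have sideE k t : in_side (c k) i0 t = \1_(`](c k).1 0 i0, (c k).2 0 i0]%classic : set R) t.
  by rewrite /in_side indicE mem_setE in_itv.
have mside k (D : set R) : measurable_fun D (EFin \o in_side (c k) i0).
  by apply/measurable_EFinP;
    rewrite (_ : in_side _ _ = \1_(`](c k).1 0 i0, (c k).2 0 i0]%classic : set R)) ?funeqE//;
    exact: measurable_indic.
have abi : a 0 i0 < b 0 i0 by have /andP[h1 h2] := abx i0; exact: lt_le_trans h2.
have -> : \prod_(i < n) (if (i < m.+1)%N then b 0 i - a 0 i else 1) = P * (b 0 i0 - a 0 i0).
  rewrite /P (bigD1 i0)//= [in RHS](bigD1 i0)//= ltnS leqnn i0m mul1r mulrC; congr (_ * _).
  by apply: eq_bigr => i /negbTE ii; rewrite im ii.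
have P0 : 0 <= P.
  by apply: prodr_ge0 => i _; case: ifP => // _; rewrite subr_ge0.
pose I := (\int[lebesgue_measure]_(t in (`]a 0%R i0, b 0%R i0]%classic : set R))
    \sum_(k <oo) ((K k)%:E * (in_side (c k) i0 t)%:E))%E.
apply: (@le_trans _ _ I).
  apply: (@le_trans _ _ (\int[lebesgue_measure]_(t in (`]a 0%R i0, b 0%R i0]%classic : set R)) P%:E)%E).
    by rewrite integral_cst//= lebesgue_measure_itv/= lte_fin abi -EFinD -EFinM.
  apply: ge0_le_integral => //.
  apply: ge0_emeasurable_sum => k; first by move=> t _ _; rewrite -EFinM lee_fin mulr_ge0.
  by move=> _; apply: measurable_funeM; exact: mside.
rewrite /I integral_nneseries//; first last.
- by move=> k t _; rewrite -EFinM lee_fin mulr_ge0.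
- by move=> k; apply: measurable_funeM; exact: mside.
apply: lee_nneseries => [k _ _|k _].
  by apply: integral_ge0 => t _; rewrite -EFinM lee_fin mulr_ge0.
rewrite ge0_integralZl_EFin//; [|by move=> t _; rewrite lee_fin|exact: mside].
rewrite (bigD1 i0)//= ltnS leqnn.
have -> : \prod_(i < n | i != i0) (if (i < m.+1)%N then side_length (c k) i
    else in_side (c k) i (x 0 i)) = \prod_(i < n | i != i0) (if (i < m)%N then side_length (c k) i else in_side (c k) i (x 0 i)).
  by apply: eq_bigr => i /negbTE ii; rewrite im ii.
rewrite mulrCA [leRHS]EFinM -/(K k) [leRHS]muleC lee_wpmul2l ?lee_fin//.
under eq_integral => t _ do rewrite sideE.
rewrite integral_indic//.
apply: (@le_trans _ _ (lebesgue_measure (`](c k).1 0 i0, (c k).2 0 i0]%classic : set R))).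
  by apply: le_measure; rewrite ?inE//; exact: measurableI.
rewrite lebesgue_measure_itv/= lte_fin /side_length.
by case: ltP => h; rewrite -?EFinD lee_fin le_max lexx ?orbT.
Qed.

(** At each point of the box the indicators of the covering boxes sum to at least 1;
    [cover_volume_aux] with all [n] coordinates integrated turns this into volumes. It is what gives
    the cube [open_cube] positive measure. *)
Lemma lebesgue_outer_box_ge (c : V * V) : (forall i, c.1 0 i <= c.2 0 i) ->
  ((box_volume c)%:E <= mu (box c))%E.
Proof.
case: c => a b /= ab; apply: le_ereal_inf_tmp => _ [C [/countable_injP[f fi] abC] <-].
pose D k := [set c | C c /\ f c = k].
have tD : trivIset setT D.
  by apply/trivIsetP => i j _ _ ij; rewrite -subset0 => c [[_ ci] [_ cj]]; move: ij; rewrite -ci -cj eqxx.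
have CE : C = \bigcup_k D k.
  by apply/seteqP; split => [c Cc|c [k _ []]//]; exists (f c).
rewrite {1}CE nneseries_sum_bigcup//; last by move=> c; exact: box_volume_ge0.
(* The injection [f] need not be onto: an index [k] without a box gets the weight [w k = 0], and
   [e k] is then the default box. *)
pose w k : R := if `[< D k !=set0 >] then 1 else 0.
pose e k := xget (0, 0) (D k).
have eD k : D k !=set0 -> D k = [set e k].
  move=> [c Dc]; have De : D k (e k) by exact: (xgetPex (0,0) (ex_intro _ c Dc)).
  apply/seteqP; split => [d [Cd fd]|_ ->//]; apply: fi; rewrite ?inE//; first by case: De.
  by rewrite fd; case: De.
have w0 k : 0 <= w k by rewrite /w; case: ifP.
have wc x : box (a, b) x -> (1 <= \sum_(k <oo) (w k * \prod_i in_side (e k) i (x 0 i))%:E)%E.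
  move=> /abC[c Cc cx].
  have t0 k : (0 <= (w k * \prod_i in_side (e k) i (x 0 i))%:E)%E.
    by rewrite lee_fin mulr_ge0// prodr_ge0.
  apply: le_trans (nneseries_lim_ge (f c).+1 _); last by [].
  rewrite big_nat_recr//= -[leLHS]add0e; apply: leeD; first exact: sume_ge0.
  have Dfc : D (f c) !=set0 by exists c.
  have ec : c = e (f c) by have : D (f c) c by []; rewrite eD.
  rewrite lee_fin /w asboolT// mul1r -ec big1// => i _.
  by rewrite /in_side cx.
have := ab; rewrite /box_volume.
case: (boolP `[< exists x, box (a, b) x >]) => [/asboolP[x abx] _|/asboolPn nx _]; last first.
  have [i ci] : exists i, b 0 i <= a 0 i.
    apply: contrapT => H; apply: nx; exists b => i /=; rewrite lexx andbT ltNge.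
    by apply/negP => ba; apply: H; exists i.
  rewrite (bigD1 i)//= max_l ?subr_le0// mul0r; apply: nneseries_ge0 => k _ _.
  by apply: esum_ge0 => *; exact: box_volume_ge0.
have := cover_volume_aux ab w0 wc (leqnn n) abx.
rewrite (eq_bigr (fun i => Num.max 0 ((a, b).2 0 i - (a, b).1 0 i))); last first.
  by move=> i _; rewrite ltn_ord max_r ?subr_ge0.
move=> /le_trans; apply; apply: lee_nneseries => [k _ _|k _].
  rewrite lee_fin mulr_ge0// prodr_ge0// => i _; rewrite ltn_ord.
  by rewrite le_max lexx.
rewrite /w; case: asboolP => Dk; last first.
  by rewrite mul0r; apply: esum_ge0 => *; exact: box_volume_ge0.
rewrite (eD _ Dk) esum_set1 ?box_volume_ge0// lee_fin mul1r.
by rewrite le_eqVlt; apply/orP; left; apply/eqP; apply: eq_bigr => i _; rewrite ltn_ord.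
Qed.
Local Notation T := (caratheodory_type mu).

Definition cbox c : set V := [set x | forall i, c.1 0 i <= x 0 i <= c.2 0 i].

Definition obox c : set V := [set x | forall i, c.1 0 i < x 0 i < c.2 0 i].

Lemma open_rat_box A (x : V) : open A -> A x ->
  exists q : 'rV[rat]_n * 'rV[rat]_n,
    obox (map_mx ratr q.1, map_mx ratr q.2) x /\
    cbox (map_mx ratr q.1, map_mx ratr q.2) `<=` A.
Proof.
move=> oA Ax; have /nbhs_ballP[e /= e0 eA] : nbhs x A by exact: open_nbhs_nbhs.
have lo (i : 'I_n) : {q : rat | x 0 i - e < ratr q < x 0 i}.
  by apply: cid; have [q] := @rat_in_itvoo R (x 0 i - e) (x 0 i) ltac:(lra);
    rewrite in_itv/=; exists q.
have hi (i : 'I_n) : {q : rat | x 0 i < ratr q < x 0 i + e}.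
  by apply: cid; have [q] := @rat_in_itvoo R (x 0 i) (x 0 i + e) ltac:(lra);
    rewrite in_itv/=; exists q.
exists (\row_i sval (lo i), \row_i sval (hi i)); split => [i|y cy].
  rewrite /= !mxE; case: (lo i) => q1 /= /andP[_ ->].
  by case: (hi i) => q2 /= /andP[-> _].
apply: eA; split => // j i; rewrite ord1; have := cy i; rewrite /= !mxE.
case: (lo i) => q1 /= /andP[h1 _]; case: (hi i) => q2 /= /andP[_ h2] /andP[h3 h4].
by rewrite /ball/= ltr_norml; lra.
Qed.

Lemma box_sub_cbox c : box c `<=` cbox c.
Proof. by move=> x cx i; have /andP[/ltW -> ->] := cx i. Qed.

Lemma obox_sub_box c : obox c `<=` box c.
Proof. by move=> x cx i; have /andP[-> /ltW ->] := cx i. Qed.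

(** The same sequence serves two purposes: the open boxes cover [A], and the closed ones are compact
    subsets of [A], on which locally integrable functions are integrable. *)
Lemma open_bigcup_box A : open A -> A !=set0 ->
  exists c : nat -> V * V,
    [/\ A = \bigcup_k cbox (c k), A = \bigcup_k obox (c k) &
        forall k, obox (c k) `<=` cbox (c k)].
Proof.
move=> oA [x0 Ax0].
pose P (q : 'rV[rat]_n * 'rV[rat]_n) : Prop :=
  cbox (map_mx ratr q.1, map_mx ratr q.2) `<=` A.
(* An index that encodes no admissible rational box gets the degenerate box at [x0], whose closed
   box is the single point [x0] of [A]. *)
pose c k : V * V := if unpickle k is Some q then
    if `[< P q >] then (map_mx ratr q.1, map_mx ratr q.2) else (x0, x0)
  else (x0, x0).
have x00 : cbox (x0, x0) `<=` A.
  move=> x xx; suff -> : x = x0 by [].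
  by apply/rowP => i; apply/eqP; rewrite eq_le; have /andP[/= -> ->] := xx i.
have cA k : cbox (c k) `<=` A.
  rewrite /c; case: unpickle => [q|]; last exact: x00.
  by case: asboolP => // _; exact: x00.
have Ac x : A x -> exists k, obox (c k) x.
  move=> Ax; have [q [qx qA]] := open_rat_box oA Ax.
  by exists (pickle q); rewrite /c pickleK asboolT.
have oc k : obox (c k) `<=` cbox (c k).
  by apply: subset_trans (@box_sub_cbox _); exact: obox_sub_box.
exists c; split => //.
- apply/seteqP; split => [x /Ac[k xk]|x [k _ /cA]//].
  by exists k => //; exact: oc.
- apply/seteqP; split => [x /Ac[k xk]|x [k _ /oc/cA]//].
  by exists k.
Qed.

Lemma measurable_halfspace (i : 'I_n) (t : R) :
  measurable ([set x : V | (x 0%R i <= t)%R] : set T).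
Proof. exact: caratheodory_halfspace. Qed.

Lemma measurable_cbox c : measurable (cbox c : set T).
Proof.
have -> : cbox c = \bigcap_(i in [set: 'I_n])
    ([set x : V | (x 0%R i <= c.2 0%R i)%R] `\` \bigcup_(k in [set: nat])
       [set x : V | (x 0%R i <= c.1 0%R i - k.+1%:R^-1)%R]).
  apply/seteqP; split => [x cx i _ /=|x cx i].
    have /andP[h ->] := cx i; split => // -[k _ /=]; apply/negP; rewrite -ltNge.
    by rewrite ltrBlDr (le_lt_trans h)// ltrDl invr_gt0.
  have [/= -> nk] := cx i I; rewrite andbT leNgt; apply/negP => xc.
  apply: nk; have d0 : 0 < c.1 0 i - x 0 i by rewrite subr_gt0.
  exists (Num.truncn (c.1 0 i - x 0 i)^-1) => //=.
  rewrite lerBrDl -lerBrDr -[leRHS]invrK lef_pV2 ?posrE ?invr_gt0// ltW//.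
  exact: truncnS_gt.
apply: (@fin_bigcap_measurable _ T) => [|i _]; first exact: finite_finset.
apply: measurableD; first exact: measurable_halfspace.
by apply: bigcupT_measurable => k; exact: measurable_halfspace.
Qed.

Lemma measurable_open A : open A -> measurable (A : set T).
Proof.
move=> oA; have [->|/set0P A0] := eqVneq A set0; first exact: measurable0.
have [c [-> _ _]] := open_bigcup_box oA A0.
by apply: bigcup_measurable => k _; exact: measurable_cbox.
Qed.

Lemma measurable_closed A : closed A -> measurable (A : set T).
Proof.
by move=> cA; rewrite -(setCK A); apply: measurableC; apply: measurable_open; rewrite openC.
Qed.

Lemma compact_cbox c : compact (cbox c).
Proof.
have -> : cbox c = [set v : V | forall i, `[c.1 0 i, c.2 0 i]%classic (v ord0 i)].
  by apply/seteqP; split => x cx i; have := cx i; rewrite /= in_itv.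
apply: (@rV_compact _ _ (fun i => `[c.1 0 i, c.2 0 i]%classic)) => i.
exact: segment_compact.
Qed.

Lemma closed_cbox c : closed (cbox c).
Proof. by apply: compact_closed; [exact: norm_hausdorff|exact: compact_cbox]. Qed.

Lemma lebesgue_outer_lty A (r : R) : (forall x i, A x -> `|x 0 i| <= r) ->
  (mu A < +oo)%E.
Proof.
move=> Ar; apply: (@le_lt_trans _ _ (mu (box (const_mx (- r - 1), const_mx r)))).
  apply: le_lebesgue_outer => x /Ar xr i; rewrite !mxE; have := xr i.
  by rewrite ler_norml => /andP[h ->]; rewrite andbT; lra.
by apply: le_lt_trans (lebesgue_outer_box_le _) _; rewrite ltry.
Qed.

Lemma compact_coord_bounded A : compact A ->
  exists r : R, forall x i, A x -> `|x 0 i| <= r.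
Proof.
move=> /compact_bounded[M [_ /(_ (M + 1))]]; rewrite ltrDl ltr01 => /(_ isT) h.
exists (M + 1) => x i /h; apply: le_trans.
have /mapP[j Hj ->] : `|x 0 i| \in [seq `|x k.1 k.2| | k : 'I_1 * 'I_n].
  by apply/mapP; exists (0, i) => //=; rewrite mem_enum.
by rewrite [leRHS]/Num.norm/= mx_normrE; apply/bigmax_geP; right => /=; exists j.
Qed.

Lemma compact_lebesgue_outer_lty A : compact A -> (mu A < +oo)%E.
Proof. by move=> /compact_coord_bounded[r /lebesgue_outer_lty]. Qed.

Lemma compact_measurable A : compact A -> measurable (A : set T).
Proof.
move=> cA; apply: measurable_closed; exact: compact_closed.
Qed.

End outer_measure.

(** * Convex domains *)

Section euclidean_space.
Context {R : realType} {n : nat}.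
Local Notation V := 'rV[R]_n.
Implicit Types (x y z : V) (A : set V).

Lemma dotmxC x y : dotmx x y = dotmx y x.
Proof. by apply: eq_bigr => i _; rewrite mulrC. Qed.

Lemma dotmxDl x y z : dotmx (x + y) z = dotmx x z + dotmx y z.
Proof. by rewrite -big_split; apply: eq_bigr => i _; rewrite mxE mulrDl. Qed.

Lemma dotmxDr x y z : dotmx z (x + y) = dotmx z x + dotmx z y.
Proof. by rewrite dotmxC dotmxDl !(dotmxC z). Qed.

Lemma dotmxZl a x y : dotmx (a *: x) y = a * dotmx x y.
Proof. by rewrite /dotmx mulr_sumr; apply: eq_bigr => i _; rewrite mxE mulrA. Qed.

Lemma dotmxZr a x y : dotmx x (a *: y) = a * dotmx x y.
Proof. by rewrite dotmxC dotmxZl dotmxC. Qed.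

Lemma dotmxNl x y : dotmx (- x) y = - dotmx x y.
Proof. by rewrite -scaleN1r dotmxZl mulN1r. Qed.

Lemma dotmxNr x y : dotmx x (- y) = - dotmx x y.
Proof. by rewrite dotmxC dotmxNl dotmxC. Qed.

Definition dotmxE := (dotmxDl, dotmxDr, dotmxZl, dotmxZr, dotmxNl, dotmxNr).

Lemma dotmx_addZ x y (s : R) : dotmx (x + s *: y) (x + s *: y) =
  dotmx x x + 2 * s * dotmx x y + s ^+ 2 * dotmx y y.
Proof. by rewrite !dotmxE (dotmxC y x); ring. Qed.

Lemma dotmx_ge0 x : 0 <= dotmx x x.
Proof. by apply: sumr_ge0 => i _; rewrite -expr2 sqr_ge0. Qed.

Lemma dotmx_delta x i : dotmx x (delta_mx 0 i) = x 0 i.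
Proof.
rewrite /dotmx (bigD1 i)//= mxE !eqxx mulr1 big1 ?addr0// => j /negbTE ji.
by rewrite mxE ji andbF mulr0.
Qed.

Lemma enorm_ge0 x : 0 <= enorm x. Proof. exact: sqrtr_ge0. Qed.

Lemma enorm_sqr x : enorm x ^+ 2 = dotmx x x.
Proof. by rewrite sqr_sqrtr// dotmx_ge0. Qed.

Lemma enormZ a x : enorm (a *: x) = `|a| * enorm x.
Proof.
by rewrite /enorm dotmxZl dotmxZr mulrA -expr2 sqrtrM ?sqr_ge0// sqrtr_sqr.
Qed.

Lemma enormN x : enorm (- x) = enorm x.
Proof. by rewrite -scaleN1r enormZ normrN1 mul1r. Qed.

Lemma enormB x y : enorm (x - y) = enorm (y - x).
Proof. by rewrite -enormN opprB. Qed.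

Lemma enorm0 : enorm (0 : V) = 0.
Proof. by rewrite -(scale0r 0) enormZ normr0 mul0r. Qed.

Lemma coord_le_enorm x i : `|x 0 i| <= enorm x.
Proof.
rewrite -sqrtr_sqr ler_wsqrtr// /dotmx (bigD1 i)//= -expr2 lerDl.
by apply: sumr_ge0 => j _; rewrite -expr2 sqr_ge0.
Qed.

Lemma enorm_eq0 x : enorm x = 0 -> x = 0.
Proof.
move=> x0; apply/rowP => i; rewrite mxE; apply/eqP; rewrite -normr_le0.
by rewrite -x0 coord_le_enorm.
Qed.

Lemma enorm_gt0 x : x != 0 -> 0 < enorm x.
Proof.
move=> x0; rewrite lt_neqAle enorm_ge0 andbT; apply/eqP => /esym/enorm_eq0.
exact/eqP.
Qed.

Lemma cauchy_schwarz x y : dotmx x y <= enorm x * enorm y.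
Proof.
have [->|x0] := eqVneq x 0.
  by rewrite -(scale0r 0) dotmxZl enormZ normr0 !mul0r.
have [->|y0] := eqVneq y 0.
  by rewrite -(scale0r 0) dotmxZr enormZ normr0 !(mul0r, mulr0).
have := dotmx_ge0 (enorm y *: x - enorm x *: y).
rewrite !dotmxE -!enorm_sqr (dotmxC y x).
have x1 := enorm_gt0 x0; have y1 := enorm_gt0 y0.
have xy : 0 < 2 * (enorm x * enorm y) by rewrite mulr_gt0// mulr_gt0.
move=> h; rewrite -(ler_pM2l xy); lra.
Qed.

Lemma ler_enormD x y : enorm (x + y) <= enorm x + enorm y.
Proof.
rewrite -(@ler_pXn2r _ 2)// ?nnegrE ?enorm_ge0// ?addr_ge0 ?enorm_ge0//.
rewrite enorm_sqr !dotmxE -!enorm_sqr (dotmxC y x).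
have := cauchy_schwarz x y; rewrite sqrrD mulr2n; lra.
Qed.

Lemma ler_enormB x y z : enorm (x - z) <= enorm (x - y) + enorm (y - z).
Proof. by rewrite -(subrKA y) ler_enormD. Qed.

Lemma enorm_le_coord x (r : R) : 0 <= r -> (forall i, `|x 0 i| <= r) ->
  enorm x <= Num.sqrt n%:R * r.
Proof.
move=> r0 xr; rewrite -(ger0_norm r0) -sqrtr_sqr -sqrtrM ?ler0n// ler_wsqrtr//.
rewrite mulr_natl -[X in _ *+ X]card_ord -sumr_const; apply: ler_sum => i _.
by rewrite -expr2 -real_normK ?num_real// ler_pXn2r// ?nnegrE.
Qed.

Lemma continuous_sum (U : topologicalType) (I : Type) (s : seq I) (f : I -> U -> R) :
  (forall i, continuous (f i)) -> continuous (fun t : U => \sum_(i <- s) f i t).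
Proof.
by move=> cf; apply: continuous_big => //; exact: add_continuous.
Qed.

Lemma continuous_dotmx (x : V) : continuous (dotmx x).
Proof.
apply: continuous_sum => i y.
by apply: continuousM; [exact: cst_continuous|exact: coord_continuous].
Qed.

Lemma enorm_continuous : continuous (@enorm R n).
Proof.
move=> x; apply: (@continuous_comp _ _ _ (fun x => dotmx x x) Num.sqrt); last exact: sqrt_continuous.
apply: continuous_sum => i y.
by apply: continuousM; exact: coord_continuous.
Qed.

Lemma nbhs_enormP x A :
  nbhs x A <-> exists2 e : R, 0 < e & forall y, enorm (y - x) < e -> A y.
Proof.
split=> [/nbhs_ballP[e /= e0 eA]|[e e0 eA]].
  exists e => // y xy; apply: eA; split => // i j; rewrite ord1 /ball/=.
  have := coord_le_enorm (y - x) j; rewrite !mxE distrC => /le_lt_trans; exact.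
apply: filterS (_ : nbhs x [set y | enorm (y - x) < e]) => //.
have c : {for x, continuous (fun y : V => enorm (y - x))}.
  apply: (@continuous_comp _ _ _ (fun y : V => y - x) (@enorm R n)); last exact: enorm_continuous.
  by apply: (@continuousB R V V id (cst x)); [exact: cvg_id|exact: (@cst_continuous V V x)].
apply: (c [set r | r < e]); rewrite /= subrr enorm0.
by apply: open_nbhs_nbhs; split => //; exact: open_lt.
Qed.

Lemma open_enorm A x : open A -> A x ->
  exists2 e : R, 0 < e & forall y, enorm (y - x) < e -> A y.
Proof. by move=> oA Ax; apply/nbhs_enormP; exact: open_nbhs_nbhs. Qed.

Lemma closure_enormP A x :
  closure A x <-> forall e : R, 0 < e -> exists2 y, A y & enorm (y - x) < e.
Proof.
split=> [cA e e0|H B /nbhs_enormP[e e0 eB]].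
  have [|y [Ay /= xy]] := cA [set y | enorm (y - x) < e]; last by exists y.
  by apply/nbhs_enormP; exists e.
by have [y Ay xy] := H _ e0; exists y; split => //; exact: eB.
Qed.

Lemma within_continuous_enormP A (u : V -> R) :
  {within A, continuous u} <-> forall x, A x -> forall e : R, 0 < e ->
  exists2 d : R, 0 < d & forall y, A y -> enorm (y - x) < d -> `|u y - u x| < e.
Proof.
rewrite subspace_continuousP; split=> H x Ax.
  move=> e e0; have /cvgrPdist_lt/(_ e e0) := H x Ax.
  move=> /nbhs_enormP[d d0 dA]; exists d => // y Ay xy.
  by rewrite distrC; exact: dA.
apply/cvgrPdist_lt => e e0; have [d d0 dA] := H x Ax e e0.
by apply/nbhs_enormP; exists d => // y xy Ay; rewrite distrC; exact: dA.
Qed.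

Lemma within_continuousD A (u v : V -> R) : {within A, continuous u} ->
  continuous v -> {within A, continuous (fun x => u x + v x)}.
Proof.
move=> cu cv x; apply: (continuousD (cu x)).
by apply: continuous_subspaceT => y; exact: cv.
Qed.

Lemma continuous_dotmx_sqr (a : V) : continuous (fun x => dotmx (x - a) (x - a)).
Proof.
move=> x; apply: (@continuous_comp _ _ _ (fun w : V => w - a) (fun w : V => dotmx w w)).
  by apply: (@continuousB R V V id (cst a)); [exact: cvg_id|exact: (@cst_continuous V V a)].
by apply: continuous_sum => i w; apply: continuousM; exact: coord_continuous.
Qed.

Lemma eball_closed_compact A (r : R) : closed A -> A `<=` eball r -> compact A.
Proof.
move=> cA Ar; have -> : A = cbox (const_mx (-r), const_mx r) `&` A.
  apply/seteqP; split => [x Ax|x []//]; split => // i; rewrite /= !mxE.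
  by rewrite -ler_norml (le_trans (coord_le_enorm _ _))// ltW//; exact: Ar.
by apply: compact_closedI => //; exact: compact_cbox.
Qed.

Lemma convex_setP A : convex_set A -> forall x y (t : R), A x -> A y ->
  0 <= t <= 1 -> A (x + t *: (y - x)).
Proof.
move=> cA x y t Ax Ay /andP[t0 t1].
have := cA y x (Itv01 t0 t1); rewrite !inE => /(_ Ay Ax).
congr A; rewrite /conv/= /unstable.onem scalerBl scale1r scalerBr.
by rewrite addrCA addrA addrC addrA.
Qed.

Lemma convex_functionP A (u : V -> R) : convex_function A u ->
  forall x y (t : R), A x -> A y -> 0 <= t <= 1 ->
  u (x + t *: (y - x)) <= (1 - t) * u x + t * u y.
Proof.
move=> cu x y t Ax Ay /andP[t0 t1].
have := cu (Itv01 t0 t1) y x; rewrite !inE => /(_ Ay Ax).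
rewrite /conv/= /unstable.onem scalerBl scale1r scalerBr.
by rewrite addrCA [leRHS]addrC.
Qed.

End euclidean_space.

Section distance.
Context {R : realType} {n : nat}.
Local Notation V := 'rV[R]_n.
Implicit Types (x y z : V) (B : set V).

Lemma edist_to_le x z B : B z -> edist_to x B <= enorm (x - z).
Proof.
move=> Bz; apply: ge_inf; last by exists z.
by exists 0 => _ [y _ <-]; exact: enorm_ge0.
Qed.

Lemma edist_to_ge x B (d : R) : B !=set0 -> (forall z, B z -> d <= enorm (x - z)) ->
  d <= edist_to x B.
Proof.
move=> [z Bz] dB; apply: lb_le_inf; first by exists (enorm (x - z)), z.
by move=> _ [y By <-]; exact: dB.
Qed.

Lemma edist_to_ge0 x B : 0 <= edist_to x B.
Proof.
have [->|/set0P B0] := eqVneq B set0; first by rewrite /edist_to image_set0 inf0.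
by apply: edist_to_ge => // z _; exact: enorm_ge0.
Qed.

Lemma edist_to_lip x y B : edist_to y B <= edist_to x B + enorm (y - x).
Proof.
have [->|/set0P B0] := eqVneq B set0.
  by rewrite /edist_to !image_set0 inf0 add0r enorm_ge0.
rewrite -lerBlDr; apply: edist_to_ge => // z Bz; rewrite lerBlDr.
by rewrite (le_trans (edist_to_le _ Bz))// [leRHS]addrC ler_enormB.
Qed.

Lemma edist_to_continuous B : continuous (edist_to ^~ B).
Proof.
move=> x; apply/(@cvgrPdist_lt _ _ _ (nbhs x) _) => e e0.
apply/nbhs_enormP; exists e => // y xy /=.
rewrite (le_lt_trans _ xy)// ler_distl lerBlDr edist_to_lip/=.
by rewrite enormB edist_to_lip.
Qed.

End distance.

Section convex_domain.
Context {R : realType} {n : nat}.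
Local Notation V := 'rV[R]_n.
Variables (Omega : set V) (r : R).
Hypotheses (Omega_ball : Omega `<=` eball r) (Omega_open : open Omega)
  (Omega_convex : convex_set Omega).
Implicit Types x y z : V.
Local Notation bd := (boundary Omega).
Local Notation dist x := (edist_to x bd).

Lemma boundaryP z : bd z <-> closure Omega z /\ ~ Omega z.
Proof. by rewrite /boundary; move/interior_id : Omega_open => ->. Qed.

Lemma closure_split z : closure Omega z -> Omega z \/ bd z.
Proof.
move=> cz; have [Oz|nOz] := pselect (Omega z); first by left.
by right; apply/boundaryP.
Qed.

Lemma boundary_closure z : bd z -> closure Omega z.
Proof. by case. Qed.

Lemma closure_eball z : closure Omega z -> enorm z <= r.
Proof.
move=> cz; apply/ler_addgt0Pr => e e0.
have [y Oy yz] := (closure_enormP _ _).1 cz e e0.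
have := ler_enormD y (z - y); rewrite addrC subrK enormB.
by have := Omega_ball Oy; rewrite /eball/=; lra.
Qed.

Lemma compact_closure_domain : compact (closure Omega).
Proof.
apply: (@eball_closed_compact _ _ _ (r + 1)); first exact: closed_closure.
by move=> z /closure_eball; rewrite /eball/=; lra.
Qed.

Lemma compact_boundary : compact bd.
Proof.
rewrite (_ : bd = closure Omega `&` ~` Omega); last first.
  by apply/seteqP; split => z /boundaryP.
apply: compact_closedI; first exact: compact_closure_domain.
by rewrite closedC.
Qed.

(** [s] is the supremum of the times that the ray spends in [Omega]: boundedness makes it finite,
    convexity fills in all smaller times, and openness keeps the supremum itself outside. *)
Lemma exit_point y (v : V) : Omega y -> v != 0 ->
  exists2 s : R, 0 < s &
    bd (y + s *: v) /\ forall t, 0 <= t < s -> Omega (y + t *: v).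
Proof.
move=> Oy v0; have v1 := enorm_gt0 v0.
pose E := [set t : R | 0 <= t /\ Omega (y + t *: v)].
have E0 : E 0 by split; rewrite // scale0r addr0.
have step t : E t -> exists2 t', t < t' & E t'.
  move=> [t0 Ot]; have [e e0 eO] := open_enorm Omega_open Ot.
  exists (t + e / (2 * enorm v)); first by rewrite ltrDl divr_gt0// mulr_gt0.
  split; first by rewrite addr_ge0// divr_ge0 ?ltW// mulr_gt0.
  apply: eO; rewrite (_ : _ - _ = (e / (2 * enorm v)) *: v); last by rv_ring.
  rewrite enormZ.
  rewrite ger0_norm ?divr_ge0 ?mulr_ge0 ?(ltW e0) ?(ltW v1)//.
  by rewrite invfM mulrA mulfVK ?gt_eqF//; lra.
have sE : has_sup E.
  split; first by exists 0.
  exists ((r + enorm y) / enorm v) => t [t0 Ot].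
  rewrite ler_pdivlMr// -(ger0_norm t0) -enormZ.
  have := ler_enormD (y + t *: v) (- y); rewrite enormN addrAC subrr add0r.
  by have := Omega_ball Ot; rewrite /eball/=; lra.
have [t1 t10 Et1] := step _ E0.
have s0 : 0 < sup E by apply: lt_le_trans t10 _; exact: sup_upper_bound.
have inE' t : 0 <= t < sup E -> Omega (y + t *: v).
  move=> /andP[t0 ts].
  have [t' [t'0 Ot'] tt'] : exists2 t', E t' & t < t'.
    by apply: sup_gt => //; exists 0.
  have t'1 : 0 < t' by exact: le_lt_trans tt'.
  have := @convex_setP _ _ _ Omega_convex y (y + t' *: v) (t / t') Oy Ot'.
  rewrite divr_ge0//= ler_pdivrMr// mul1r (ltW tt') => /(_ isT).
  by rewrite [_ - y]addrAC subrr add0r scalerA mulfVK// gt_eqF.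
exists (sup E) => //; split=> //; apply/boundaryP; split.
  apply/closure_enormP => e e0.
  pose t := sup E - Num.min (sup E) (e / (2 * enorm v)).
  have m1 : Num.min (sup E) (e / (2 * enorm v)) <= sup E by rewrite ge_min lexx.
  have m2 : Num.min (sup E) (e / (2 * enorm v)) <= e / (2 * enorm v) by rewrite ge_min lexx orbT.
  have m0 : 0 < Num.min (sup E) (e / (2 * enorm v)).
    by rewrite lt_min s0 divr_gt0// mulr_gt0.
  exists (y + t *: v).
    by apply: inE'; rewrite subr_ge0 m1/= ltrBlDr ltrDl.
  set m := Num.min _ _ in t m1 m2 m0 *.
  rewrite (_ : _ - _ = (- m) *: v); last by rewrite /t; rv_ring.
  rewrite enormZ normrN.
  rewrite gtr0_norm//; apply: (@le_lt_trans _ _ (e / (2 * enorm v) * enorm v)).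
    by rewrite ler_pM2r.
  by rewrite invfM mulrA mulfVK ?gt_eqF//; lra.
move=> Os; have /step[t st Et] : E (sup E) by split=> //; exact: ltW.
by have := lt_le_trans st (sup_upper_bound sE Et); rewrite ltxx.
Qed.

Lemma boundary_neq0 x : (0 < n)%N -> Omega x -> bd !=set0.
Proof.
move=> n0 Ox; have v0 : delta_mx 0 (Ordinal n0) != 0 :> V.
  apply/eqP => /rowP/(_ (Ordinal n0)); rewrite !mxE !eqxx/= => /eqP.
  by rewrite oner_eq0.
by have [s _ [bs _]] := exit_point Ox v0; exists (x + s *: delta_mx 0 (Ordinal n0)).
Qed.

Lemma nearest_boundary x : bd !=set0 -> exists2 z, bd z & dist x = enorm (x - z).
Proof.
move=> b0; have c : {within bd, continuous (fun z => enorm (x - z))}.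
  apply/within_continuous_enormP => z _ e e0; exists e => // y _ yz.
  rewrite (le_lt_trans _ yz)// ler_distl; apply/andP; split.
    by rewrite lerBlDr (le_trans (ler_enormB _ y _))// addrC.
  by rewrite (le_trans (ler_enormB _ z _))// (enormB z).
have [z] := EVT_min_rV b0 compact_boundary c.
rewrite inE => bz zm; exists z => //; apply/eqP; rewrite eq_le edist_to_le//=.
by apply: edist_to_ge => // y By; apply: zm; rewrite inE.
Qed.

Lemma dist_gt0 x : bd !=set0 -> Omega x -> 0 < dist x.
Proof.
move=> b0 Ox; have [z bz ->] := nearest_boundary x b0.
apply: enorm_gt0; apply/eqP => /subr0_eq xz.
by have /boundaryP[_] := bz; rewrite -xz.
Qed.

(** Otherwise the segment from [x] to [y] would meet the boundary at a distance less than
    [dist x]. *)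
Lemma dist_ball x y : Omega x -> enorm (y - x) < dist x -> Omega y.
Proof.
move=> Ox yx; have [->//|] := eqVneq y x; rewrite -subr_eq0 => v0.
have [s s0 [bs Os]] := exit_point Ox v0.
have [s1|s1] := leP s 1; last first.
  have := Os 1; rewrite scale1r addrC subrK s1 ler01; exact.
have := edist_to_le x bs; rewrite opprD addrA subrr add0r enormN enormZ.
rewrite gtr0_norm// leNgt (le_lt_trans _ yx)//.
by rewrite ler_piMl ?enorm_ge0.
Qed.

Lemma dist_le_diam x : bd !=set0 -> Omega x -> dist x <= 2 * r.
Proof.
move=> b0 Ox; have [z bz ->] := nearest_boundary x b0.
have := ler_enormD x (- z); rewrite enormN.
have := closure_eball (boundary_closure bz).
by have := Omega_ball Ox; rewrite /eball/=; lra.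
Qed.

(** If [y] violated the inequality, a slightly shifted [y'] in [Omega] would lie strictly on the
    wrong side of the hyperplane. Prolonging the segment from [y'] to [z] a little beyond [z] enters
    the ball of radius [dist x] around [x], so [z] would lie between two points of [Omega]. *)
Lemma supporting_halfspace x z y : Omega x -> bd z -> dist x = enorm (x - z) ->
  Omega y -> 0 < dotmx (x - z) (y - z).
Proof.
move=> Ox bz xz Oy; rewrite ltNge; apply/negP => dy.
have b0 : bd !=set0 by exists z.
have d0 := dist_gt0 b0 Ox.
have [e e0 eO] := open_enorm Omega_open Oy.
pose y' := y - (e / (2 * dist x)) *: (x - z).
have Oy' : Omega y'.
  apply: eO; rewrite /y' addrAC subrr add0r enormN enormZ -xz.
  rewrite ger0_norm ?divr_ge0 ?mulr_ge0 ?ltW//.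
  by rewrite invfM mulrA mulfVK ?gt_eqF//; lra.
pose c := - dotmx (x - z) (y' - z).
have c0 : 0 < c.
  rewrite /c oppr_gt0 /y' addrAC dotmxDr dotmxNr dotmxZr -enorm_sqr -xz.
  have : 0 < e / (2 * dist x) * dist x ^+ 2 by rewrite mulr_gt0 ?divr_gt0 ?mulr_gt0 ?exprn_gt0.
  by lra.
pose q := dotmx (y' - z) (y' - z).
have q0 : 0 < q.
  rewrite lt_neqAle dotmx_ge0 andbT eq_sym /q -enorm_sqr sqrf_eq0.
  apply/eqP => /enorm_eq0/subr0_eq yz; have /boundaryP[_] := bz; by rewrite -yz.
(* This [s] minimises [- 2 s c + s^2 q], the change of the squared distance to [x] on passing from
   [z] to [p]. *)
pose s := c / q; have s0 : 0 < s by rewrite divr_gt0.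
pose p := z - s *: (y' - z).
have Op : Omega p.
  apply: (dist_ball Ox).
  rewrite -(@ltr_pXn2r _ 2)// ?nnegrE ?enorm_ge0// ?(ltW d0)//.
  rewrite xz !enorm_sqr.
  have -> : p - x = - ((x - z) + s *: (y' - z)) by rewrite /p; rv_ring.
  rewrite dotmxNl dotmxNr opprK dotmx_addZ -/q -[dotmx (x - z) (y' - z)]opprK -/c.
  have -> : s ^+ 2 * q = s * c by rewrite expr2 -mulrA /s mulfVK ?gt_eqF.
  have : 0 < s * c by rewrite mulr_gt0.
  by lra.
have /boundaryP[_] := bz; apply.
have s1 : 0 < 1 + s by lra.
have := @convex_setP _ _ _ Omega_convex p y' (s / (1 + s)) Op Oy'.
have -> : 0 <= s / (1 + s) <= 1.
  by rewrite divr_ge0 ?(ltW s0) ?(ltW s1)//= ler_pdivrMr// mul1r; lra.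
move=> /(_ isT); congr Omega.
have -> : y' - p = (1 + s) *: (y' - z).
  by rewrite /p; rv_ring.
by rewrite scalerA mulfVK ?gt_eqF// /p subrK.
Qed.

End convex_domain.

(** * Bounds from convexity up to the boundary *)

Section boundary_estimates.
Context {R : realType} {n : nat}.
Local Notation V := 'rV[R]_n.
Variables (Omega : set V) (r : R).
Hypotheses (Omega_ball : Omega `<=` eball r) (Omega_open : open Omega)
  (Omega_convex : convex_set Omega).
Implicit Types x y z : V.
Local Notation bd := (boundary Omega).
Local Notation dist x := (edist_to x bd).

Lemma closure_convex x y (t : R) : closure Omega x -> closure Omega y ->
  0 <= t <= 1 -> closure Omega (x + t *: (y - x)).
Proof.
move=> cx cy t01; apply/closure_enormP => e e0.
have [x' Ox' x'x] := (closure_enormP _ _).1 cx e e0.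
have [y' Oy' y'y] := (closure_enormP _ _).1 cy e e0.
exists (x' + t *: (y' - x')); first exact: convex_setP.
rewrite (_ : _ - _ = (1 - t) *: (x' - x) + t *: (y' - y)); last by rv_ring.
apply: le_lt_trans (ler_enormD _ _) _; rewrite !enormZ.
have /andP[t0 t1] := t01; rewrite !ger0_norm ?subr_ge0//.
have [->|tn0] := eqVneq t 0; first by rewrite subr0 mul1r mul0r addr0.
have {}t0 : 0 < t by rewrite lt_neqAle eq_sym tn0.
have h1 : (1 - t) * enorm (x' - x) <= (1 - t) * e by rewrite ler_wpM2l ?subr_ge0// ltW.
have h2 : t * enorm (y' - y) < t * e by rewrite ltr_pM2l.
by lra.
Qed.

(** The chord runs from the nearest boundary point [z] through [y] to the exit point [b]. The point
    [b] may be far away, at distance [s * dist y], but it carries only the weight [1 / (1 + s)]; as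
    [s^alpha <= s], its contribution is still of order [dist y^alpha]. *)
Lemma chord_upper_bound (u g : V -> R) (K alpha : R) y :
  {within closure Omega, continuous u} -> convex_function Omega u ->
  (forall x, bd x -> u x = g x) -> 0 <= K -> 0 <= alpha <= 1 ->
  (forall x y, closure Omega x -> closure Omega y ->
     `|g x - g y| <= K * enorm (x - y) `^ alpha) ->
  bd !=set0 -> Omega y -> u y <= g y + 2 * K * dist y `^ alpha.
Proof.
move=> cu convu ug K0 /andP[a0 a1] gK b0 Oy.
have [z bz dz] := nearest_boundary Omega_ball Omega_open y b0.
have d0 := dist_gt0 Omega_ball Omega_open b0 Oy.
pose v := y - z.
have v0 : v != 0.
  by apply/eqP => v0; move: d0; rewrite dz -/v v0 enorm0 ltxx.
have [s s0 [bs Os]] := exit_point Omega_ball Omega_open Omega_convex Oy v0.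
set b := y + s *: v in bs.
have yb : enorm (y - b) = s * dist y.
  by rewrite /b opprD addrA subrr add0r enormN enormZ gtr0_norm// dz.
(* The exit point is a boundary point too, hence no nearer to [y] than [z] is. *)
have s1 : 1 <= s.
  by have := edist_to_le y bs; rewrite yb -{1}[dist y]mul1r ler_pM2r.
have cl x : Omega x -> closure Omega x by exact: subset_closure.
have cz := boundary_closure bz.
have cb := boundary_closure bs.
have ps : 0 < 1 + s by lra.
(* Convexity is known only inside [Omega], so the chord is first shrunk towards [y] by a factor [t]
   close to 1, which keeps the weights; continuity on the closure then reaches both ends. *)
have chord : u y <= s / (1 + s) * u z + (1 + s)^-1 * u b.
  apply/ler_addgt0Pr => e e0.
  have [d1 d10 D1] := (within_continuous_enormP _ _).1 cu z cz e e0.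
  have [d2 d20 D2] := (within_continuous_enormP _ _).1 cu b cb e e0.
  pose q := Num.min d1 d2 / (2 * s * dist y).
  have m0 : 0 < Num.min d1 d2 by rewrite lt_min d10.
  have q0 : 0 < q by rewrite divr_gt0 ?mulr_gt0.
  pose t := 1 - Num.min q (1/2).
  have mq : Num.min q (1/2) <= q by rewrite ge_min lexx.
  have mh : Num.min q (1/2) <= 1/2 by rewrite ge_min lexx orbT.
  have mp : 0 < Num.min q (1/2) by rewrite lt_min q0/=; lra.
  have t0 : 0 < t by rewrite /t; lra.
  have t1 : t < 1 by rewrite /t; lra.
  have qd : q * (s * dist y) < Num.min d1 d2.
    have -> : q * (s * dist y) = Num.min d1 d2 / 2.
      by rewrite /q; field; rewrite !gt_eqF.
    by lra.
  have qs : q * dist y <= q * (s * dist y).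
    by rewrite ler_pM2l// ler_peMl// ltW.
  have Oa : Omega (y - t *: v).
    apply: (dist_ball Omega_ball Omega_open Omega_convex Oy).
    rewrite addrAC subrr add0r enormN enormZ gtr0_norm// /v -dz.
    by rewrite gtr_pMl.
  have Ob : Omega (y + (t * s) *: v).
    apply: Os; rewrite mulr_ge0 ?(ltW t0) ?(ltW s0)//=.
    by rewrite gtr_pMl.
  have ua : u (y - t *: v) < u z + e.
    rewrite -ltrBlDl; apply: le_lt_trans (ler_norm _) _; apply: D1; first exact: cl.
    rewrite (_ : _ - _ = (1 - t) *: v); last by rewrite /v; rv_ring.
    rewrite enormZ /v -dz gtr0_norm ?subr_gt0// /t subKr.
    apply: le_lt_trans (_ : q * (s * dist y) < _).
      by apply: le_trans qs; rewrite ler_pM2r.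
    by apply: lt_le_trans qd _; rewrite ge_min lexx.
  have ub : u (y + (t * s) *: v) < u b + e.
    rewrite -ltrBlDl; apply: le_lt_trans (ler_norm _) _; apply: D2; first exact: cl.
    rewrite (_ : _ - _ = (- ((1 - t) * s)) *: v); last by rewrite /b; rv_ring.
    rewrite enormZ /v -dz normrN ger0_norm ?mulr_ge0 ?subr_ge0 ?(ltW t1) ?(ltW s0)//.
    rewrite /t subKr -mulrA; apply: le_lt_trans (_ : q * (s * dist y) < _).
      by rewrite ler_pM2r// mulr_gt0.
    by apply: lt_le_trans qd _; rewrite ge_min lexx orbT.
  have : u y <= s / (1 + s) * u (y - t *: v) + (1 + s)^-1 * u (y + (t * s) *: v).
    have := convex_functionP convu (t := (1 + s)^-1) Oa Ob.
    have -> : 0 <= (1 + s)^-1 <= 1.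
      by rewrite invr_ge0 (ltW ps)/= invf_le1//; lra.
    move=> /(_ isT).
    have -> : y - t *: v + (1 + s)^-1 *: (y + (t * s) *: v - (y - t *: v)) = y.
      by apply/rowP => i; rewrite !mxE; field; rewrite gt_eqF.
    by congr (_ <= _ * _ + _); field; rewrite gt_eqF.
  move=> /le_trans; apply.
  have h1 : s / (1 + s) * u (y - t *: v) <= s / (1 + s) * (u z + e).
    by rewrite ler_pM2l ?divr_gt0// ltW.
  have h2 : (1 + s)^-1 * u (y + (t * s) *: v) <= (1 + s)^-1 * (u b + e).
    by rewrite ler_pM2l ?invr_gt0// ltW.
  have -> : s / (1 + s) * u z + (1 + s)^-1 * u b + e =
    s / (1 + s) * (u z + e) + (1 + s)^-1 * (u b + e) by field; rewrite gt_eqF.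
  exact: lerD.
apply: le_trans chord _; rewrite (ug _ bz) (ug _ bs).
have gz : g z <= g y + K * dist y `^ alpha.
  rewrite -lerBlDl; apply: le_trans (ler_norm _) _.
  by rewrite dz -enormB; apply: gK => //; exact: cl.
have gb : g b <= g y + K * (s * dist y `^ alpha).
  rewrite -lerBlDl; apply: le_trans (ler_norm _) _.
  apply: le_trans (gK _ _ cb (cl _ Oy)) _; rewrite enormB yb ler_wpM2l//.
  rewrite powRM ?(ltW s0) ?(ltW d0)// ler_wpM2r ?powR_ge0//.
  by rewrite -[leRHS]powRr1 ?(ltW s0)// ler_powR.
have K1 : 0 <= K * dist y `^ alpha by rewrite mulr_ge0 ?powR_ge0.
apply: (@le_trans _ _ (s / (1 + s) * (g y + K * dist y `^ alpha) +
    (1 + s)^-1 * (g y + K * (s * dist y `^ alpha)))).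
  by apply: lerD; rewrite ler_pM2l ?divr_gt0// ?invr_gt0.
have -> : s / (1 + s) * (g y + K * dist y `^ alpha) +
    (1 + s)^-1 * (g y + K * (s * dist y `^ alpha)) =
  g y + 2 * (s / (1 + s)) * (K * dist y `^ alpha) by field; rewrite gt_eqF.
rewrite lerD2l -[2 * K * _]mulrA ler_wpM2r//.
by rewrite ger_pMr// ler_pdivrMr// mul1r; lra.
Qed.

(** The point [y] minimises [g] plus the penalty [k |y - x|^2] over the compact closure. The
    first-order condition at [y] makes [- 2 k (y - x)] a subgradient of [g] there, and a large [k]
    forces [y] close to [x]. This works at every point of the closure, without a separation
    theorem. *)
Lemma affine_minorant (g : V -> R) x (e : R) :
  {within closure Omega, continuous g} -> convex_function (closure Omega) g ->
  closure Omega x -> 0 < e -> exists y xi,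
  (forall z, closure Omega z -> g y + dotmx xi (z - y) <= g z) /\
  g x - e <= g y + dotmx xi (x - y).
Proof.
move=> cg convg cx e0.
have c0 : closure Omega !=set0 by exists x.
have cc := compact_closure_domain Omega_ball.
have [m] := EVT_min_rV c0 cc cg; rewrite inE => cm gm.
have [d d0 dg] := (within_continuous_enormP _ _).1 cg x cx e e0.
have gxm : g m <= g x by apply: gm; rewrite inE.
(* The penalty at distance [d] then exceeds the largest possible gain [g x - g m], so the minimiser
   stays within [d] of [x]. *)
pose k := (g x - g m + 1) / d ^+ 2.
have k0 : 0 < k by rewrite divr_gt0 ?exprn_gt0//; lra.
pose F y := g y + k * dotmx (y - x) (y - x).
have cF : {within closure Omega, continuous F}.
  apply: within_continuousD => // y.
  by apply: (@cvgMl_tmp R V (nbhs y) _ _ k); exact: continuous_dotmx_sqr.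
have [y] := EVT_min_rV c0 cc cF; rewrite inE => cy Fy.
have yx : k * dotmx (y - x) (y - x) <= g x - g m.
  have := Fy x; rewrite inE => /(_ cx); rewrite /F subrr.
  have -> : dotmx (0 : V) 0 = 0 by rewrite -enorm_sqr enorm0 expr0n.
  have := gm y; rewrite inE => /(_ cy); lra.
have yd : enorm (y - x) < d.
  rewrite -(@ltr_pXn2r _ 2)// ?nnegrE ?enorm_ge0 ?(ltW d0)// enorm_sqr.
  rewrite -(ltr_pM2l k0); apply: le_lt_trans yx _.
  by rewrite /k mulfVK ?gt_eqF ?exprn_gt0//; lra.
have gyx : g x - e <= g y.
  by have := dg y cy yd; rewrite ltr_norml => /andP[]; lra.
exists y, ((- 2 * k) *: (y - x)); split => [z cz|]; last first.
  rewrite dotmxZl -(opprB y x) dotmxNr.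
  have : 0 <= k * dotmx (y - x) (y - x) by rewrite mulr_ge0 ?dotmx_ge0 ?(ltW k0).
  lra.
rewrite dotmxZl; set D := dotmx (y - x) (z - y).
pose q := dotmx (z - y) (z - y).
have q0 : 0 <= q by exact: dotmx_ge0.
(* Minimality along the segment from [y] to [z] leaves a remainder proportional to [s], which is
   sent to 0. *)
suff H (s : R) : 0 < s <= 1 -> 0 <= (g z - g y + 2 * k * D) + s * (k * q).
  apply/ler_addgt0Pr => e' e'0.
  pose s := Num.min 1 (e' / (k * q + 1)).
  have kq : 0 < k * q + 1 by rewrite ltr_wpDl// mulr_ge0// ltW.
  have s0 : 0 < s by rewrite lt_min ltr01 divr_gt0.
  have s1 : s <= 1 by rewrite ge_min lexx.
  have s2 : s * (k * q + 1) <= e' by rewrite -ler_pdivlMr// ge_min lexx orbT.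
  by have := H s; rewrite s0 s1 => /(_ isT); lra.
move=> /andP[s0 s1].
have s01 : 0 <= s <= 1 by rewrite (ltW s0).
have cs := closure_convex cy cz s01.
have := Fy (y + s *: (z - y)); rewrite inE => /(_ cs).
have gs := convex_functionP convg cy cz s01.
rewrite /F (_ : y + _ - x = (y - x) + s *: (z - y)); last by rv_ring.
rewrite dotmx_addZ -/D -/q => Fs.
rewrite -(ler_pM2l s0) mulr0.
have -> : s * (g z - g y + 2 * k * D + s * (k * q)) =
   s * (g z - g y) + k * (2 * s * D + s ^+ 2 * q) by ring.
by lra.
Qed.

End boundary_estimates.

(** * Lower bounds from the Monge-Ampere inequality *)

Section sub_paraboloid.
Context {R : realType} {n : nat}.
Local Notation V := 'rV[R]_n.
Local Notation mu := (@lebesgue_outer R n).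
Implicit Types (x y z p xi c : V) (A : set V).

(** Products of shears that replace a determinant: [row_shear] with weights [- c 0 j] recovers [z]
    from the coordinates [c.z], [z_j], and [col_shear] with weights [c 0 j] is its inverse
    transpose, acting on slopes. *)
Definition row_shear (i : 'I_n) (m : 'I_n -> R) (s : seq 'I_n) : V -> V :=
  foldr (fun j f => shear i j (m j) \o f) id s.

Definition col_shear (i : 'I_n) (m : 'I_n -> R) (s : seq 'I_n) : V -> V :=
  foldr (fun j f => shear j i (m j) \o f) id s.

Lemma row_shearE i m s z k : i \notin s ->
  row_shear i m s z 0 k = z 0 k + (k == i)%:R * \sum_(j <- s) m j * z 0 j.
Proof.
elim: s k => [|j s IHs] k /=; first by rewrite big_nil mulr0 addr0.
rewrite inE negb_or => /andP[ij si]; rewrite shearE !IHs// big_cons.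
by rewrite [j == i]eq_sym (negbTE ij) mul0r addr0 mulrDr addrA addrAC.
Qed.

Lemma col_shearE i m s z k : i \notin s -> uniq s ->
  col_shear i m s z 0 k = z 0 k + (k \in s)%:R * (m k * z 0 i).
Proof.
elim: s k => [|j s IHs] k /=; first by rewrite mul0r addr0.
rewrite inE negb_or => /andP[ij si] /andP[js us]; rewrite shearE !IHs// inE.
rewrite (negbTE si) mul0r addr0; case: (eqVneq k j) => [->|kj] /=.
  by rewrite (negbTE js) mul0r addr0.
by rewrite mul0r addr0.
Qed.

Lemma lebesgue_outer_row_shear i m s A : i \notin s ->
  mu (row_shear i m s @` A) = mu A.
Proof.
elim: s => [|j s IHs] /=; first by rewrite image_id.
rewrite inE negb_or => /andP[ij si].
by rewrite -image_comp lebesgue_outer_shear// IHs.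
Qed.

Lemma lebesgue_outer_col_shear i m s A : i \notin s ->
  mu (col_shear i m s @` A) = mu A.
Proof.
elim: s => [|j s IHs] /=; first by rewrite image_id.
rewrite inE negb_or => /andP[ij si].
by rewrite -image_comp lebesgue_outer_shear 1?eq_sym// IHs.
Qed.

(** The common unit of volume for [slab] and [dual_slab]; its measure is positive and finite and
    cancels from their comparison. *)
Definition open_cube : set V := [set z | forall j, `|z 0 j| < 1].

Lemma open_cube_gt0 : (0 < mu open_cube)%E.
Proof.
apply: (@lt_le_trans _ _ (mu (box (const_mx (- (1 / 2)), const_mx (1 / 2))))).
  apply: lt_le_trans (lebesgue_outer_box_ge _).
    rewrite lte_fin; apply: prodr_gt0 => i _; rewrite /= !mxE lt_max.
    by apply/orP; right; lra.
  by move=> i /=; rewrite !mxE; lra.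
by apply: le_lebesgue_outer => z cz i; have := cz i; rewrite /= !mxE ltr_norml; lra.
Qed.

Lemma open_cube_lty : (mu open_cube < +oo)%E.
Proof. by apply: (@lebesgue_outer_lty _ _ _ 1) => z i /(_ i)/ltW. Qed.

Variables (i : 'I_n) (c : V).
Hypothesis ci1 : c 0 i = 1.

Let s := [seq j <- index_enum 'I_n | j != i].

Let si : i \notin s. Proof. by rewrite mem_filter eqxx. Qed.

Let us : uniq s. Proof. by rewrite filter_uniq// index_enum_uniq. Qed.

Let sE j : (j \in s) = (j != i). Proof. by rewrite mem_filter mem_index_enum andbT. Qed.

Let sum_s (F : 'I_n -> R) : \sum_(j <- s) F j = \sum_(j | j != i) F j.
Proof. by rewrite big_filter. Qed.

(* [slab] is the set where [|c.z| < l i] and [|z_j| < l j] for [j <> i];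
   [dual_slab] is the corresponding set in the coordinates dual to
   [c.z, z_j (j <> i)]. *)
Definition slab (l : 'I_n -> R) : set V :=
  [set z | forall j, `|if j == i then dotmx c z else z 0 j| < l j].

Definition dual_slab (l : 'I_n -> R) : set V :=
  [set xi | forall j, `|if j == i then xi 0 i else xi 0 j - c 0 j * xi 0 i| < l j].

Lemma dotmx_split z : dotmx c z = z 0 i + \sum_(j | j != i) c 0 j * z 0 j.
Proof. by rewrite /dotmx (bigD1 i)//= ci1 mul1r. Qed.

Lemma dual_pairing xi z : dotmx xi z =
  xi 0 i * dotmx c z + \sum_(j | j != i) (xi 0 j - c 0 j * xi 0 i) * z 0 j.
Proof.
rewrite dotmx_split /dotmx (bigD1 i)//= mulrDr -addrA; congr (_ + _).
by rewrite mulr_sumr -big_split; apply: eq_bigr => j _ /=; ring.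
Qed.

Lemma mu_slab l : (forall j, 0 < l j) ->
  mu (slab l) = ((\prod_j l j)%:E * mu open_cube)%E.
Proof.
move=> l0; rewrite -lebesgue_outer_diag_scale//.
rewrite -[RHS](lebesgue_outer_row_shear (fun j => - c 0 j) _ si).
have sumN z : \sum_(j <- s) - c 0 j * z 0 j = - \sum_(j | j != i) c 0 j * z 0 j.
  by rewrite sum_s -sumrN; apply: eq_bigr => j _; rewrite mulNr.
congr (mu _); apply/seteqP; split => [z lz|_ [_ [w cw <-] <-] j].
  pose w : V := \row_j (if j == i then dotmx c z else z 0 j).
  exists w; last first.
    apply/rowP => k; rewrite row_shearE// sumN mxE.
    rewrite (eq_bigr (fun j => c 0 j * z 0 j)); last first.
      by move=> j /negbTE ji; rewrite mxE ji.
    case: eqP => [->|_]; last by rewrite mul0r addr0.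
    by rewrite mul1r dotmx_split addrK.
  exists (\row_j (w 0 j / l j)); last first.
    by apply/rowP => j; rewrite !mxE mulrC divfK// gt_eqF.
  move=> j; rewrite mxE normrM normfV (gtr0_norm (l0 j)) ltr_pdivrMr// mul1r mxE.
  exact: lz.
have lw k : `|l k * w 0 k| < l k.
  by rewrite normrM (gtr0_norm (l0 k)) gtr_pMr.
case: eqP => [->|/eqP ji]; last first.
  by rewrite row_shearE// (negbTE ji) mul0r addr0 mxE.
rewrite dotmx_split row_shearE// eqxx mul1r sumN.
rewrite [X in _ + X](eq_bigr (fun j => c 0 j * diag_scale l w 0 j)).
  by rewrite subrK mxE.
by move=> k /negbTE ki; rewrite row_shearE// ki mul0r addr0.
Qed.

Lemma mu_dual_slab l : (forall j, 0 < l j) ->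
  mu (dual_slab l) = ((\prod_j l j)%:E * mu open_cube)%E.
Proof.
move=> l0; rewrite -lebesgue_outer_diag_scale//.
rewrite -[RHS](lebesgue_outer_col_shear (fun j => c 0 j) _ si).
congr (mu _); apply/seteqP; split => [z lz|_ [_ [w cw <-] <-] j].
  pose w : V := \row_j (if j == i then z 0 i else z 0 j - c 0 j * z 0 i).
  exists w; last first.
    apply/rowP => k; rewrite col_shearE// sE !mxE eqxx.
    by case: eqP => [->|_] /=; rewrite ?mul0r ?addr0// mul1r subrK.
  exists (\row_j (w 0 j / l j)); last first.
    by apply/rowP => j; rewrite !mxE mulrC divfK// gt_eqF.
  move=> j; rewrite mxE normrM normfV (gtr0_norm (l0 j)) ltr_pdivrMr// mul1r mxE.
  exact: lz.
have lw k : `|l k * w 0 k| < l k.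
  by rewrite normrM (gtr0_norm (l0 k)) gtr_pMr.
rewrite !col_shearE// !sE eqxx/= mul0r addr0.
case: eqP => [->|/eqP ji] /=; first by rewrite mxE.
by rewrite mul1r addrK mxE.
Qed.

Let slab_coord j z := if j == i then dotmx c z else z 0 j.

Let slab_coord_continuous j : continuous (slab_coord j).
Proof.
rewrite /slab_coord; case: eqP => _; first exact: continuous_dotmx.
by move=> z; exact: coord_continuous.
Qed.

Let open_slab l : open (slab l).
Proof.
rewrite openE => z lz.
apply: (@filter_forall _ _ (fun j w => `|slab_coord j w| < l j) (nbhs z)) => j.
apply: open_nbhs_nbhs; split; last exact: lz.
rewrite (_ : (fun w => _) = slab_coord j @^-1` `]- l j, l j[%classic).
  by apply: open_comp => [w _|]; [exact: slab_coord_continuous|exact: itv_open].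
by apply/seteqP; split => w /=; rewrite in_itv/= -ltr_norml.
Qed.

Let closed_slab (l : 'I_n -> R) : set V := [set z | forall j, `|slab_coord j z| <= l j].

Let closed_slab_enorm l (B : R) z : (forall j, `|c 0 j| <= 1) -> 0 <= B ->
  (forall j, l j <= B) -> closed_slab l z -> enorm z <= Num.sqrt n%:R * (B * (1 + n%:R)).
Proof.
move=> c1 B0 lB lz; apply: enorm_le_coord.
  by rewrite mulr_ge0// addr_ge0.
have zj j : j != i -> `|z 0 j| <= B.
  by move=> /negbTE ji; have := lz j; rewrite /slab_coord ji => /le_trans; exact.
move=> j; have [->|/zj h] := eqVneq j i; last first.
  by apply: le_trans h _; rewrite ler_peMr// lerDl.
have -> : z 0 i = dotmx c z - \sum_(j | j != i) c 0 j * z 0 j.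
  by rewrite dotmx_split addrK.
apply: le_trans (ler_normB _ _) _; rewrite mulrDr mulr1; apply: lerD.
  by have := lz i; rewrite /slab_coord eqxx => /le_trans; exact.
apply: le_trans (ler_norm_sum _ _ _) _.
apply: (@le_trans _ _ (\sum_(j < n | j != i) B)).
  apply: ler_sum => k ki; rewrite normrM -[leRHS]mul1r.
  by rewrite ler_pM//; exact: zj.
rewrite sumr_const -[leLHS]mulr_natr ler_wpM2l// ler_nat.
by apply: leq_trans (max_card _) _; rewrite card_ord.
Qed.

Let compact_closed_slab l : (forall j, `|c 0 j| <= 1) -> compact (closed_slab l).
Proof.
move=> c1; pose B := \sum_j `|l j|.
have lB j : l j <= B.
  rewrite (le_trans (ler_norm _))// /B (bigD1 j)//= lerDl.
  by apply: sumr_ge0 => k _.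
have B0 : 0 <= B by apply: sumr_ge0 => k _.
apply: (@eball_closed_compact _ _ _ (Num.sqrt n%:R * (B * (1 + n%:R)) + 1)); last first.
  by move=> z /(closed_slab_enorm c1 B0 lB); rewrite /eball/=; lra.
have -> : closed_slab l = \bigcap_(j in [set: 'I_n]) (slab_coord j @^-1` `[- l j, l j]%classic).
  by apply/seteqP; split => z lz j => [_|]; have := lz j; rewrite /= in_itv/= -ler_norml; apply.
apply: closed_bigI => j _; apply: closed_comp => [w _|]; first exact: slab_coord_continuous.
exact: itv_closed.
Qed.

(* The slopes in [p + dual_slab (q l / 2n)] are all attained on [x + slab l],
   which bounds the product of the second derivatives [q] from above. *)
Lemma sub_paraboloid (Omega : set V) (u : V -> R) (L a b : R) x p (e : R) :
  (forall j, `|c 0 j| <= 1) ->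
  (forall y, Omega y -> forall e : R, 0 < e -> exists2 d : R, 0 < d &
     forall y', Omega y' -> enorm (y' - y) < d -> `|u y' - u y| < e) ->
  convex_set Omega -> convex_function Omega u -> 0 < a -> 0 < b -> 0 < e ->
  (forall z, enorm z < e -> Omega (x + z) /\
     u x + dotmx p z + a * dotmx c z ^+ 2 + b * \sum_(j | j != i) z 0 j ^+ 2
       <= u (x + z)) ->
  0 <= L ->
  (forall A, open A -> A `<=` Omega ->
     (mu (\bigcup_(y in A) subdifferential Omega u y) <= L%:E * mu A)%E) ->
  \prod_(j < n) ((if j == i then a else b) / (2 * n%:R)) <= L.
Proof.
move=> c1 cu convO convu a0 b0 e0 ue L0 MA.
have N0 : 0 < n%:R :> R by rewrite ltr0n; apply: leq_ltn_trans (ltn_ord i).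
pose q j := if j == i then a else b.
have q0 j : 0 < q j by rewrite /q; case: ifP.
have sq0 j : 0 < Num.sqrt (q j) by rewrite sqrtr_gt0.
pose M0 := (Num.sqrt a)^-1 + (Num.sqrt b)^-1.
have sa0 : 0 < (Num.sqrt a)^-1 by rewrite invr_gt0 sqrtr_gt0.
have sb0 : 0 < (Num.sqrt b)^-1 by rewrite invr_gt0 sqrtr_gt0.
have M00 : 0 < M0 by rewrite addr_gt0.
have sn0 : 0 < Num.sqrt n%:R :> R by rewrite sqrtr_gt0.
(* With half-widths [l j = k / sqrt (q j)] the quadratic term of each slab coordinate equals [k^2]
   on the corresponding faces. The value of [k] makes the closed slab fit into the ball of radius
   [e]. *)
pose k := e / (2 * (Num.sqrt n%:R * (M0 * (1 + n%:R)))).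
have k0 : 0 < k by rewrite divr_gt0// !mulr_gt0// addr_gt0.
pose l j := k / Num.sqrt (q j).
have l0 j : 0 < l j by rewrite divr_gt0.
have ql j : q j * l j ^+ 2 = k ^+ 2.
  by rewrite /l expr_div_n sqr_sqrtr ?ltW// mulrC divfK// gt_eqF.
have lB j : l j <= k * M0.
  rewrite /l ler_pM2l// /q /M0; case: ifP => _; first by rewrite lerDl ltW.
  by rewrite lerDr ltW.
have small z : closed_slab l z -> enorm z < e.
  move=> /(closed_slab_enorm c1 (ltW (mulr_gt0 k0 M00)) lB) /le_lt_trans; apply.
  have -> : Num.sqrt n%:R * (k * M0 * (1 + n%:R)) = e / 2.
    by rewrite /k; field; rewrite !gt_eqF// addr_gt0.
  by lra.
have lc z : slab l z -> closed_slab l z by move=> lz j; apply/ltW/lz.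
pose A := [set y | slab l (y - x)].
have AE : A = (+%R x) @` slab l.
  apply/seteqP; split => [y Ay|_ [z lz <-]].
    by exists (y - x) => //; rewrite addrC subrK.
  by rewrite /A/= addrAC subrr add0r.
have oA : open A.
  apply: (@open_comp _ _ (fun y : V => y - x)) => // y _.
  by apply: (@continuousB R V V id (cst x)); [exact: cvg_id|exact: (@cst_continuous V V x)].
have AO : A `<=` Omega.
  by move=> y /lc/small/ue[+ _]; rewrite addrC subrK.
(* Slopes of this size satisfy [|xi.z| <= n * k^2 / (2 n) = k^2 / 2] on the closed slab. This is
   less than the rise [k^2] at the faces, so tilting by [xi] cannot push the minimum onto a face. *)
pose sg j := q j * l j / (2 * n%:R).
have sg0 j : 0 < sg j.
  by rewrite divr_gt0//; apply: mulr_gt0 => //; exact: l0.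
have key : (+%R p) @` dual_slab sg `<=` \bigcup_(y in A) subdifferential Omega u y.
  move=> _ [xi sxi <-].
  pose phi z := u (x + z) - dotmx (p + xi) z.
  have cphi : {within closed_slab l, continuous phi}.
    apply: within_continuousD; last first.
      by move=> z; apply: continuousN; exact: continuous_dotmx.
    apply/within_continuous_enormP => z lz e' e'0.
    have [Oz _] := ue _ (small _ lz).
    have [d d0 H] := cu _ Oz e' e'0.
    exists d => // z' lz' zz'; apply: H; first by have [] := ue _ (small _ lz').
    by rewrite opprD addrACA subrr add0r.
  have ne0 : closed_slab l !=set0.
    exists 0 => j; rewrite /slab_coord mxE; case: ifP => _; last by rewrite normr0 ltW.
    by rewrite -(scale0r 0) dotmxZr mul0r normr0 ltW.
  have [z0] := EVT_min_rV ne0 (compact_closed_slab c1) cphi.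
  rewrite inE => lz0 zmin.
  have phi0 : phi z0 <= u x.
    have := zmin 0; rewrite inE /phi addr0 -{2}(scale0r 0) dotmxZr mul0r subr0; apply.
    case: ne0 => _ _ j; rewrite /slab_coord mxE; case: ifP => _; last by rewrite normr0 ltW.
    by rewrite -(scale0r 0) dotmxZr mul0r normr0 ltW.
  have pairing : `|dotmx xi z0| <= k ^+ 2 / 2.
    have H j (t w : R) : `|t| <= sg j -> `|w| <= l j -> `|t * w| <= k ^+ 2 / (2 * n%:R).
      move=> tj wj; rewrite normrM.
      apply: (@le_trans _ _ (sg j * l j)); first by rewrite ler_pM.
      by rewrite -(ql j) /sg le_eqVlt; apply/orP; left; apply/eqP; ring.
    rewrite dual_pairing; apply: le_trans (ler_normD _ _) _.
    apply: (@le_trans _ _ (\sum_(j < n) k ^+ 2 / (2 * n%:R))); last first.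
      rewrite sumr_const card_ord -[leLHS]mulr_natr.
      by rewrite le_eqVlt; apply/orP; left; apply/eqP; field; rewrite gt_eqF.
    rewrite [leRHS](bigD1 i)//=; apply: lerD.
      apply: (H i); first by have := sxi i; rewrite eqxx => /ltW.
      by have := lz0 i; rewrite /slab_coord eqxx.
    apply: le_trans (ler_norm_sum _ _ _) _; apply: ler_sum => j ji.
    apply: (H j); first by have := sxi j; rewrite (negbTE ji) => /ltW.
    by have := lz0 j; rewrite /slab_coord (negbTE ji).
  have lz : slab l z0.
    move=> j; rewrite -/(slab_coord j z0) lt_neqAle lz0 andbT; apply/eqP => zj.
    have [_ uz] := ue _ (small _ lz0).
    have : k ^+ 2 <= a * dotmx c z0 ^+ 2 + b * \sum_(j | j != i) z0 0 j ^+ 2.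
      have zk : q j * slab_coord j z0 ^+ 2 = k ^+ 2.
        by rewrite -real_normK ?num_real// zj ql.
      rewrite -zk /q /slab_coord; case: (eqVneq j i) => [_|ji].
        by rewrite lerDl mulr_ge0 ?(ltW b0)// sumr_ge0// => m _; rewrite sqr_ge0.
      have h1 : 0 <= a * dotmx c z0 ^+ 2 by rewrite mulr_ge0 ?sqr_ge0 ?(ltW a0).
      apply: le_trans (_ : b * \sum_(j0 | j0 != i) z0 0 j0 ^+ 2 <= _); last by rewrite lerDr.
      rewrite ler_pM2l// (bigD1 j)//= lerDl.
      by apply: sumr_ge0 => m _; rewrite sqr_ge0.
    move: phi0 uz pairing; rewrite /phi dotmxDl ler_norml => phi0 uz /andP[_ h] h2.
    have : 0 < k ^+ 2 by rewrite exprn_gt0.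
    by lra.
  (* The minimum is interior, hence local; convexity makes it global. The inequality is taken at a
     point of the segment towards [y] that still lies in the slab, and divided by [t]. *)
  exists (x + z0); first by rewrite /A/= addrAC subrr add0r.
  move=> y Oy; pose w := y - (x + z0).
  have oS : nbhs z0 (slab l) by apply: open_nbhs_nbhs; split => //; exact: open_slab.
  have [d d0 dS] := (nbhs_enormP _ _).1 oS.
  pose t := Num.min 1 (d / (2 * (enorm w + 1))).
  have w1 : 0 < enorm w + 1 by rewrite ltr_wpDl// enorm_ge0.
  have t0 : 0 < t by rewrite lt_min ltr01 divr_gt0// mulr_gt0.
  have t1 : t <= 1 by rewrite ge_min lexx.
  have td : t * enorm w < d.
    apply: (@le_lt_trans _ _ (d / (2 * (enorm w + 1)) * (enorm w + 1))).
      by rewrite ler_pM ?enorm_ge0 ?(ltW t0) ?ge_min ?lexx ?orbT ?lerDl.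
    by rewrite invfM mulrA mulfVK ?gt_eqF//; lra.
  have lzt : closed_slab l (z0 + t *: w).
    by apply/lc/dS; rewrite addrAC subrr add0r enormZ gtr0_norm.
  have := zmin (z0 + t *: w); rewrite inE => /(_ lzt); rewrite /phi addrA.
  have [Oz0 _] := ue _ (small _ lz0).
  have := convex_functionP convu Oz0 Oy (t := t); rewrite (ltW t0) t1 => /(_ isT).
  rewrite -/w (dotmxDr z0) dotmxZr => h1 h2.
  rewrite -(ler_pM2l t0); lra.
have := MA _ oA AO; rewrite AE lebesgue_outer_translate -AE mu_slab//.
have : (mu (dual_slab sg) <= mu (\bigcup_(y in A) subdifferential Omega u y))%E.
  by rewrite -(lebesgue_outer_translate p); exact: le_lebesgue_outer.
move=> /le_trans h1 /h1; rewrite mu_dual_slab// muleA lee_pmul2r; first last.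
- exact: open_cube_gt0.
- by rewrite ge0_fin_numE ?open_cube_lty// lebesgue_outer_ge0.
rewrite -EFinM lee_fin.
have -> : \prod_j sg j = (\prod_(j < n) (q j / (2 * n%:R))) * \prod_j l j.
  by rewrite -big_split/=; apply: eq_bigr => j _; rewrite /sg mulrAC.
by rewrite ler_pM2r// prodr_gt0.
Qed.

End sub_paraboloid.

(** * Second-order inequalities for powers *)

Section power_inequalities.
Context {R : realType}.
Implicit Types (x y t s g : R).

Lemma amgm_powR x y t : 0 < x -> 0 < y -> 0 <= t <= 1 ->
  x `^ t * y `^ (1 - t) <= t * x + (1 - t) * y.
Proof.
move=> x0 y0 /andP[t0 t1].
rewrite /powR !gt_eqF// -expRD -[in leRHS](lnK x0) -[in leRHS](lnK y0).
exact: (convex_expR (Itv01 t0 t1) (ln x) (ln y)).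
Qed.

Lemma sqrt_upper_quadratic s : `|s| <= 1 ->
  Num.sqrt (1 + s) <= 1 + s / 2 - s ^+ 2 / 16.
Proof.
rewrite ler_norml => /andP[s0 s1].
have h : 0 <= 1 + s / 2 - s ^+ 2 / 16 by nra.
rewrite -(ger0_norm h) -sqrtr_sqr ler_wsqrtr//.
have -> : (1 + s / 2 - s ^+ 2 / 16) ^+ 2 = 1 + s + s ^+ 2 * (2 - s) / 16 + s ^+ 4 / 256.
  by field.
have h1 : 0 <= s ^+ 2 * (2 - s) by apply: mulr_ge0; [exact: sqr_ge0|lra].
have h2 : 0 <= s ^+ 4 by rewrite (exprM s 2 2) sqr_ge0.
by move: (s ^+ 2 * (2 - s)) (s ^+ 4) h1 h2 => v w; lra.
Qed.

(** The quadratic gain [s^2 / 16] of the square root, times the weight [2 g] or [2 (1 - g)] that the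
    square root carries in the geometric mean for [(1 + s)^g]. *)
Definition power_gap g : R := Num.min g (1 - g) / 8.

Lemma power_gap_gt0 g : 0 < g < 1 -> 0 < power_gap g.
Proof. by move=> /andP[g0 g1]; rewrite divr_gt0// lt_min g0 subr_gt0. Qed.

(* Writing [(1 + s)^g] as a weighted geometric mean of [sqrt (1 + s)] and
   either [1] or [1 + s] keeps a fraction of the strict concavity of [sqrt]. *)
Lemma powR_upper_quadratic g s : 0 < g < 1 -> `|s| <= 1 / 2 ->
  (1 + s) `^ g <= 1 + g * s - power_gap g * s ^+ 2.
Proof.
move=> /andP[g0 g1] s12.
have /sqrt_upper_quadratic sq : `|s| <= 1 by lra.
have s0 : 0 < 1 + s by move: s12; rewrite ler_norml => /andP[]; lra.
have q0 : 0 < Num.sqrt (1 + s) by rewrite sqrtr_gt0.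
have E : Num.sqrt (1 + s) = (1 + s) `^ 2^-1 by rewrite powR12_sqrt// ltW.
have s2 : 0 <= s ^+ 2 by exact: sqr_ge0.
have [gh|gh] := leP g (1 / 2).
  have -> : (1 + s) `^ g = Num.sqrt (1 + s) `^ (2 * g) * 1 `^ (1 - 2 * g).
    rewrite powR1 mulr1 E -powRrM; congr (_ `^ _); by field.
  apply: le_trans (amgm_powR _ _ _) _ => //; first by lra.
  have -> : power_gap g = g / 8 by rewrite /power_gap min_l//; lra.
  have : 2 * g * Num.sqrt (1 + s) <= 2 * g * (1 + s / 2 - s ^+ 2 / 16).
    by rewrite ler_pM2l//; lra.
  by lra.
have -> : (1 + s) `^ g = (1 + s) `^ (2 * g - 1) * Num.sqrt (1 + s) `^ (1 - (2 * g - 1)).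
  rewrite E -powRrM -powRD ?(gt_eqF s0) ?implybT//; congr (_ `^ _); by field.
apply: le_trans (amgm_powR _ _ _) _ => //; first by lra.
have -> : power_gap g = (1 - g) / 8 by rewrite /power_gap min_r//; lra.
have : (1 - (2 * g - 1)) * Num.sqrt (1 + s) <= (1 - (2 * g - 1)) * (1 + s / 2 - s ^+ 2 / 16).
  by rewrite ler_pM2l//; lra.
by lra.
Qed.

(** Subadditivity of the concave power: [x^g] is split in the proportion of [y] and [x - y], and
    each share [(w / x) x^g] is at most [w^g]. It gives continuity of the barrier up to [t = 0],
    where the power is not differentiable. *)
Lemma powR_lip x y g : 0 <= x -> 0 <= y -> 0 < g <= 1 ->
  `|x `^ g - y `^ g| <= `|x - y| `^ g.
Proof.
wlog xy : x y / y <= x.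
  move=> H x0 y0 g01; have [yx|/ltW xy] := leP y x; first exact: H.
  by rewrite distrC [`|x - y|]distrC; exact: H.
move=> x0 y0 /andP[g0 g1].
have mono : y `^ g <= x `^ g by rewrite ge0_ler_powR ?nnegrE// ltW.
rewrite !ger0_norm ?subr_ge0// lerBlDl.
have [->|yn] := eqVneq y 0; first by rewrite subr0 powR0 ?add0r// gt_eqF.
have [/subr0_eq ->|xn] := eqVneq (x - y) 0.
  by rewrite lerDl powR_ge0.
have yp : 0 < y by rewrite lt_neqAle eq_sym yn.
have xp : 0 < x by exact: lt_le_trans xy.
have dp : 0 < x - y by rewrite lt_neqAle eq_sym xn subr_ge0.
have part w : 0 < w -> w <= x -> w / x * x `^ g <= w `^ g.
  move=> w0 wx; have -> : w `^ g = (w / x) `^ g * x `^ g.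
    by rewrite -powRM ?divr_ge0 ?ltW// divfK// gt_eqF.
  rewrite ler_wpM2r ?powR_ge0//; apply: ger1_powR => //.
  by rewrite divr_gt0//= ler_pdivrMr// mul1r.
have -> : x `^ g = y / x * x `^ g + (x - y) / x * x `^ g.
  by field; rewrite gt_eqF.
by apply: lerD; apply: part => //; lra.
Qed.

(* The expansion of [(1 + s)^g (S' - M)], i.e. of the barrier, to second order. *)
Lemma barrier_expansion (g r2 S S' p q s M : R) : M = r2 * (1 + 5 / power_gap g) -> 0 < g < 1 -> `|s| <= 1 / 4 ->
  0 <= r2 -> 0 <= q -> S' = S + 2 * p + q -> S' <= r2 ->
  p ^+ 2 <= r2 * q ->
  (S - M) + (g * s * (S - M) + 2 * p) + r2 * s ^+ 2 + q / 4 <=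
  (1 + s) `^ g * (S' - M).
Proof.
move=> ME g01 s4 r20 q0 SE Sr pq.
have c0 := power_gap_gt0 g01; set c := power_gap g in c0 ME *.
have X : (1 + s) `^ g <= 1 + g * s - c * s ^+ 2.
  by apply: powR_upper_quadratic => //; lra.
have MS : S' - M <= 0.
  have : 0 <= r2 * (5 / c) by rewrite mulr_ge0// divr_ge0// ltW.
  by rewrite ME; lra.
apply: le_trans (_ : (1 + g * s - c * s ^+ 2) * (S' - M) <= _); last first.
  exact: ler_wnM2r.
(* This fixes the factor 5 in [M]. Of the gain [5 r2 s^2], four parts together with [q / 4] absorb
   the mixed term [2 g s p], by [p^2 <= r2 q]; one part remains as curvature across the
   hyperplane. *)
have cM : c * (M - S') >= 5 * r2.
  have -> : 5 * r2 = c * (M - r2) by rewrite ME; field; rewrite gt_eqF.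
  by rewrite ler_pM2l//; lra.
have s2 : 0 <= s ^+ 2 by exact: sqr_ge0.
have h1 : s ^+ 2 * (5 * r2) <= s ^+ 2 * (c * (M - S')) by rewrite ler_wpM2l.
move: s4; rewrite ler_norml => /andP[sl sr].
have /andP[g0 g1] := g01.
have gs : - (1 / 4) <= g * s by nra.
have h2 : - (q / 4) <= g * s * q by nra.
have h3 : - (4 * s ^+ 2 * r2 + q / 4) <= 2 * (g * s) * p.
  have K0 : 0 <= 4 * s ^+ 2 * r2 + q / 4.
    by rewrite addr_ge0// ?divr_ge0// mulr_ge0// mulr_ge0.
  suff : `|2 * (g * s) * p| <= 4 * s ^+ 2 * r2 + q / 4 by rewrite ler_norml => /andP[].
  rewrite -(@ler_pXn2r _ 2)// ?nnegrE// real_normK ?num_real//.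
  apply: (@le_trans _ _ (4 * s ^+ 2 * p ^+ 2)).
    have -> : (2 * (g * s) * p) ^+ 2 = g ^+ 2 * (4 * s ^+ 2 * p ^+ 2) by ring.
    rewrite ler_piMl//; last by rewrite expr_le1// ltW.
    by apply: mulr_ge0; [apply: mulr_ge0|exact: sqr_ge0].
  apply: (@le_trans _ _ (4 * s ^+ 2 * (r2 * q))); first by rewrite ler_wpM2l// mulr_ge0.
  have : 0 <= (4 * s ^+ 2 * r2 - q / 4) ^+ 2 by exact: sqr_ge0.
  by lra.
have -> : (1 + g * s - c * s ^+ 2) * (S' - M) = (S - M) + (g * s * (S - M) + 2 * p) +
  q + 2 * (g * s) * p + g * s * q + s ^+ 2 * (c * (M - S')) by rewrite SE; ring.
by lra.
Qed.

End power_inequalities.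

(** * The boundary barrier *)

Section barrier.
Context {R : realType} {n : nat}.
Local Notation V := 'rV[R]_n.
Local Notation mu := (@lebesgue_outer R n).
Variables (Omega : set V) (r : R).
Hypotheses (Omega_ball : Omega `<=` eball r) (Omega_open : open Omega)
  (Omega_convex : convex_set Omega).
Implicit Types x y z : V.
Local Notation bd := (boundary Omega).
Local Notation dist x := (edist_to x bd).

(** Let [Y] be the factor multiplied by [L]. A barrier of scale [B >= 1] yields a product of
    curvatures of at least [B / Y] in [sub_paraboloid], and [B = 1 + L Y] makes this exceed [L]. The
    base [sqrt n * 2 r] bounds the hyperplane function [t] on [Omega]. In [barrier_constant] the
    factor [sqrt n ^ g] passes from [t] to the distance to the boundary. *)
Definition barrier_scale (L g : R) : R :=
  1 + L * ((2 * n%:R) * (8 * n%:R) ^+ n.-1 *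
     (Num.sqrt n%:R * (2 * r)) `^ (2 - n%:R * g) / r ^+ 2).

Definition barrier_depth (g : R) : R := r ^+ 2 * (1 + 5 / power_gap g).

Definition barrier_constant (L g : R) : R :=
  barrier_scale L g * barrier_depth g * Num.sqrt n%:R `^ g.

Lemma within_continuousM (A : set V) (u v : V -> R) : {within A, continuous u} ->
  {within A, continuous v} -> {within A, continuous (fun x => u x * v x)}.
Proof. by move=> cu cv x; apply: (continuousM (cu x) (cv x)). Qed.

Lemma max_coordE x (i0 : 'I_n) : exists i, forall j, `|x 0 j| <= `|x 0 i|.
Proof.
exists [arg max_(i > i0) `|x 0%R i|]%O.
by case: arg_maxP => // i _ h j; exact: h.
Qed.

Lemma barrier_lower_bound (u : V -> R) (L g l0 : R) (eta x0 : V) :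
  (0 < n)%N -> 0 < g < 1 -> n%:R * g <= 2 -> 0 <= L ->
  {within closure Omega, continuous u} -> convex_function Omega u ->
  (forall A, open A -> A `<=` Omega ->
     (mu (\bigcup_(y in A) subdifferential Omega u y) <= L%:E * mu A)%E) ->
  (forall z, bd z -> l0 + dotmx eta z <= u z) -> Omega x0 ->
  l0 + dotmx eta x0 - barrier_constant L g * dist x0 `^ g <= u x0.
Proof.
move=> n0 g01 ng2 L0 cu convu MA lu Ox0.
have /andP[g0 g1] := g01.
have r0 : 0 < r.
  by have := Omega_ball Ox0; rewrite /eball/=; apply: le_lt_trans; exact: enorm_ge0.
have N0 : 0 < n%:R :> R by rewrite ltr0n.
have sN0 : 0 < Num.sqrt n%:R :> R by rewrite sqrtr_gt0.
have b0 : bd !=set0.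
  exact: (boundary_neq0 Omega_ball Omega_open Omega_convex n0 Ox0).
have [zb bzb dz] := nearest_boundary Omega_ball Omega_open x0 b0.
have d0 := dist_gt0 Omega_ball Omega_open b0 Ox0.
pose e := x0 - zb.
(* Dividing by the largest entry keeps all entries of [c] within [[-1, 1]] and the norm of [c'] at
   most [sqrt n]. *)
have [i imax] := max_coordE e (Ordinal n0).
have ei0 : 0 < `|e 0 i|.
  rewrite normr_gt0; apply/eqP => ei; move: d0; rewrite dz -/e.
  suff -> : e = 0 by rewrite enorm0 ltxx.
  apply/rowP => j; rewrite [RHS]mxE; apply/eqP; rewrite -normr_le0.
  by rewrite (le_trans (imax j))// ei normr0.
have ei : enorm e <= Num.sqrt n%:R * `|e 0 i|.
  by apply: enorm_le_coord => //; exact: normr_ge0.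
(* [c] has [i]-th entry 1, as [sub_paraboloid] requires; [c'] keeps the direction of [e], so that
   [t] is positive on [Omega]. The two agree up to sign, which the squares do not see. *)
pose c := (e 0 i)^-1 *: e.
pose c' := `|e 0 i|^-1 *: e.
have ein0 : e 0 i != 0 by rewrite -normr_gt0.
have ci1 : c 0 i = 1 by rewrite mxE mulVf.
have c1 j : `|c 0 j| <= 1.
  by rewrite mxE normrM normfV mulrC ler_pdivrMr// mul1r.
have cc' z : dotmx c z ^+ 2 = dotmx c' z ^+ 2.
  by rewrite !dotmxZl !exprMn !exprVn real_normK ?num_real.
have c'n : enorm c' <= Num.sqrt n%:R.
  by rewrite enormZ normfV normr_id mulrC ler_pdivrMr.
pose t x := dotmx c' (x - zb).
pose T := Num.sqrt n%:R * (2 * r).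
have T0 : 0 < T by rewrite !mulr_gt0.
have tlip x y : `|t x - t y| <= Num.sqrt n%:R * enorm (x - y).
  rewrite /t -dotmxNr -dotmxDr opprB addrA subrK.
  have h z : dotmx c' z <= Num.sqrt n%:R * enorm z.
    by rewrite (le_trans (cauchy_schwarz _ _))// ler_wpM2r// enorm_ge0.
  by rewrite ler_norml h andbT -[X in _ <= X]opprK lerN2 -dotmxNr -[enorm _]enormN h.
have tzb : t zb = 0 by rewrite /t subrr -(scale0r 0) dotmxZr mul0r.
have tx_pos x : Omega x -> 0 < t x.
  move=> Ox; rewrite /t dotmxZl mulr_gt0 ?invr_gt0//.
  exact: (supporting_halfspace Omega_ball Omega_open Omega_convex Ox0 bzb dz).
have tx_ge0 x : closure Omega x -> 0 <= t x.
  move=> cx; apply/ler_addgt0Pr => e' e'0.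
  have [y Oy yx] := (closure_enormP _ _).1 cx (e' / Num.sqrt n%:R) (divr_gt0 e'0 sN0).
  have := tlip y x; rewrite ler_norml => /andP[_ h].
  have := tx_pos y Oy; move: yx; rewrite ltr_pdivlMr// mulrC; lra.
have txT x : Omega x -> t x <= T.
  move=> Ox; have := tlip x zb; rewrite tzb subr0 => h.
  apply: le_trans (ler_norm _) (le_trans h _); rewrite ler_pM2l//.
  apply: le_trans (ler_enormD _ _) _; rewrite enormN.
  have := closure_eball Omega_ball (boundary_closure bzb).
  by have := Omega_ball Ox; rewrite /eball/=; lra.
have tx0 : t x0 <= Num.sqrt n%:R * dist x0.
  by have := tlip x0 zb; rewrite tzb subr0 dz; apply: le_trans; exact: ler_norm.
pose B := barrier_scale L g; pose M := barrier_depth g.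
have gap0 := power_gap_gt0 g01.
have M0 : 0 <= M by rewrite mulr_ge0 ?sqr_ge0// addr_ge0// divr_ge0// ltW.
pose Y := (2 * n%:R) * (8 * n%:R) ^+ n.-1 * T `^ (2 - n%:R * g) / r ^+ 2 : R.
have Y0 : 0 < Y by rewrite /Y !mulr_gt0 ?exprn_gt0 ?invr_gt0 ?powR_gt0 ?mulr_gt0 ?exprn_gt0.
have BE : B = 1 + L * Y by [].
have B1 : 1 <= B by rewrite BE lerDl mulr_ge0// ltW.
have B0 : 0 < B by lra.
(* The square norm without the coordinate [i], whose role is taken over by [t]. *)
pose S x := \sum_(j | j != i) x 0 j ^+ 2 : R.
have Sr x : Omega x -> S x <= r ^+ 2.
  move=> /Omega_ball xr; apply: (@le_trans _ _ (enorm x ^+ 2)); last first.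
    by rewrite ler_pXn2r ?nnegrE ?enorm_ge0// ltW.
  rewrite enorm_sqr /dotmx [leRHS](bigD1 i)//= -expr2.
  rewrite (eq_bigr (fun j => x 0 j ^+ 2)) ?lerDr ?sqr_ge0//.
pose w x := B * (t x `^ g * (S x - M)).
have rM : r ^+ 2 <= M.
  by rewrite /M /barrier_depth ler_peMr ?sqr_ge0// lerDl divr_ge0// ltW.
have cS : continuous S.
  rewrite (_ : S = fun x : V => \sum_j (if j != i then x 0 j * x 0 j else 0)).
    apply: continuous_sum => j x; case: (j != i); last exact: cst_continuous.
    by apply: continuousM; exact: coord_continuous.
  by apply/funext => x; rewrite /S big_mkcond.
have ct : {within closure Omega, continuous (fun x => t x `^ g)}.
  apply/within_continuous_enormP => x cx e' e'0.
  have p0 : 0 < e' `^ g^-1 by rewrite powR_gt0.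
  exists (e' `^ g^-1 / Num.sqrt n%:R); first by rewrite divr_gt0.
  move=> y cy yx; apply: le_lt_trans (powR_lip (tx_ge0 _ cy) (tx_ge0 _ cx) _) _.
    by rewrite g0 ltW.
  have -> : e' = (e' `^ g^-1) `^ g.
    by rewrite -powRrM mulVf ?gt_eqF// powRr1// ltW.
  apply: gt0_ltr_powR => //; rewrite ?nnegrE ?(ltW p0)//.
  by apply: le_lt_trans (tlip _ _) _; rewrite mulrC -ltr_pdivlMr.
have cw : {within closure Omega, continuous (fun x => - B * (t x `^ g * (S x - M)))}.
  apply: within_continuousM; first by move=> x; exact: cst_continuous.
  apply: within_continuousM => //.
  apply: continuous_subspaceT => x.
  by apply: (@continuousB R R V S (cst M)); [exact: cS|exact: cst_continuous].
pose h x := u x + (- l0 + dotmx (- eta) x) + - B * (t x `^ g * (S x - M)).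
have ch : {within closure Omega, continuous h}.
  move=> x; apply: (continuousD _ (cw x)).
  apply: within_continuousD cu _ x => y.
  apply: (@continuousD R R V (cst (- l0)) (dotmx (- eta))).
    exact: cst_continuous.
  exact: continuous_dotmx.
have c0 : closure Omega !=set0 by exists x0; exact: subset_closure.
have [m] := EVT_min_rV c0 (compact_closure_domain Omega_ball) ch.
rewrite inE => cm hm.
have clS x : closure Omega x -> S x <= r ^+ 2.
  move=> cx; apply/ler_addgt0Pr => e' e'0.
  have [d dd H] := (within_continuous_enormP (closure Omega) S).1 (continuous_subspaceT cS) x cx e' e'0.
  have [y Oy yx] := (closure_enormP _ _).1 cx d dd.
  have := H y (subset_closure Oy) yx; rewrite ltr_norml => /andP[h1 _].
  by have := Sr y Oy; lra.
have wle x : closure Omega x -> 0 <= - B * (t x `^ g * (S x - M)).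
  move=> cx; rewrite mulNr -mulrN -mulrN mulr_ge0 ?(ltW B0)// mulr_ge0 ?powR_ge0//.
  by have := clS x cx; lra.
have hx0 : 0 <= h x0.
  have cx0 := subset_closure Ox0.
  suff hm0 : 0 <= h m by apply: le_trans hm0 _; apply: hm; rewrite inE.
  (* At a boundary minimiser [u] lies above the affine function and the barrier is nonpositive, so
     [h m] is nonnegative. An interior minimiser is ruled out by the volume bound. *)
  have [Om|bm] := closure_split Omega_open cm; last first.
    have := wle m cm; have := lu m bm; rewrite /h dotmxNl; lra.
  rewrite leNgt; apply/negP => hm0.
  pose tm := t m; have tm0 : 0 < tm by exact: tx_pos.
  pose phi := tm `^ g; have phi0 : 0 < phi by rewrite powR_gt0.
  (* The curvatures [r^2 s^2] and [q / 4] of [barrier_expansion], with [s = c'.z / tm] and the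
     factor [B * phi] restored. *)
  pose a := B * phi * r ^+ 2 / tm ^+ 2; pose b := B * phi / 4.
  have aa0 : 0 < a by rewrite /a divr_gt0 ?exprn_gt0// !mulr_gt0 ?exprn_gt0.
  have bb0 : 0 < b by rewrite /b divr_gt0// mulr_gt0.
  pose m' : V := \row_j (if j == i then 0 else m 0 j).
  (* The gradient at [m] of the affine function plus the barrier. *)
  pose p := eta + ((B * phi * g * (S m - M) / tm) *: c' + (2 * B * phi) *: m').
  have [e1 e10 e1O] := open_enorm Omega_open Om.
  (* The second bound keeps the relative change [s] of [t] within [1/4], the range of the
     expansion. *)
  pose e2 := Num.min e1 (tm / 4 / Num.sqrt n%:R).
  have e20 : 0 < e2 by rewrite lt_min e10 !divr_gt0.
  have cuO y : Omega y -> forall e : R, 0 < e -> exists2 d : R, 0 < d &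
     forall y', Omega y' -> enorm (y' - y) < d -> `|u y' - u y| < e.
    move=> Oy e' e'0.
    have [d dd H] := (within_continuous_enormP _ _).1 cu y (subset_closure Oy) e' e'0.
    by exists d => // y' Oy'; apply: H; exact: subset_closure.
  have expand z : enorm z < e2 -> Omega (m + z) /\
     u m + dotmx p z + a * dotmx c z ^+ 2 + b * \sum_(j | j != i) z 0 j ^+ 2
       <= u (m + z).
    rewrite lt_min => /andP[ze1 ze2].
    have Omz : Omega (m + z) by apply: e1O; rewrite addrAC subrr add0r.
    split => //.
    pose s := dotmx c' z / tm.
    have tmz : t (m + z) = tm * (1 + s).
      rewrite /t addrAC dotmxDr -/(t m) -/tm /s; field; exact: lt0r_neq0.
    have s4 : `|s| <= 1 / 4.
      rewrite /s normrM normfV (gtr0_norm tm0) ler_pdivrMr//.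
      have -> : dotmx c' z = t (m + z) - t m by rewrite /t !dotmxDr; ring.
      apply: le_trans (tlip _ _) _; rewrite addrAC subrr add0r mulrC -ler_pdivlMr//.
      by apply: ltW; move: ze2; rewrite mul1r [4^-1 * _]mulrC.
    pose q := \sum_(j | j != i) z 0 j ^+ 2 : R.
    have q0 : 0 <= q by apply: sumr_ge0 => j _; exact: sqr_ge0.
    pose p' := dotmx m' z.
    have p'E : p' = \sum_(j | j != i) m 0 j * z 0 j.
      rewrite /p' /dotmx (bigD1 i)//= mxE eqxx mul0r add0r.
      by apply: eq_bigr => j /negbTE ji; rewrite mxE ji.
    have SE : S (m + z) = S m + 2 * p' + q.
      rewrite p'E /S /q mulr_sumr -!big_split/=; apply: eq_bigr => j _.
      by rewrite mxE; ring.
    have pq : p' ^+ 2 <= r ^+ 2 * q.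
      pose z' : V := \row_j (if j == i then 0 else z 0 j).
      have -> : p' = dotmx m' z'.
        by apply: eq_bigr => j _; rewrite !mxE; case: ifP; rewrite ?mul0r.
      have -> : q = dotmx z' z'.
        rewrite /q /dotmx [RHS](bigD1 i)//= mxE eqxx mul0r add0r.
        by apply: eq_bigr => j /negbTE ji; rewrite mxE ji expr2.
      have mS : dotmx m' m' = S m.
        rewrite /S /dotmx (bigD1 i)//= mxE eqxx mul0r add0r.
        by apply: eq_bigr => j /negbTE ji; rewrite mxE ji expr2.
      have cs : `|dotmx m' z'| <= enorm m' * enorm z'.
        rewrite ler_norml cauchy_schwarz andbT -[leRHS]opprK lerN2 -dotmxNl.
        by rewrite -(enormN m') cauchy_schwarz.
      rewrite -[X in X ^+ 2]/(dotmx m' z') -real_normK ?num_real//.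
      apply: (@le_trans _ _ ((enorm m' * enorm z') ^+ 2)).
        by rewrite ler_pXn2r ?nnegrE// mulr_ge0 ?enorm_ge0.
      by rewrite exprMn !enorm_sqr mS ler_wpM2r ?dotmx_ge0// Sr.
    have := @barrier_expansion R g (r ^+ 2) (S m) (S (m + z)) p' q s M erefl g01 s4
      (sqr_ge0 _) q0 SE (Sr _ Omz) pq.
    have Bphi : 0 < B * phi by rewrite mulr_gt0.
    rewrite -(ler_pM2l Bphi) => EX.
    have := hm (m + z); rewrite inE => /(_ (subset_closure Omz)).
    have -> : h (m + z) = u (m + z) + (- l0 + dotmx (- eta) (m + z)) -
        B * phi * ((1 + s) `^ g * (S (m + z) - M)).
      rewrite /h tmz powRM ?(ltW tm0)//.
        by rewrite -/phi; ring.
      by move: s4; rewrite ler_norml => /andP[]; lra.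
    rewrite /h -/tm -/phi dotmxDr => HM.
    have -> : dotmx p z = dotmx eta z + (B * phi * (g * s * (S m - M) + 2 * p')).
      by rewrite /p !dotmxDl (dotmxZl _ c' z) (dotmxZl _ m' z) -/p' /s; ring.
    have -> : a * dotmx c z ^+ 2 = B * phi * (r ^+ 2 * s ^+ 2).
      by rewrite cc' /a /s; field; rewrite gt_eqF.
    rewrite -/q; move: HM EX; rewrite !dotmxNl /b; lra.
  have := sub_paraboloid ci1 c1 cuO Omega_convex convu aa0 bb0 e20 expand L0 MA.
  apply/negP; rewrite -ltNge (bigD1 i)//= eqxx.
  rewrite (eq_bigr (fun=> b / (2 * n%:R))); last by move=> j /negbTE ->.
  rewrite prodr_const cardC1 card_ord.
  (* Here [n g <= 2] enters: [phi^n / tm^2 = tm^(n g - 2)] has a nonpositive exponent, so on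
     [t <= T] it is smallest at [T]. *)
  have phin : phi ^+ n * T `^ (2 - n%:R * g) >= tm ^+ 2.
    have -> : tm ^+ 2 = phi ^+ n * tm `^ (2 - n%:R * g).
      have -> : phi ^+ n = tm `^ (n%:R * g).
        by rewrite /phi -powR_mulrn ?powR_ge0// -powRrM mulrC.
      rewrite -powRD ?(gt_eqF tm0) ?implybT// addrC subrK.
      by rewrite powR_mulrn// ltW.
    rewrite ler_pM2l ?exprn_gt0//; apply: ge0_ler_powR; rewrite ?nnegrE ?(ltW tm0) ?(ltW T0)//.
      by rewrite subr_ge0.
    exact: txT.
  have Bn : B <= B ^+ n by rewrite -[leLHS]expr1 ler_weXn2l.
  have -> : a / (2 * n%:R) * (b / (2 * n%:R)) ^+ n.-1 =
    B ^+ n * (r ^+ 2 / tm ^+ 2 * phi ^+ n) / ((2 * n%:R) * (8 * n%:R) ^+ n.-1).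
    rewrite -[n in B ^+ n](prednK n0) -[n in phi ^+ n](prednK n0) !exprS /a /b.
    have -> : B * phi / 4 / (2 * n%:R) = B * phi / (8 * n%:R) by field; rewrite gt_eqF.
    rewrite expr_div_n exprMn; field.
    by rewrite !gt_eqF ?exprn_gt0// mulr_gt0.
  apply: (@lt_le_trans _ _ (B / Y)).
    by rewrite ltr_pdivlMr// BE ltrDr.
  have -> : B / Y = B * (r ^+ 2 / T `^ (2 - n%:R * g)) / (2 * n%:R * (8 * n%:R) ^+ n.-1).
    by rewrite /Y; field; rewrite !gt_eqF ?exprn_gt0 ?powR_gt0 ?mulr_gt0.
  rewrite ler_pM2r; last by rewrite invr_gt0 mulr_gt0 ?exprn_gt0 ?mulr_gt0.
  apply: ler_pM => //; first by rewrite ltW.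
    by rewrite divr_ge0 ?sqr_ge0 ?powR_ge0.
  rewrite ler_pdivrMr ?powR_gt0//.
  have -> : r ^+ 2 / tm ^+ 2 * phi ^+ n * T `^ (2 - n%:R * g) =
    r ^+ 2 * (phi ^+ n * T `^ (2 - n%:R * g) / tm ^+ 2) by ring.
  by rewrite ler_peMr ?sqr_ge0// ler_pdivlMr ?exprn_gt0// mul1r.
have wx0 : - B * (t x0 `^ g * (S x0 - M)) <= barrier_constant L g * dist x0 `^ g.
  have h1 : - B * (t x0 `^ g * (S x0 - M)) <= B * (t x0 `^ g * M).
    rewrite mulNr -mulrN ler_pM2l// -mulrN ler_wpM2l ?powR_ge0// opprB gerBl.
    by apply: sumr_ge0 => j _; exact: sqr_ge0.
  apply: le_trans h1 _; rewrite /barrier_constant -/B -/M -[X in _ <= X]mulrA -[B * M * _]mulrA.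
  rewrite ler_pM2l// mulrC ler_wpM2l// -powRM ?(ltW sN0) ?(ltW d0)//.
  apply: ge0_ler_powR => //; rewrite ?nnegrE; first exact: ltW.
    by rewrite ltW// tx_pos.
  by rewrite mulr_ge0 ?(ltW sN0) ?(ltW d0).
by move: hx0 wx0; rewrite /h dotmxNl; lra.
Qed.

End barrier.

(** * Bounds for difference quotients *)

Section slope_estimate.
Context {R : realType} {n : nat}.
Local Notation V := 'rV[R]_n.
Local Notation mu := (@lebesgue_outer R n).
Variables (Omega : set V) (r : R).
Hypotheses (Omega_ball : Omega `<=` eball r) (Omega_open : open Omega)
  (Omega_convex : convex_set Omega) (n0 : (0 < n)%N).
Implicit Types x y z : V.
Local Notation bd := (boundary Omega).
Local Notation dist x := (edist_to x bd).

(** The form in which the equation enters the barrier argument: a bound on the volume of the slopes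
    attained on an open set. *)
Lemma monge_ampere_le (u f : V -> R) (L : R) :
  (lebesgue_n R n).-integrable Omega (EFin \o f) ->
  {ae lebesgue_n R n, forall x, Omega x -> 0 <= f x <= L} ->
  monge_ampere_eq Omega u f -> 0 <= L ->
  forall A, open A -> A `<=` Omega ->
  (mu (\bigcup_(y in A) subdifferential Omega u y) <= L%:E * mu A)%E.
Proof.
move=> intf fL MA L0 A oA AO.
have mA := measurable_open oA.
have -> : mu (\bigcup_(y in A) subdifferential Omega u y) =
    (\int[lebesgue_n R n]_(x in A) (f x)%:E)%E.
  by apply: (MA A) => //; exact: sub_sigma_algebra.
have mf : measurable_fun (A : set (caratheodory_type mu)) (EFin \o f).
  exact: measurable_funS (measurable_open Omega_open) AO (measurable_int _ intf).
apply: (@le_trans _ _ (`|\int[lebesgue_n R n]_(x in A) (f x)%:E|)%E).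
  exact: lee_abs.
apply: le_trans (le_abse_integral (lebesgue_n R n) mA mf) _.
rewrite -(integral_cst (lebesgue_n R n) mA).
apply: ae_ge0_le_integral => //.
- exact: measurableT_comp.
- move: fL; apply: negligibleS => x /=; apply: contra_not => fx Ax.
  have /andP[f0 fl] := fx (AO _ Ax).
  by rewrite /= lee_fin ger0_norm.
Qed.

(** For [|y - x| <= dist x / 2], the bound on [u y] contributes [2 K * 2], as
    [dist y^alpha <= 2 dist x^alpha], and the change of [g] contributes [K]. The power of [2 r]
    trades [alpha] for the smaller exponent, the barrier bounds [u x] from below, and the outer 2
    comes from dividing by [dist x / 2]. *)
Definition slope_constant (K L alpha g : R) : R :=
  2 * (5 * K * (2 * r) `^ (alpha - g) + @barrier_constant R n r L g).

(** One-sided bounds suffice: the upper estimate uses the chord from [x] to [x + s v], and the lower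
    one the position of [x] between [x - s v] and [x + h v]. *)
Lemma convex_slope (u : V -> R) x (v : V) (h s B : R) : convex_function Omega u ->
  0 < h <= s -> Omega (x + s *: v) -> Omega (x - s *: v) -> Omega x ->
  u (x + s *: v) - u x <= B -> u (x - s *: v) - u x <= B ->
  `|u (x + h *: v) - u x| <= h * (B / s).
Proof.
move=> convu /andP[h0 hs] Op Om Ox uB1 uB2.
have s0 : 0 < s by exact: lt_le_trans hs.
have hs1 : 0 <= h / s <= 1.
  by rewrite divr_ge0 ?(ltW h0) ?(ltW s0)//= ler_pdivrMr// mul1r.
have Oh : Omega (x + h *: v).
  have := convex_setP Omega_convex Ox Op hs1.
  by rewrite [_ - x]addrAC subrr add0r scalerA divfK// gt_eqF.
rewrite ler_norml; apply/andP; split; last first.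
  have := convex_functionP convu Ox Op hs1.
  rewrite [_ - x]addrAC subrr add0r scalerA divfK ?gt_eqF// => H.
  have -> : h * (B / s) = h / s * B by ring.
  have : h / s * (u (x + s *: v) - u x) <= h / s * B by rewrite ler_pM2l ?divr_gt0.
  by lra.
have sh : 0 < s + h by rewrite addr_gt0.
have sh1 : 0 <= s / (s + h) <= 1.
  by rewrite divr_ge0 ?(ltW s0) ?(ltW sh)//= ler_pdivrMr// mul1r; lra.
have := convex_functionP convu Om Oh sh1.
have -> : x - s *: v + (s / (s + h)) *: (x + h *: v - (x - s *: v)) = x.
  apply/rowP => i; rewrite !mxE; field; exact: lt0r_neq0.
have -> : 1 - s / (s + h) = h / (s + h) by field; exact: lt0r_neq0.
rewrite -(ler_pM2l sh).
have -> : (s + h) * (h / (s + h) * u (x - s *: v) + s / (s + h) * u (x + h *: v)) =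
   h * u (x - s *: v) + s * u (x + h *: v) by field; exact: lt0r_neq0.
move=> H.
have hB : h * (u (x - s *: v) - u x) <= h * B by rewrite ler_pM2l.
rewrite -(ler_pM2l s0).
have -> : s * - (h * (B / s)) = - (h * B) by field; exact: lt0r_neq0.
by lra.
Qed.

Lemma slope_bound (u f g : V -> R) (K L alpha ga : R) x i h :
  (lebesgue_n R n).-integrable Omega (EFin \o f) ->
  {ae lebesgue_n R n, forall x, Omega x -> 0 <= f x <= L} ->
  monge_ampere_eq Omega u f -> 0 <= L -> 0 <= K -> 0 < alpha < 1 ->
  0 < ga <= alpha -> n%:R * ga <= 2 ->
  (forall x y, closure Omega x -> closure Omega y ->
     `|g x - g y| <= K * enorm (x - y) `^ alpha) ->
  convex_function (closure Omega) g ->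
  {within closure Omega, continuous u} -> convex_function Omega u ->
  (forall x, bd x -> u x = g x) ->
  Omega x -> 0 < h <= dist x / 2 ->
  `|u (x + h *: delta_mx 0 i) - u x| <=
    h * (slope_constant K L alpha ga * dist x `^ (ga - 1)).
Proof.
move=> intf fL MA L0 K0 /andP[al0 al1] /andP[ga0 gaal] nga gK convg cu convu ug Ox hd.
have MA' := monge_ampere_le intf fL MA L0.
have b0 := boundary_neq0 Omega_ball Omega_open Omega_convex n0 Ox.
have d0 := dist_gt0 Omega_ball Omega_open b0 Ox.
have r0 : 0 < r.
  by have := Omega_ball Ox; rewrite /eball/=; apply: le_lt_trans; exact: enorm_ge0.
have cl y : Omega y -> closure Omega y by exact: subset_closure.
have cg : {within closure Omega, continuous g}.
  apply/within_continuous_enormP => y cy e e0.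
  have K1 : 0 < K + 1 by rewrite ltr_wpDl.
  exists ((e / (K + 1)) `^ alpha^-1); first by rewrite powR_gt0// divr_gt0.
  move=> z cz zy; apply: le_lt_trans (gK _ _ cz cy) _.
  have : enorm (z - y) `^ alpha < e / (K + 1).
    have -> : e / (K + 1) = ((e / (K + 1)) `^ alpha^-1) `^ alpha.
      by rewrite -powRrM mulVf ?gt_eqF// powRr1// divr_ge0// ltW.
    by apply: gt0_ltr_powR => //; rewrite ?nnegrE ?enorm_ge0// powR_ge0.
  rewrite ltr_pdivlMr// => H; apply: le_lt_trans H.
  by rewrite mulrC ler_wpM2l ?powR_ge0// lerDl.
have lower : g x - @barrier_constant R n r L ga * dist x `^ ga <= u x.
  apply/ler_addgt0Pr => e e0.
  have [y [xi [gm gx]]] := affine_minorant Omega_ball Omega_convex cg convg (cl _ Ox) e0.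
  have ga1 : 0 < ga < 1 by rewrite ga0 (le_lt_trans gaal).
  have := barrier_lower_bound Omega_ball Omega_open Omega_convex (l0 := g y - dotmx xi y)
    (eta := xi) n0 ga1 nga L0 cu convu MA' _ Ox.
  have H z : bd z -> g y - dotmx xi y + dotmx xi z <= u z.
    move=> bz; rewrite ug//; have := gm z (boundary_closure bz).
    by rewrite dotmxDr dotmxNr; lra.
  move=> /(_ H); move: gx; rewrite dotmxDr dotmxNr; lra.
have osc y : Omega y -> enorm (y - x) <= dist x / 2 ->
    u y - u x <= slope_constant K L alpha ga / 2 * dist x `^ ga.
  move=> Oy yx.
  have al01 : 0 <= alpha <= 1 by rewrite !ltW.
  have up := chord_upper_bound Omega_ball Omega_open Omega_convex cu convu ug K0 al01 gK b0 Oy.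
  have dy : dist y `^ alpha <= 2 * dist x `^ alpha.
    apply: (@le_trans _ _ ((2 * dist x) `^ alpha)).
      apply: ge0_ler_powR; rewrite ?nnegrE ?edist_to_ge0 ?mulr_ge0 ?edist_to_ge0 ?ltW//.
      have := edist_to_lip x y bd; move: yx d0.
      by move: (enorm _) (dist x) (dist y); clear -Omega_ball Omega_open Omega_convex n0 => *; lra.
    rewrite powRM ?edist_to_ge0// ler_wpM2r ?powR_ge0//.
    by apply: ler1_powR; rewrite ?ler1n ?ltW.
  have gyx : g y - g x <= K * dist x `^ alpha.
    apply: le_trans (ler_norm _) _; apply: le_trans (gK _ _ (cl _ Oy) (cl _ Ox)) _.
    rewrite ler_wpM2l//; apply: ge0_ler_powR; rewrite ?nnegrE ?edist_to_ge0 ?enorm_ge0 ?(ltW al0)//.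
    by move: yx d0; move: (enorm _) (dist x); clear -Omega_ball Omega_open Omega_convex n0 => *; lra.
  have dga : dist x `^ alpha <= (2 * r) `^ (alpha - ga) * dist x `^ ga.
    have -> : dist x `^ alpha = dist x `^ (alpha - ga) * dist x `^ ga.
      by rewrite -powRD ?subrK// (gt_eqF d0) implybT.
    rewrite ler_wpM2r ?powR_ge0//; apply: ge0_ler_powR; rewrite ?subr_ge0 ?nnegrE ?edist_to_ge0//.
      by rewrite mulr_ge0// ltW.
    exact: dist_le_diam.
  have -> : slope_constant K L alpha ga / 2 * dist x `^ ga =
    5 * K * ((2 * r) `^ (alpha - ga) * dist x `^ ga) + @barrier_constant R n r L ga * dist x `^ ga.
    by rewrite /slope_constant; field.
  have h1 : 2 * K * dist y `^ alpha <= 2 * K * (2 * dist x `^ alpha).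
    by rewrite ler_wpM2l// mulr_ge0.
  have h2 : 5 * K * dist x `^ alpha <= 5 * K * ((2 * r) `^ (alpha - ga) * dist x `^ ga).
    by rewrite ler_wpM2l// mulr_ge0.
  move: up lower gyx h1 h2 {dga dy yx}; move: (dist x `^ alpha) (dist y `^ alpha)
    ((2 * r) `^ _ * _) (@barrier_constant _ _ _ _ _ * _) (u x) (u y) (g x) (g y).
  by clear -Omega_ball Omega_open Omega_convex n0 => *; lra.
pose e : V := delta_mx 0 i.
have e1 : enorm e = 1.
  by rewrite /enorm dotmx_delta mxE !eqxx sqrtr1.
have s0 : 0 < dist x / 2 by rewrite divr_gt0.
have Np : enorm (x + (dist x / 2) *: e - x) = dist x / 2.
  by rewrite addrAC subrr add0r enormZ e1 mulr1 gtr0_norm.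
have Nm : enorm (x - (dist x / 2) *: e - x) = dist x / 2.
  by rewrite addrAC subrr add0r enormN enormZ e1 mulr1 gtr0_norm.
have Op : Omega (x + (dist x / 2) *: e).
  apply: (dist_ball Omega_ball Omega_open Omega_convex Ox); rewrite Np.
  by move: (dist x) d0; clear -Omega_ball Omega_open Omega_convex n0 => *; lra.
have Om : Omega (x - (dist x / 2) *: e).
  apply: (dist_ball Omega_ball Omega_open Omega_convex Ox); rewrite Nm.
  by move: (dist x) d0; clear -Omega_ball Omega_open Omega_convex n0 => *; lra.
have := convex_slope convu hd Op Om Ox (osc _ Op _) (osc _ Om _).
rewrite Np Nm lexx => /(_ isT isT); congr (_ <= h * _).
rewrite powRB ?(gt_eqF d0) ?implybT// powRr1 ?edist_to_ge0//.
by field; exact: lt0r_neq0.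
Qed.

End slope_estimate.

(** * Integrability of powers of the boundary distance *)

Section distance_power_integral.
Context {R : realType} {n : nat}.
Local Notation V := 'rV[R]_n.
Local Notation mu := (@lebesgue_outer R n).
Local Notation T := (caratheodory_type mu).
Implicit Types x y z v : V.

Section exit_set.
Variables (Omega : set V) (r : R).
Hypotheses (Omega_ball : Omega `<=` eball r) (Omega_open : open Omega)
  (Omega_convex : convex_set Omega) (n0 : (0 < n)%N) (r0 : 0 < r).
Local Notation bd := (boundary Omega).
Local Notation dist x := (edist_to x bd).

Lemma open_translate v (A : set V) : open A -> open [set x | A (x + v)].
Proof.
move=> oA; apply: (@open_comp _ _ (fun y : V => y + v)) => // y _.
by apply: (@continuousD R V V id (cst v)); [exact: cvg_id|exact: (@cst_continuous V V v)].
Qed.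

Definition exit_set v : set V := Omega `\` [set x | Omega (x + v)].

(* The translates of [exit_set v] by multiples of [v] are disjoint: a line in
   direction [v] leaves [Omega] only once. *)
Lemma exit_set_small (i : 'I_n) (s e : R) : 0 < s -> `|e| = 1 ->
  (mu (exit_set ((s * e) *: delta_mx 0%R i)) <= ((4 * r) ^+ n * (s / r))%:E)%E.
Proof.
move=> s0 e1; set v := (s * e) *: _; set A := exit_set v.
(* The largest [N] with [N s <= r]: the translates by [0, ..., N] steps stay in a cube of side
   [4 r], and there are more than [r / s] of them. *)
pose N := Num.truncn (r / s).
have rs0 : 0 <= r / s by rewrite divr_ge0// ltW.
have Ns : N%:R * s <= r by rewrite -ler_pdivlMr//; by rewrite truncn_le.
have Nr : r / s < N.+1%:R by exact: truncnS_gt.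
pose F k := (+%R (v *+ k)) @` A.
have FE k : F k = [set y | Omega (y - v *+ k)] `\` [set y | Omega (y - v *+ k + v)].
  apply/seteqP; split => [_ [x [Ox nO] <-]|y [Oy nO]].
    by split => /=; rewrite [v *+ k + x]addrC addrK.
  exists (y - v *+ k); first by split.
  by rewrite addrC subrK.
have mF k : measurable (F k : set T).
  rewrite FE; apply: measurableD; apply: measurable_open; first exact: open_translate.
  by under eq_set do rewrite -addrA; exact: open_translate.
have tF : trivIset setT F.
  apply/trivIsetP => j k _ _ jk; rewrite -subset0 => y [].
  wlog : j k jk / (j < k)%N.
    move=> H Fj Fk; have [jk'|kj|jk'] := ltngtP j k; first exact: (H j k).
      by apply: (H k j) => //; rewrite eq_sym.
    by move: jk; rewrite jk' eqxx.
  move=> {}jk [x [Ox nOx] xy] [x' [Ox' nOx'] x'y].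
  apply: nOx'; rewrite /=.
  have xE : x = x' + v *+ (k - j).
    have : v *+ j + x = v *+ k + x' by rewrite xy x'y.
    rewrite -[in v *+ k](subnK (ltnW jk)) mulrnDr [v *+ (k - j) + _]addrC -addrA.
    by move=> /addrI ->; rewrite addrC.
  have kj0 : (0 < k - j)%N by rewrite subn_gt0.
  have kjR : 0 < (k - j)%:R :> R by rewrite ltr0n.
  have kj1 : 1 <= (k - j)%:R :> R by rewrite ler1n.
  have h01 : 0 <= ((k - j)%:R : R)^-1 <= 1.
    by rewrite invr_ge0 (ltW kjR)/= invf_le1.
  have := convex_setP Omega_convex Ox' Ox h01.
  by rewrite xE addrAC subrr add0r -scaler_nat scalerA mulVf ?gt_eqF// scale1r.
have FA k : mu (F k) = mu A by exact: lebesgue_outer_translate.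
have Fbox : \big[setU/set0]_(k < N.+1) F k `<=` box (const_mx (- (2 * r)), const_mx (2 * r)).
  rewrite -bigcup_mkord => y [k /= kN [x [Ox _] <-]] j; rewrite /= !mxE.
  have : `|(v *+ k + x) 0 j| < 2 * r; last first.
    by rewrite !mxE ltr_norml => /andP[-> /ltW ->].
  have xj : `|x 0 j| < r.
    by apply: le_lt_trans (coord_le_enorm _ _) _; exact: Omega_ball.
  have kvj : `|(v *+ k) 0 j| <= r.
    apply: le_trans (coord_le_enorm _ _) _; rewrite -scaler_nat !enormZ.
    have -> : enorm (delta_mx 0 i : V) = 1.
      by rewrite /enorm dotmx_delta mxE !eqxx sqrtr1.
    rewrite mulr1 normrM e1 mulr1 normr_nat gtr0_norm//.
    by apply: le_trans Ns; rewrite ler_pM2r// ler_nat.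
  rewrite mxE; apply: le_lt_trans (ler_normD _ _) _; lra.
have vol : box_volume (const_mx (- (2 * r)) : V, const_mx (2 * r)) = (4 * r) ^+ n.
  rewrite /box_volume (eq_bigr (fun=> 4 * r)) ?prodr_const ?card_ord// => j _.
  have h : 2 * r - - (2 * r) = 4 * r by ring.
  by rewrite /= !mxE h max_r// mulr_ge0// ltW.
have : (\sum_(k < N.+1) mu (F k) <= ((4 * r) ^+ n)%:E)%E.
  have <- : lebesgue_n R n (\big[setU/set0]_(k < N.+1) F k) = (\sum_(k < N.+1) mu (F k))%E.
    exact: (measure_bigsetU (lebesgue_n R n) mF tF).
  apply: le_trans (le_lebesgue_outer Fbox) _.
  by rewrite -vol; exact: lebesgue_outer_box_le.
have fA : mu A \is a fin_num.
  rewrite ge0_fin_numE ?lebesgue_outer_ge0//.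
  apply: (@lebesgue_outer_lty _ _ _ r) => x j [/Omega_ball Ox _].
  by apply: le_trans (coord_le_enorm _ _) _; exact: ltW.
have [a AE] : exists a, mu A = a%:E by exists (fine (mu A)); rewrite fineK.
under eq_bigr do rewrite FA AE.
rewrite sumEFin sumr_const card_ord AE !lee_fin -[a *+ _]mulr_natl => H.
have a0 : 0 <= a by rewrite -lee_fin -AE lebesgue_outer_ge0.
apply: (@le_trans _ _ (N.+1%:R * a * (s / r))); last first.
  by rewrite ler_wpM2r// divr_ge0 ?(ltW r0) ?(ltW s0).
have -> : N.+1%:R * a * (s / r) = a * (N.+1%:R * (s / r)) by ring.
rewrite ler_peMr// mulrA ler_pdivlMr// mul1r mulrC -ler_pdivrMl//.
by rewrite mulrC ltW.
Qed.

(** A shift by [sqrt n * t] along the axis of the largest entry of [x - z], with sign opposite to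
    that entry, carries [x] out through the supporting hyperplane at its nearest boundary point [z].
    The layer is thus covered by [2 n] exit sets. *)
Lemma layer_small (t : R) : 0 < t ->
  (mu [set x | Omega x /\ (dist x < t)%R] <=
    (2 * n%:R * ((4 * r) ^+ n * (Num.sqrt n%:R * t / r)))%:E)%E.
Proof.
move=> t0; have sn0 : 0 < Num.sqrt n%:R :> R by rewrite sqrtr_gt0 ltr0n.
pose s := Num.sqrt n%:R * t; have s0 : 0 < s by rewrite mulr_gt0.
pose E (k : bool * 'I_n) := exit_set ((s * (-1) ^+ k.1) *: delta_mx 0 k.2).
apply: (@le_trans _ _ (mu (\big[setU/set0]_(k : bool * 'I_n) E k))).
  apply: le_lebesgue_outer => x [Ox dt].
  have b0 := boundary_neq0 Omega_ball Omega_open Omega_convex n0 Ox.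
  have d0 := dist_gt0 Omega_ball Omega_open b0 Ox.
  have [z bz dz] := nearest_boundary Omega_ball Omega_open x b0.
  have [i imax] := max_coordE (x - z) (Ordinal n0).
  have ei : dist x <= Num.sqrt n%:R * `|(x - z) 0 i|.
    by rewrite dz; apply: enorm_le_coord => //; exact: normr_ge0.
  rewrite -bigcup_seq; exists ((0 < (x - z) 0 i), i); first by rewrite /= mem_index_enum.
  split => //= Oxs.
  have := supporting_halfspace Omega_ball Omega_open Omega_convex Ox bz dz Oxs.
  rewrite addrAC dotmxDr -enorm_sqr -dz dotmxZr dotmx_delta.
  have -> : s * (-1) ^+ (0 < (x - z) 0 i)%R * (x - z) 0 i = - (s * `|(x - z) 0 i|).
    case: ltrgt0P => h; last by rewrite h !mulr0 oppr0.
      by rewrite expr1 mulrN1 mulNr.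
    by rewrite expr0 mulr1 mulrN opprK.
  apply/negP; rewrite -leNgt subr_le0 /s.
  apply: (@le_trans _ _ (t * dist x)).
    by rewrite expr2 ler_pM2r// ltW.
  by rewrite [_ * t]mulrC -[X in _ <= X]mulrA ler_pM2l.
apply: le_trans (_ : (\sum_(k : bool * 'I_n) mu (E k) <= _)%E).
  elim/big_ind2 : _ => [|A a B b Aa Bb|k _//]; first by rewrite lebesgue_outer0.
  apply: le_trans (outer_measureU2 _ _ _) _; exact: leeD.
apply: (@le_trans _ _ (\sum_(k : bool * 'I_n) ((4 * r) ^+ n * (s / r))%:E)%E).
  apply: lee_sum => k _; apply: exit_set_small => //.
  by rewrite normrX normrN1 expr1n.
rewrite sumEFin lee_fin sumr_const card_prod card_bool card_ord -[leLHS]mulr_natl.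
by rewrite natrM.
Qed.

End exit_set.

Lemma measurable_within_continuous (A : set V) (f : V -> R) :
  measurable (A : set T) -> {within A, continuous f} ->
  measurable_fun (A : set T) f.
Proof.
move=> mA /continuousP cf; apply: (measurability _ (RGenOpens.measurableE R)).
move=> _ [_ [a [b ->] <-]].
have /open_subspaceP[W oW WA] : open (f @^-1` `]a, b[%classic : set (subspace A)).
  by apply: cf; exact: itv_open.
by rewrite setIC -WA; apply: measurableI => //; exact: measurable_open.
Qed.

Lemma measurable_continuous (A : set V) (f : V -> R) :
  measurable (A : set T) -> continuous f -> measurable_fun (A : set T) f.
Proof. by move=> mA cf; apply: measurable_within_continuous => //; exact: continuous_subspaceT. Qed.

Lemma geometric_sum_le (q : R) (m : nat) : 0 <= q -> q < 1 ->
  \sum_(k < m) q ^+ k <= (1 - q)^-1.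
Proof.
move=> q0 q1; have h : 0 < 1 - q by rewrite subr_gt0.
rewrite -(ler_pM2l h) mulfV ?gt_eqF// -opprB mulNr -subrX1 opprB gerBl.
exact: exprn_ge0.
Qed.

Lemma dyadic_scale (D d : R) : 0 < d <= D ->
  exists k : nat, D / 2 ^+ k.+1 < d <= D / 2 ^+ k.
Proof.
move=> /andP[d0 dD]; have D0 : 0 < D by exact: lt_le_trans dD.
have H : exists k, D / 2 ^+ k.+1 < d.
  exists (Num.truncn (D / d)); rewrite ltr_pdivrMr ?exprn_gt0// mulrC -ltr_pdivrMr//.
  apply: lt_le_trans (truncnS_gt _) _; rewrite -natrX ler_nat.
  by apply: ltnW; rewrite ltn_expl.
exists (ex_minn H); case: ex_minnP => k -> kmin /=.
case: k kmin => [|k] kmin; first by rewrite expr0 divr1.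
by rewrite leNgt; apply/negP => /kmin; rewrite ltnn.
Qed.

(** For [q = - p < 0] the integrand is dominated by constants on dyadic sublevel sets of the
    distance. The set of index [k] contributes a constant times [(2^p / 2)^k], and the series
    converges because [p < 1]. The constant precedes [Omega], as the uniform estimate requires. *)
Lemma dist_power_integral (r q : R) : (0 < n)%N -> 0 < r -> -1 < q ->
  exists2 C : R, 0 <= C & forall Omega : set V,
    Omega `<=` eball r -> open Omega -> convex_set Omega ->
    (\int[lebesgue_n R n]_(x in Omega) (edist_to x (boundary Omega) `^ q)%:E
      <= C%:E)%E.
Proof.
move=> n0 r0 q1; pose D := 2 * r; have D0 : 0 < D by rewrite mulr_gt0.
have mdist (Omega : set V) p : measurable (Omega : set T) -> measurable_fun (Omega : set T)
    (fun x => (edist_to x (boundary Omega) `^ p)%:E).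
  move=> mO; apply/measurable_EFinP; apply: (measurableT_comp (measurable_powR p)).
  by apply: measurable_continuous => //; exact: edist_to_continuous.
have [q0|q0] := leP 0 q.
  exists (D `^ q * box_volume (const_mx (- D) : V, const_mx D)).
    by rewrite mulr_ge0 ?powR_ge0// -lee_fin box_volume_ge0.
  move=> Omega OB oO cO; have mO := measurable_open oO.
  apply: (@le_trans _ _ (\int[lebesgue_n R n]_(x in Omega) (D `^ q)%:E)%E).
    apply: (ge0_le_integral _ mO).
    - by move=> x _; rewrite lee_fin powR_ge0.
    - exact: mdist.
    - exact: measurable_cst.
    - move=> x Ox; rewrite lee_fin; apply: ge0_ler_powR; rewrite ?nnegrE ?edist_to_ge0 ?(ltW D0)//.
      apply: (dist_le_diam OB oO) => //; exact: (boundary_neq0 OB oO cO n0 Ox).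
  rewrite integral_cst// EFinM lee_pmul2l ?lte_fin ?powR_gt0//.
  apply: le_trans (lebesgue_outer_box_le _); apply: le_lebesgue_outer => x Ox j.
  have : `|x 0 j| < r by apply: le_lt_trans (coord_le_enorm _ _) _; exact: OB.
  by rewrite /= !mxE ltr_norml => /andP[]; rewrite /D; lra.
pose p := - q; have p0 : 0 < p by rewrite oppr_gt0.
pose w := 2 `^ p : R.
have w0 : 0 < w by rewrite powR_gt0.
have w2 : w < 2.
  rewrite /w /powR gt_eqF// -[ltRHS](@lnK R 2) ?posrE// ltr_expR gtr_pMl ?ln_gt0 ?ltr1n//.
  by rewrite /p; lra.
pose C1 := 2 * n%:R * ((4 * r) ^+ n * (Num.sqrt n%:R / r)) : R.
have C10 : 0 <= C1.
  apply: mulr_ge0; first by apply: mulr_ge0.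
  apply: mulr_ge0; first by apply/exprn_ge0/mulr_ge0 => //; exact: ltW.
  by apply: divr_ge0; [exact: sqrtr_ge0|exact: ltW].
pose K := 2 * C1 * D * w / D `^ p.
have K0 : 0 <= K.
  apply: divr_ge0; last exact: powR_ge0.
  by apply: mulr_ge0; [apply: mulr_ge0; [apply: mulr_ge0|]|]; rewrite ?(ltW D0) ?(ltW w0).
have q2 : 0 <= w / 2 by rewrite divr_ge0// ltW.
have q21 : w / 2 < 1 by rewrite ltr_pdivrMr// mul1r.
exists (K * (1 - w / 2)^-1).
  by rewrite mulr_ge0// invr_ge0 subr_ge0 ltW.
move=> Omega OB oO cO; have mO := measurable_open oO.
pose dist x := edist_to x (boundary Omega).
pose a k : R := w ^+ k.+1 / D `^ p.
have a0 k : 0 <= a k by rewrite divr_ge0 ?exprn_ge0 ?powR_ge0 ?(ltW w0).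
have aE k : a k = (D / 2 ^+ k.+1) `^ q.
  have E2 : (2 ^+ k.+1 : R) `^ p = w ^+ k.+1.
    by rewrite -powR_mulrn// powRAC powR_mulrn ?powR_ge0.
  have pk : 0 < 2 ^+ k.+1 :> R by rewrite exprn_gt0.
  have D2 : D `^ p = (D / 2 ^+ k.+1) `^ p * w ^+ k.+1.
    by rewrite -E2 -powRM ?divr_ge0 ?(ltW D0) ?(ltW pk)// divfK// gt_eqF.
  have -> : (D / 2 ^+ k.+1) `^ q = ((D / 2 ^+ k.+1) `^ p)^-1 by rewrite -powRN /p opprK.
  rewrite /a D2; field.
  by rewrite (gt_eqF (powR_gt0 _ (divr_gt0 D0 pk))) expf_neq0// gt_eqF.
(* The factor 2 turns the bound [dist x <= D / 2^k] of [dyadic_scale] into the strict one of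
   [layer_small]. *)
pose Lk k := [set x | Omega x /\ (dist x < 2 * (D / 2 ^+ k))%R].
have mL k : measurable (Lk k : set T).
  have -> : Lk k = Omega `&` (dist @^-1` `]-oo, 2 * (D / 2 ^+ k)[%classic).
    by apply/seteqP; split => x /=; rewrite in_itv.
  apply: measurableI => //; apply: measurable_open.
  by apply: open_comp => [x _|]; [exact: edist_to_continuous|exact: interval_open].
have muL k : (lebesgue_n R n (Lk k) <= (C1 * (2 * (D / 2 ^+ k)))%:E)%E.
  apply: le_trans (layer_small OB oO cO n0 r0 _) _.
    by rewrite mulr_gt0// divr_gt0// exprn_gt0.
  rewrite lee_fin le_eqVlt; apply/orP; left; apply/eqP.
  by rewrite /C1; field; rewrite (gt_eqF r0) expf_neq0.
have t0 k x : (0 <= (a k)%:E * (\1_(Lk k) x)%:E)%E.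
  by rewrite -EFinM lee_fin mulr_ge0.
have mt k : measurable_fun (Omega : set T) (fun x => ((a k)%:E * (\1_(Lk k) x)%:E)%E).
  apply: measurable_funeM; apply/measurable_EFinP.
  exact: measurable_indic.
apply: (@le_trans _ _ (\int[lebesgue_n R n]_(x in Omega)
    \sum_(k <oo) ((a k)%:E * (\1_(Lk k) x)%:E))%E).
  apply: (ge0_le_integral _ mO).
  - by move=> x _; rewrite lee_fin powR_ge0.
  - exact: mdist.
  - by apply: ge0_emeasurable_sum => k.
  - move=> x Ox.
    have b0 := boundary_neq0 OB oO cO n0 Ox.
    have d0 := dist_gt0 OB oO b0 Ox.
    have dD := dist_le_diam OB oO b0 Ox.
    have [|k /andP[k1 k2]] := @dyadic_scale D (dist x); first by rewrite d0.
    apply: le_trans (nneseries_lim_ge k.+1 _) => //.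
    rewrite big_nat_recr//= -[leLHS]add0e; apply: leeD; first exact: sume_ge0.
    rewrite indicE mem_set ?mule1; last first.
      by split => //; apply: le_lt_trans k2 _; rewrite ltr_pMl ?ltr1n// divr_gt0// exprn_gt0.
    have qp : q = - p by rewrite /p opprK.
    rewrite lee_fin aE qp 2!powRN lef_pV2 ?posrE ?powR_gt0 ?divr_gt0 ?exprn_gt0//.
    apply: ge0_ler_powR; rewrite ?nnegrE ?(ltW p0) ?edist_to_ge0 ?(ltW k1)//.
    by rewrite divr_ge0 ?exprn_ge0 ?(ltW D0).
rewrite integral_nneseries//.
apply: lime_le; first by apply: is_cvg_nneseries => k _ _; exact: integral_ge0.
apply: nearW => m; apply: (@le_trans _ _ (\sum_(0 <= k < m) (K * (w / 2) ^+ k)%:E)%E).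
  apply: lee_sum => k _.
  rewrite ge0_integralZl_EFin//; last first.
    by apply/measurable_EFinP; exact: measurable_indic.
  rewrite integral_indic//.
  apply: (@le_trans _ _ ((a k)%:E * (C1 * (2 * (D / 2 ^+ k)))%:E)%E).
    rewrite lee_wpmul2l ?lee_fin//; apply: le_trans (muL k).
    by apply: le_lebesgue_outer => x [].
  rewrite -EFinM lee_fin le_eqVlt; apply/orP; left; apply/eqP.
  rewrite /a /K exprS expr_div_n; field.
  by rewrite (gt_eqF (powR_gt0 _ D0)) expf_neq0.
rewrite sumEFin lee_fin -mulr_sumr ler_wpM2l// big_mkord.
exact: geometric_sum_le.
Qed.

End distance_power_integral.

(** * Existence of the weak gradient *)

Section lebesgue_integration.
Context {R : realType} {n : nat}.
Local Notation V := 'rV[R]_n.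
Local Notation mu := (@lebesgue_outer R n).
Local Notation T := (caratheodory_type mu).
Local Notation lambda := (lebesgue_n R n).
Implicit Types (x y v h : V) (A D : set V) (f : V -> R).

Lemma measurable_translate h A : measurable (A : set T) ->
  measurable ([set x | A (x + h)] : set T).
Proof.
move=> mA; apply: le_caratheodory_measurable => X.
have tr (B : set V) : mu (X `&` [set x | B (x + h)]) = mu ((+%R h @` X) `&` B).
  rewrite -[RHS](lebesgue_outer_translate (- h)); congr (mu _).
  apply/seteqP; split => [x [Xx Bx]|_ [_ [[y Xy <-] By] <-]].
    exists (h + x); last by rewrite addKr.
    by split; [exists x|rewrite addrC].
  by rewrite addKr; split => //=; rewrite addrC.
have -> : ~` [set x | A (x + h)] = [set x | (~` A) (x + h)] by [].
rewrite -[leRHS](lebesgue_outer_translate h X) [leRHS](mA (+%R h @` X)).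
have tr' (B : set V) : (mu (X `&` [set x | B (x + h)%R]) <= mu ((+%R h @` X) `&` B))%E by rewrite tr.
by apply: leeD; [exact: (tr' A)|exact: (tr' (~` A))].
Qed.

Lemma measurable_fun_translate h (f : V -> R) : measurable_fun [set: T] f ->
  measurable_fun [set: T] (fun x => f (x + h)).
Proof.
move=> mf _ B mB; rewrite setTI.
by have := measurable_translate h (mf measurableT B mB); rewrite setTI.
Qed.

Lemma Rintegral_translate h f : lambda.-integrable setT (EFin \o f) ->
  measurable_fun [set: T] f ->
  \int[lambda]_x f (x + h) = \int[lambda]_x f x.
Proof.
move=> intf mf.
pose phi : T -> T := fun x : V => x + h.
have mphi : measurable_fun [set: T] phi.
  by move=> _ B mB; rewrite setTI; exact: measurable_translate.
have phiE (B : set T) : measurable B -> pushforward lambda phi B = lambda B.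
  move=> mB; rewrite /pushforward /=.
  rewrite -[LHS](lebesgue_outer_translate h); congr (mu _).
  apply/seteqP; split => [_ [x Bx <-]|x Bx]; first by rewrite addrC.
  by exists (x - h); rewrite /preimage/= /phi ?subrK// addrC subrK.
rewrite /Rintegral; congr fine.
have mef : measurable_fun [set: T] (EFin \o f) by exact/measurable_EFinP.
have intfp : lambda.-integrable (phi @^-1` setT) ((EFin \o f) \o phi).
  apply/integrableP; split.
    by apply/measurable_EFinP; exact: measurable_fun_translate.
  have /integrableP[_] := intf; congr (_ < _)%E.
  have <- : (\int[pushforward lambda phi]_x `|(EFin \o f) x| = \int[lambda]_x `|(EFin \o f) x|)%E.
    by apply: eq_measure_integral => B mB _; exact: phiE.
  rewrite ge0_integral_pushforward//; exact: measurableT_comp.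
have := integral_pushforward mphi mef intfp measurableT.
rewrite preimage_setT => <-.
by apply: eq_measure_integral => B mB _; exact: phiE.
Qed.

Lemma bounded_on (M : R) (A : set T) (f : T -> R) : (forall x, A x -> `|f x| <= M) ->
  [bounded f x | x in A].
Proof.
move=> fM; exists M; split; first exact: num_real.
by move=> y My x Ax; apply: le_trans (fM _ Ax) _; exact: ltW.
Qed.

Lemma bounded_integrable (M : R) A f : measurable (A : set T) -> (mu A < +oo)%E ->
  measurable_fun (A : set T) f -> (forall x, A x -> `|f x| <= M) ->
  lambda.-integrable A (EFin \o f).
Proof.
move=> mA Aoo mf fM; apply: measurable_bounded_integrable => //.
exact: bounded_on fM.
Qed.

Lemma Rintegral_dominated_cvg A (f_ : nat -> V -> R) f (g : V -> R) :
  measurable (A : set T) -> (forall k, measurable_fun (A : set T) (f_ k)) ->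
  (forall x, A x -> f_ k x @[k --> \oo] --> f x) ->
  lambda.-integrable A (EFin \o g) ->
  (forall k x, A x -> `|f_ k x| <= g x) ->
  \int[lambda]_(x in A) f_ k x @[k --> \oo] --> \int[lambda]_(x in A) f x.
Proof.
move=> mA mf_ cf intg fg; apply: fine_cvg.
have mf : measurable_fun (A : set T) f.
  by apply: (measurable_fun_cvg mf_) => x Ax; exact: cf.
have intf : lambda.-integrable A (EFin \o f).
  apply: (le_integrable mA) intg; first exact/measurable_EFinP.
  move=> x Ax; rewrite /= lee_fin [leRHS]ger0_norm; last first.
    by rewrite (le_trans _ (fg 0%N x Ax)).
  have c : `|f_ k x| @[k --> \oo] --> `|f x| by apply: cvg_norm; exact: cf.
  rewrite -(cvg_lim _ c)//; apply: limr_le; last exact: nearW (fun k => fg k x Ax).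
  by apply/cvg_ex; exists (`|f x|).
rewrite fineK; last exact: integrable_fin_num.
apply: (@dominated_cvg _ T R lambda A mA (fun k x => (f_ k x)%:E) (EFin \o f) (EFin \o g)) => //.
- by move=> k; exact/measurable_EFinP.
- by move=> x Ax; apply: cvg_EFin; [exact: nearW|exact: cf].
Qed.

End lebesgue_integration.

Lemma cvg_norm_le (R : realType) (f : nat -> R) (l B : R) : f k @[k --> \oo] --> l ->
  (\forall k \near \oo, `|f k| <= B) -> `|l| <= B.
Proof.
move=> /cvg_norm c fB; have <- := cvg_lim (@Rhausdorff R) c.
by apply: limr_le fB; apply/cvg_ex; exists `|l|.
Qed.

Section compact_support.
Context {R : realType} {n : nat}.
Local Notation V := 'rV[R]_n.
Local Notation mu := (@lebesgue_outer R n).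
Local Notation T := (caratheodory_type mu).
Local Notation lambda := (lebesgue_n R n).
Implicit Types (A K : set V) (f : V -> R).

Lemma compact_bound K f : compact K -> {within K, continuous f} ->
  exists2 M : R, 0 <= M & forall x, K x -> `|f x| <= M.
Proof.
move=> cK cf.
have /compact_bounded[M [_ /(_ (`|M| + 1))]] := continuous_compact cf cK.
rewrite (le_lt_trans (ler_norm M)) ?ltrDl// => /(_ isT) h.
exists (`|M| + 1); first by rewrite addr_ge0.
by move=> x cx; apply: h; exists x.
Qed.

Lemma support_patch A f : (forall x, ~ A x -> f x = 0) -> f \_ A = f.
Proof.
move=> f0; apply/funext => x; rewrite patchE; case: ifPn => // /negP nAx.
by rewrite f0// => Ax; apply: nAx; rewrite inE.
Qed.

Lemma Rintegral_support A f : (forall x, ~ A x -> f x = 0) ->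
  \int[lambda]_(x in A) f x = \int[lambda]_x f x.
Proof. by move=> f0; rewrite Rintegral_mkcond support_patch. Qed.

Lemma support_integrable (M : R) A f : measurable (A : set T) -> (mu A < +oo)%E ->
  measurable_fun [set: T] f -> (forall x, `|f x| <= M) ->
  (forall x, ~ A x -> f x = 0) -> lambda.-integrable setT (EFin \o f).
Proof.
move=> mA Aoo mf fM f0.
have : lambda.-integrable A (EFin \o f).
  by apply: (@bounded_integrable _ _ M) => //; exact: measurable_funS mf.
move=> /(integrable_mkcond _ mA); congr (_.-integrable _ _).
apply/funext => x; rewrite patchE; case: ifPn => // /negP nAx.
by rewrite /= f0// => Ax; apply: nAx; rewrite inE.
Qed.

End compact_support.

Section line_derivative.
Context {R : realType} {n : nat}.
Local Notation V := 'rV[R]_n.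
Implicit Types (x y v : V) (phi : V -> R).

Lemma line_derivative phi x v (t : R) : derivable phi (x + t *: v) v ->
  is_derive t (1 : R) (fun s : R => phi (x + s *: v)) ('D_v phi (x + t *: v)).
Proof.
pose q := fun h : R => h^-1 *: (((fun s : R => phi (x + s *: v)) \o shift t) (h *: 1) - phi (x + t *: v)).
have qE : q = fun h : R => h^-1 *: ((phi \o shift (x + t *: v)) (h *: v) - phi (x + t *: v)).
  apply/funext => h; rewrite /q /=; congr (_ *: (phi _ - _)).
  by rewrite [h *: 1]mulr1 scalerDl addrCA.
move=> d; apply: DeriveDef; first by rewrite /derivable -/q qE.
by rewrite /derive -/q qE.
Qed.

Lemma directional_mean_value phi x v (h : R) : 0 <= h ->
  (forall y, derivable phi y v) ->
  exists2 c : R, 0 <= c <= h & phi (x + h *: v) - phi x = h * 'D_v phi (x + c *: v).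
Proof.
move=> h0 dphi.
have D (t : R) := @line_derivative phi x v t (dphi (x + t *: v)).
have dq (t : R) : t \in `]0, h[%R -> is_derive t 1 (fun s : R => phi (x + s *: v)) ('D_v phi (x + t *: v)).
  by move=> _; exact: D.
have cq : {within `[0, h], continuous (fun s : R => phi (x + s *: v))}.
  by apply: derivable_within_continuous => t _; have := D t => -[].
have [c] := MVT_segment h0 dq cq.
rewrite in_itv/= scale0r addr0 subr0 => ch ->; exists c => //.
by rewrite mulrC.
Qed.

End line_derivative.

Section weak_gradient_existence.
Context {R : realType} {n : nat}.
Local Notation V := 'rV[R]_n.
Local Notation mu := (@lebesgue_outer R n).
Local Notation T := (caratheodory_type mu).
Local Notation lambda := (lebesgue_n R n).
Variables (Omega : set V) (r : R) (u : V -> R).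
Hypotheses (Omega_ball : Omega `<=` eball r) (Omega_open : open Omega)
  (Omega_convex : convex_set Omega) (n0 : (0 < n)%N)
  (u_cont : {within closure Omega, continuous u})
  (u_convex : convex_function Omega u).
Implicit Types (x y v : V) (phi : V -> R) (i : 'I_n).
Local Notation bd := (boundary Omega).
Local Notation dist x := (edist_to x bd).
Local Notation e_ i := (@unit_vec R n i).

Let step (k : nat) : R := k.+1%:R^-1.

Let step_gt0 k : 0 < step k. Proof. by rewrite invr_gt0. Qed.

(** The extension by 0 turns integrals over [Omega] into integrals over the whole space, where
    translation invariance applies. *)
Let ut : V -> R := u \_ Omega.

Definition difference_quotient i (k : nat) x : R :=
  (step k)^-1 * (ut (x + step k *: e_ i) - ut x).

(** By convexity the quotients eventually decrease as the step shrinks, so the limit exists at every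
    point of [Omega], including those where [u] is not differentiable. *)
Definition right_gradient x : V :=
  \row_i limn (fun k => difference_quotient i k x).

Let utE x : Omega x -> ut x = u x.
Proof. by move=> Ox; rewrite /ut patchE mem_set. Qed.

Let ut0 x : ~ Omega x -> ut x = 0.
Proof. by move=> Ox; rewrite /ut patchE memNset. Qed.

Lemma u_bounded : exists2 U : R, 0 <= U & forall x, closure Omega x -> `|u x| <= U.
Proof. exact: compact_bound (compact_closure_domain Omega_ball) u_cont. Qed.

Let ut_bounded (U : R) : 0 <= U -> (forall x, closure Omega x -> `|u x| <= U) ->
  forall x, `|ut x| <= U.
Proof.
move=> U0 uU x; have [Ox|nOx] := pselect (Omega x).
  by rewrite utE//; apply: uU; exact: subset_closure.
by rewrite ut0// normr0.
Qed.

Let mOmega : measurable (Omega : set T).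
Proof. exact: measurable_open. Qed.

Let Omega_lty : (mu Omega < +oo)%E.
Proof.
apply: (@lebesgue_outer_lty _ _ _ r) => x i /Omega_ball Ox.
by apply: le_trans (coord_le_enorm _ _) _; exact: ltW.
Qed.

Lemma measurable_u : measurable_fun (Omega : set T) u.
Proof.
apply: measurable_within_continuous => //.
exact: continuous_subspaceW (@subset_closure _ _) u_cont.
Qed.

Let measurable_ut : measurable_fun [set: T] ut.
Proof.
exact: ((measurable_restrictT _ mOmega).1 measurable_u).
Qed.

Let measurable_dq i k : measurable_fun [set: T] (difference_quotient i k).
Proof.
have mt := measurable_fun_translate (step k *: e_ i) measurable_ut.
have mB := @measurable_funB _ T R setT _ _ mt measurable_ut.
exact: (@measurable_funM _ T R setT _ _ (measurable_cst _) mB).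
Qed.

Lemma slope_mono x v (h h' : R) : 0 < h <= h' -> Omega x -> Omega (x + h' *: v) ->
  h^-1 * (u (x + h *: v) - u x) <= h'^-1 * (u (x + h' *: v) - u x).
Proof.
move=> /andP[h0 hh'] Ox Oh'; have h'0 : 0 < h' by exact: lt_le_trans hh'.
have hs1 : 0 <= h / h' <= 1.
  by rewrite divr_ge0 ?(ltW h0) ?(ltW h'0)//= ler_pdivrMr// mul1r.
have := convex_functionP u_convex Ox Oh' hs1.
rewrite [_ - x]addrAC subrr add0r scalerA divfK ?gt_eqF// => H.
rewrite ler_pdivrMl//.
have -> : h * (h'^-1 * (u (x + h' *: v) - u x)) = h / h' * (u (x + h' *: v) - u x) by ring.
by lra.
Qed.

Lemma right_gradient_cvg x i : Omega x ->
  difference_quotient i k x @[k --> \oo] --> right_gradient x 0 i.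
Proof.
move=> Ox; rewrite mxE; suff : cvgn (fun k => difference_quotient i k x) by [].
have b0 := boundary_neq0 Omega_ball Omega_open Omega_convex n0 Ox.
have d0 := dist_gt0 Omega_ball Omega_open b0 Ox.
have e1 : enorm (e_ i) = 1 by rewrite /unit_vec /enorm dotmx_delta mxE !eqxx sqrtr1.
(* From [N] on the steps are shorter than [dist x / 2], so the quotients involve [u] itself and not
   its extension by 0. *)
pose N := Num.truncn (dist x / 2)^-1.
have sN k : step (k + N) < dist x / 2.
  rewrite /step -[ltRHS]invrK ltf_pV2 ?posrE ?invr_gt0 ?divr_gt0//.
  by apply: lt_le_trans (truncnS_gt _) _; rewrite ler_nat ltnS leq_addl.
have On (h : R) : `|h| < dist x -> Omega (x + h *: e_ i).
  move=> hd; apply: (dist_ball Omega_ball Omega_open Omega_convex Ox).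
  by rewrite addrAC subrr add0r enormZ e1 mulr1.
have Os k : Omega (x + step (k + N) *: e_ i).
  by apply: On; rewrite gtr0_norm//; have := sN k; lra.
have dqE k : difference_quotient i (k + N) x =
    (step (k + N))^-1 * (u (x + step (k + N) *: e_ i) - u x).
  by rewrite /difference_quotient !utE.
have [U U0 uU] := u_bounded.
have cl y : Omega y -> `|u y| <= U by move=> Oy; apply: uU; exact: subset_closure.
have /cvg_ex[l cl'] : cvgn (fun k => difference_quotient i (k + N) x).
  apply: nonincreasing_is_cvgn => [k k' kk'|].
    rewrite !dqE; apply: slope_mono => //; rewrite step_gt0/=.
    by rewrite /step lef_pV2 ?posrE// ler_nat ltnS leq_add2r.
  exists (- (2 * U / (dist x / 2))) => _ [k _ <-]; rewrite dqE.
  have s0 : 0 < dist x / 2 by rewrite divr_gt0.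
  have Op : Omega (x + (dist x / 2) *: e_ i) by apply: On; rewrite gtr0_norm//; lra.
  have Om : Omega (x - (dist x / 2) *: e_ i).
    by rewrite -scaleNr; apply: On; rewrite normrN gtr0_norm//; lra.
  have B y : Omega y -> u y - u x <= 2 * U.
    by move=> /cl; have := cl _ Ox; rewrite !ler_norml => /andP[? ?] /andP[? ?]; lra.
  have hs : 0 < step (k + N) <= dist x / 2 by rewrite step_gt0 ltW.
  have := convex_slope Omega_convex u_convex hs Op Om Ox (B _ Op) (B _ Om).
  rewrite ler_norml => /andP[H _]; rewrite ler_pdivlMl// mulrN.
  exact: H.
apply/cvg_ex; exists l; rewrite -(cvg_shiftn N).
exact: cl'.
Qed.

Lemma right_gradient_bound x i (B d : R) : Omega x -> 0 < d ->
  (forall h, 0 < h <= d -> `|u (x + h *: delta_mx 0 i) - u x| <= h * B) ->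
  `|right_gradient x 0 i| <= B.
Proof.
move=> Ox d0 uB.
have b0 := boundary_neq0 Omega_ball Omega_open Omega_convex n0 Ox.
have dx0 := dist_gt0 Omega_ball Omega_open b0 Ox.
apply: cvg_norm_le (right_gradient_cvg (i := i) Ox) _.
have [m0 m1 m2] : [/\ 0 < Num.min d (dist x / 2), Num.min d (dist x / 2) <= d &
    Num.min d (dist x / 2) <= dist x / 2].
  by rewrite lt_min d0 divr_gt0// !ge_min !lexx orbT.
exists (Num.truncn (Num.min d (dist x / 2))^-1) => // k /= Nk.
have sk : step k <= Num.min d (dist x / 2).
  rewrite /step -[leRHS]invrK lef_pV2 ?posrE ?invr_gt0// ltW//.
  by apply: lt_le_trans (truncnS_gt _) _; rewrite ler_nat ltnS.
have Ok : Omega (x + step k *: e_ i).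
  apply: (dist_ball Omega_ball Omega_open Omega_convex Ox).
  rewrite addrAC subrr add0r enormZ /unit_vec /enorm dotmx_delta mxE !eqxx sqrtr1 mulr1.
  by rewrite gtr0_norm//; lra.
rewrite /difference_quotient !utE// normrM normfV (gtr0_norm (step_gt0 k)) ler_pdivrMl//.
by apply: uB; rewrite step_gt0 (le_trans sk).
Qed.

Lemma right_gradient_measurable i : measurable_fun (Omega : set T) (fun x => right_gradient x 0 i).
Proof.
have mq k : measurable_fun (Omega : set T) (difference_quotient i k).
  by apply: measurable_funS (measurable_dq i k).
apply: (measurable_fun_cvg mq) => x Ox; exact: right_gradient_cvg.
Qed.

Lemma compact_room (K : set V) : compact K -> K `<=` Omega ->
  exists2 d : R, 0 < d & forall x, K x -> 2 * d <= dist x.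
Proof.
move=> cK KO; have [->|/set0P K0] := eqVneq K set0; first by exists 1.
have [x] := EVT_min_rV K0 cK (continuous_subspaceT (@edist_to_continuous _ _ bd)).
rewrite inE => Kx xm; exists (dist x / 2).
  have Ox := KO _ Kx; have b0 := boundary_neq0 Omega_ball Omega_open Omega_convex n0 Ox.
  by rewrite divr_gt0// (dist_gt0 Omega_ball).
by move=> y Ky; rewrite mulrC divfK//; apply: xm; rewrite inE.
Qed.

(** The domination needed for the limit, uniform in [k]: steps of length at least [d] are bounded by
    dividing the oscillation of [u], shorter ones by [convex_slope]. *)
Lemma difference_quotient_bound (K : set V) : compact K -> K `<=` Omega ->
  exists2 B : R, 0 <= B & forall i k x, K x -> `|difference_quotient i k x| <= B.
Proof.
move=> cK KO; have [d d0 Kd] := compact_room cK KO.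
have [U U0 uU] := u_bounded; exists (2 * U / d).
  by rewrite divr_ge0 ?mulr_ge0 ?(ltW d0).
move=> i k x Kx; have Ox := KO _ Kx.
have e1 : enorm (e_ i) = 1 by rewrite /unit_vec /enorm dotmx_delta mxE !eqxx sqrtr1.
have utU := ut_bounded U0 uU.
rewrite normrM normfV (gtr0_norm (step_gt0 k)) ler_pdivrMl//.
have [dk|kd] := leP d (step k).
  apply: (@le_trans _ _ (2 * U)).
    apply: le_trans (ler_normB _ _) _.
    by have := utU (x + step k *: e_ i); have := utU x; lra.
  by rewrite mulrA ler_pdivlMr// mulrC ler_wpM2r// mulr_ge0.
have On (h : R) : `|h| <= d -> Omega (x + h *: e_ i).
  move=> hd; apply: (dist_ball Omega_ball Omega_open Omega_convex Ox).
  by rewrite addrAC subrr add0r enormZ e1 mulr1; have := Kd x Kx; lra.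
have Op : Omega (x + d *: e_ i) by apply: On; rewrite gtr0_norm.
have Om : Omega (x - d *: e_ i) by rewrite -scaleNr; apply: On; rewrite normrN gtr0_norm.
have Ok : Omega (x + step k *: e_ i) by apply: On; rewrite gtr0_norm// ltW.
rewrite !utE//.
have B y : Omega y -> u y - u x <= 2 * U.
  by move=> Oy; have := utU y; have := utU x; rewrite !utE// !ler_norml => /andP[? ?] /andP[? ?]; lra.
have hs : 0 < step k <= d by rewrite step_gt0 ltW.
exact: (convex_slope Omega_convex u_convex hs Op Om Ox (B _ Op) (B _ Om)).
Qed.

Lemma right_gradient_L1loc i : L1loc Omega (fun x => right_gradient x 0 i).
Proof.
move=> K cK KO; have [B B0 dqB] := difference_quotient_bound cK KO.
apply: (@bounded_integrable _ _ B).
- exact: compact_measurable.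
- exact: compact_lebesgue_outer_lty.
- by apply: measurable_funS (right_gradient_measurable i).
- move=> x Kx; apply: cvg_norm_le (right_gradient_cvg (i := i) (KO _ Kx)) _.
  by apply: nearW => k; exact: dqB.
Qed.

Lemma u_L1loc : L1loc Omega u.
Proof.
move=> K cK KO; have [U U0 uU] := u_bounded.
apply: (@bounded_integrable _ _ U).
- exact: compact_measurable.
- exact: compact_lebesgue_outer_lty.
- by apply: measurable_funS measurable_u.
- by move=> x Kx; apply: uU; exact/subset_closure/KO.
Qed.

Lemma test_functionP phi : test_function Omega phi ->
  [/\ continuous phi, forall i, continuous ('D_(e_ i) phi),
    forall i x, derivable phi x (e_ i) &
    exists S, [/\ compact S, S `<=` Omega & forall x, ~ S x -> phi x = 0]].
Proof.
move=> [sm cS SO]; split.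
- by have [] := sm [::].
- by move=> i; have [] := sm [:: i].
- by move=> i x; have [_] := sm [::]; exact.
- exists (closure [set x | phi x != 0]); split => // x nSx.
  by apply: contrapT => px; apply: nSx; apply: subset_closure; exact/eqP.
Qed.

(** A translation of the variable in the whole space. It is valid for every step, even if shifted
    points leave [Omega], because the zero extension [ut] stands on both sides. *)
Lemma summation_by_parts phi i k : test_function Omega phi ->
  \int[lambda]_(x in Omega) (u x * ((step k)^-1 * (phi x - phi (x - step k *: e_ i)))) =
  - \int[lambda]_(x in Omega) (difference_quotient i k x * phi x).
Proof.
move=> /test_functionP[cphi _ _ [S [cS SO phi0]]].
set h := step k *: e_ i; have [M M0 phiM] := compact_bound cS (continuous_subspaceT cphi).
have phiM' x : `|phi x| <= M.
  by have [/phiM//|/phi0->] := pselect (S x); rewrite normr0.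
have [U U0 uU] := u_bounded; have utU := ut_bounded U0 uU.
have mphi : measurable_fun [set: T] phi := measurable_continuous measurableT cphi.
have mphi' : measurable_fun [set: T] (fun x => phi (x - h)) := measurable_fun_translate (- h) mphi.
have mut' : measurable_fun [set: T] (fun x => ut (x + h)) := measurable_fun_translate h measurable_ut.
have mS : measurable (S : set T) := compact_measurable cS.
have m1 : measurable_fun [set: T] (fun x => ut x * phi x).
  exact: (@measurable_funM _ T R setT _ _ measurable_ut mphi).
have m2 : measurable_fun [set: T] (fun x => ut x * phi (x - h)).
  exact: (@measurable_funM _ T R setT _ _ measurable_ut mphi').
have m3 : measurable_fun [set: T] (fun x => ut (x + h) * phi x).
  exact: (@measurable_funM _ T R setT _ _ mut' mphi).
have i1 : lambda.-integrable setT (EFin \o (fun x => ut x * phi x)).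
  apply: (@support_integrable _ _ (U * M) Omega _ mOmega Omega_lty m1) => x.
    by rewrite normrM ler_pM.
  by move=> /ut0->; rewrite mul0r.
have i2 : lambda.-integrable setT (EFin \o (fun x => ut x * phi (x - h))).
  apply: (@support_integrable _ _ (U * M) Omega _ mOmega Omega_lty m2) => x.
    by rewrite normrM ler_pM.
  by move=> /ut0->; rewrite mul0r.
have i3 : lambda.-integrable setT (EFin \o (fun x => ut (x + h) * phi x)).
  apply: (@support_integrable _ _ (U * M) S _ mS (compact_lebesgue_outer_lty cS) m3) => x.
    by rewrite normrM ler_pM.
  by move=> /phi0->; rewrite mulr0.
transitivity ((step k)^-1 * \int[lambda]_x (ut x * phi x - ut x * phi (x - h))).
  rewrite -RintegralZl//; last exact: (integrableB measurableT i1 i2).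
  rewrite -(Rintegral_support (A := Omega)).
    apply: eq_Rintegral => x; rewrite inE => Ox; rewrite utE//; ring.
  by move=> x /ut0->; ring.
have tr : \int[lambda]_x (ut x * phi (x - h)) = \int[lambda]_x (ut (x + h) * phi x).
  rewrite -(Rintegral_translate h i2 m2).
  by apply: eq_Rintegral => x _; rewrite addrK.
rewrite RintegralB// tr.
have -> : \int[lambda]_(x in Omega) (difference_quotient i k x * phi x) =
    (step k)^-1 * \int[lambda]_x (ut (x + h) * phi x - ut x * phi x).
  rewrite -RintegralZl//; last exact: (integrableB measurableT i3 i1).
  rewrite Rintegral_support; last by move=> x nOx; rewrite phi0 ?mulr0// => /SO.
  by apply: eq_Rintegral => x _; rewrite /difference_quotient -/h; ring.
by rewrite RintegralB//; ring.
Qed.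

Lemma backward_quotient_cvg phi i x : continuous ('D_(e_ i) phi) ->
  (forall y, derivable phi y (e_ i)) ->
  (step k)^-1 * (phi x - phi (x - step k *: e_ i)) @[k --> \oo] --> 'D_(e_ i) phi x.
Proof.
move=> cD dphi; apply/cvgrPdist_le => /= e e0.
have /cvgrPdist_le/(_ _ e0)/nbhs_enormP[d d0 De] := cD x.
exists (Num.truncn d^-1) => // k /= Nk.
have sd : step k < d.
  rewrite /step -[ltRHS]invrK ltf_pV2 ?posrE ?invr_gt0//.
  by apply: lt_le_trans (truncnS_gt _) _; rewrite ler_nat ltnS.
have [c /andP[c0 cs]] := directional_mean_value (x - step k *: e_ i) (ltW (step_gt0 k)) dphi.
rewrite subrK => ->; rewrite mulKf ?gt_eqF//; apply: De.
rewrite (_ : _ - x = (c - step k) *: e_ i); last by rv_ring.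
rewrite enormZ; have -> : enorm (e_ i) = 1 by rewrite /unit_vec /enorm dotmx_delta mxE !eqxx sqrtr1.
by rewrite mulr1 ler0_norm; [have := step_gt0 k; lra|lra].
Qed.

Lemma backward_quotient_bound phi i : continuous ('D_(e_ i) phi) ->
  (forall y, derivable phi y (e_ i)) ->
  exists2 L : R, 0 <= L & forall k x, Omega x ->
    `|(step k)^-1 * (phi x - phi (x - step k *: e_ i))| <= L.
Proof.
move=> cD dphi.
(* Steps are at most 1, so the mean value points of all quotients lie in this enlarged cube. *)
have [L L0 DL] := compact_bound (@compact_cbox R n (const_mx (- (r + 1)), const_mx (r + 1)))
  (continuous_subspaceT cD).
exists L => // k x Ox.
have [c /andP[c0 cs]] := directional_mean_value (x - step k *: e_ i) (ltW (step_gt0 k)) dphi.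
rewrite subrK => ->; rewrite mulKf ?gt_eqF//; apply: DL => j.
have s1 : step k <= 1 by rewrite /step invf_le1// ler1n.
have xj : `|x 0 j| <= r by apply: le_trans (coord_le_enorm _ _) _; exact/ltW/Omega_ball.
rewrite (_ : _ - _ + _ = x + (c - step k) *: e_ i); last by rv_ring.
rewrite !mxE -ler_norml; set b := _ && _.
apply: le_trans (ler_normD _ _) _; rewrite lerD// normrM.
apply: mulr_ile1 => //; last by case: b; rewrite ?normr0 ?normr1.
by rewrite ler_norml; have := step_gt0 k; lra.
Qed.

Lemma right_gradient_weak : weak_gradient Omega u right_gradient.
Proof.
split; first exact: u_L1loc.
move=> i; split; first exact: right_gradient_L1loc.
move=> phi tphi; have [cphi cD dphi [S [cS SO phi0]]] := test_functionP tphi.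
have [U U0 uU] := u_bounded.
have mphi A : measurable (A : set T) -> measurable_fun (A : set T) phi.
  by move=> mA; exact: measurable_continuous.
have mS := compact_measurable cS.
have lim1 : \int[lambda]_(x in Omega) (u x * ((step k)^-1 * (phi x - phi (x - step k *: e_ i))))
    @[k --> \oo] --> \int[lambda]_(x in Omega) (u x * 'D_(e_ i) phi x).
  have [L L0 DL] := backward_quotient_bound (cD i) (dphi i).
  apply: (@Rintegral_dominated_cvg _ _ _ _ _ (cst (U * L))).
  - exact: mOmega.
  - move=> k; have m2 : measurable_fun (Omega : set T) (fun x => phi (x - step k *: e_ i)).
      by apply: measurable_funS (measurable_fun_translate (- (step k *: e_ i)) (mphi _ measurableT)).
    have m3 := @measurable_funB _ T R Omega _ _ (mphi _ mOmega) m2.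
    have m4 := @measurable_funM _ T R Omega _ _ (measurable_cst ((step k)^-1)) m3.
    exact: (@measurable_funM _ T R Omega _ _ measurable_u m4).
  - by move=> x _; apply: cvgM; [exact: cvg_cst|exact: backward_quotient_cvg].
  - exact: (@bounded_integrable _ _ `|U * L| _ (cst (U * L)) mOmega Omega_lty (measurable_cst _)).
  - move=> k x Ox; rewrite normrM ler_pM ?DL//.
    by apply: uU; exact: subset_closure.
have lim2 : \int[lambda]_(x in Omega) (difference_quotient i k x * phi x)
    @[k --> \oo] --> \int[lambda]_(x in Omega) (right_gradient x 0 i * phi x).
  (* The difference quotients are dominated only on compact subsets of [Omega], so the integrals are
     moved to the support of [phi]. *)
  have toS (w : V -> R) : \int[lambda]_(x in Omega) (w x * phi x) = \int[lambda]_(x in S) (w x * phi x).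
    have w0 x : ~ S x -> w x * phi x = 0 by move=> /phi0 ->; rewrite mulr0.
    have wO x : ~ Omega x -> w x * phi x = 0 by move=> nO; apply: w0 => /SO.
    by rewrite (Rintegral_support w0) (Rintegral_support wO).
  rewrite toS (_ : (fun k => _) = fun k => \int[lambda]_(x in S) (difference_quotient i k x * phi x)).
    have [B B0 dqB] := difference_quotient_bound cS SO.
    have [M M0 phiM] := compact_bound cS (continuous_subspaceT cphi).
    apply: (@Rintegral_dominated_cvg _ _ _ _ _ (cst (B * M))).
    - exact: mS.
    - move=> k; have m1 : measurable_fun (S : set T) (difference_quotient i k).
        by apply: measurable_funS (measurable_dq i k).
      exact: (@measurable_funM _ T R S _ _ m1 (mphi _ mS)).
    - move=> x Sx; apply: cvgM; last exact: cvg_cst.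
      by apply: right_gradient_cvg; exact: SO.
    - exact: (@bounded_integrable _ _ `|B * M| _ (cst (B * M)) mS (compact_lebesgue_outer_lty cS) (measurable_cst _)).
    - by move=> k x Sx; rewrite normrM ler_pM ?dqB ?phiM.
  by apply/funext => k; rewrite toS.
apply: (cvg_unique (@Rhausdorff R) lim1).
rewrite (_ : (fun k => _) = fun k => - \int[lambda]_(x in Omega) (difference_quotient i k x * phi x)).
  exact: cvgN.
by apply/funext => k; exact: summation_by_parts.
Qed.

End weak_gradient_existence.

(** * Uniqueness of the weak gradient *)

Section flat_function.
Context {R : realType}.
Variable eps : R.
Hypothesis eps0 : 0 < eps.
Implicit Types (m : nat) (t : R).

(** The powers [t^-m] close the family under differentiation up to linear combinations. The
    parameter [eps] later tends to 0, which sends [flat eps 0] to the indicator of the positive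
    half-line. *)
Definition flat m t : R := if 0 < t then t^-1 ^+ m * expR (- (eps * t^-1)) else 0.

Lemma flat_le0 m t : t <= 0 -> flat m t = 0.
Proof. by rewrite /flat ltNge => ->. Qed.

Lemma flat_ge0 m t : 0 <= flat m t.
Proof.
rewrite /flat; case: ifP => // t0.
by rewrite mulr_ge0 ?exprn_ge0 ?expR_ge0 ?invr_ge0 ?(ltW t0).
Qed.

(* [exp (- y) <= (N / y) ^ N] for [N = m + 2] and [y = eps / t]. *)
Lemma flat_le_sqr m t : flat m t <= (m.+2%:R / eps) ^+ m.+2 * t ^+ 2.
Proof.
rewrite /flat; case: ifP => [t0|_]; last first.
  by rewrite mulr_ge0 ?sqr_ge0// exprn_ge0// divr_ge0// ltW.
set N := m.+2; have N0 : (0 : R) < N%:R by rewrite ltr0n.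
have y0 : 0 < eps * t^-1 by rewrite mulr_gt0 ?invr_gt0.
have H : (eps * t^-1 / N%:R) ^+ N <= expR (eps * t^-1).
  have -> : expR (eps * t^-1) = expR (eps * t^-1 / N%:R) ^+ N.
    by rewrite -expRM_natl; congr expR; rewrite [RHS]mulrC divfK// lt0r_neq0.
  have z0 : 0 <= eps * t^-1 / N%:R by rewrite divr_ge0// ltW.
  rewrite lerXn2r ?nnegrE ?expR_ge0//.
  by apply: le_trans (expR_ge1Dx _); rewrite lerDr.
rewrite expRN.
have K0 : 0 < (eps * t^-1 / N%:R) ^+ N by rewrite exprn_gt0// divr_gt0.
have := lef_pV2 (expR_gt0 (eps * t^-1) : expR (eps * t^-1) \in Num.pos) K0; rewrite H => H'.
apply: (@le_trans _ _ (t^-1 ^+ m * ((eps * t^-1 / N%:R) ^+ N)^-1)).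
  by rewrite ler_wpM2l ?H'// exprn_ge0// invr_ge0 ltW.
rewrite -exprVn (_ : (eps * t^-1 / N%:R)^-1 = N%:R / eps * t); last first.
  by field; rewrite !gt_eqF.
rewrite exprMn mulrCA ler_pM2l ?exprn_gt0 ?divr_gt0//.
by rewrite {1}/N -addn2 exprD mulrA -exprMn mulVf ?gt_eqF// expr1n mul1r.
Qed.

Lemma is_derive_flat m t :
  is_derive t 1 (flat m) (- m%:R * flat m.+1 t + eps * flat m.+2 t).
Proof.
have [t0|t0|->] := ltgtP t 0.
- rewrite !flat_le0 ?(ltW t0)// !mulr0 addr0.
  apply: near_eq_is_derive (is_derive_cst (0 : R) t (1 : R)).
  by near=> s; rewrite flat_le0// ltW//; near: s; exact: lt_nbhsl.
- suff H : is_derive t (1 : R) (fun s : R => s^-1 ^+ m * expR (- (eps * s^-1)))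
      (- m%:R * flat m.+1 t + eps * flat m.+2 t).
    apply: near_eq_is_derive H.
    by near=> s; rewrite /flat ifT//; near: s; exact: lt_nbhsr.
  have dV : is_derive t 1 (fun s : R => s^-1) (- t ^- 2 *: 1).
    by apply: (@is_deriveV R id) => //; exact: lt0r_neq0.
  have dX := is_deriveX m dV.
  have dM : is_derive t 1 (fun s : R => - (eps * s^-1)) (- (eps *: (- t ^- 2 *: 1))).
    by apply: is_deriveN; apply: is_deriveZ.
  have dE := is_derive1_comp (is_derive_expR _) dM.
  have := is_deriveM dX dE.
  rewrite (_ : (fun s => s^-1 ^+ m * expR (- (eps * s^-1))) =
    (fun s : R => s^-1) ^+ m * (expR \o (fun s : R => - (eps * s^-1)))); last first.
    by apply/funext => s; rewrite /= exprfctE.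
  move=> /is_derive_eq; apply.
  rewrite exprfctE /flat t0 /= .
  have ZE (a b : R) : a *: (b : R) = a * b by [].
  rewrite !ZE -exprVn; case: (m) => [|k] /=; first by rewrite expr0; ring.
  by rewrite !exprS; ring.
- rewrite !flat_le0// !mulr0 addr0.
  set C := (m.+2%:R / eps) ^+ m.+2.
  have C0 : 0 < C by rewrite exprn_gt0// divr_gt0.
  (* The quotient at 0 is at most [C |h|], by the quadratic bound [flat_le_sqr]. *)
  have c : h^-1 *: ((flat m \o shift 0) (h *: (1 : R)) - flat m 0) @[h --> 0^'] --> 0.
    apply/cvgr0Pnorm_le => e e0.
    near=> h; have h0 : h != 0 by near: h; exact: nbhs_dnbhs_neq.
    rewrite /= addr0 [h *: 1]mulr1 [flat m 0]flat_le0// subr0 normrM normfV.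
    rewrite ler_pdivrMl ?normr_gt0// ger0_norm ?flat_ge0//.
    apply: le_trans (flat_le_sqr m h) _; rewrite -/C -real_normK ?num_real// expr2 mulrCA.
    rewrite ler_wpM2l// -ler_pdivlMl// mulrC ltW//.
    by near: h; apply: dnbhs0_lt; rewrite divr_gt0.
  apply: DeriveDef; first by apply/cvg_ex; exists 0.
  exact: cvg_lim c.
Unshelve. all: by end_near. Qed.

End flat_function.

Lemma is_derive_line (R : realType) (n : nat) (phi : 'rV[R]_n -> R) (x v : 'rV[R]_n) (D : R) :
  is_derive (0 : R) (1 : R) (fun s : R => phi (x + s *: v)) D -> is_derive x v phi D.
Proof.
pose q := fun h : R => h^-1 *: (((fun s : R => phi (x + s *: v)) \o shift 0) (h *: 1) - phi (x + 0 *: v)).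
have qE : q = fun h : R => h^-1 *: ((phi \o shift x) (h *: v) - phi x).
  apply/funext => h; rewrite /q /= addr0 [h *: 1]mulr1 scale0r addr0.
  by rewrite [x + _]addrC.
move=> [d]; rewrite /derivable /derive -/q qE in d *.
by move=> dE; exact: DeriveDef.
Qed.

Section bump.
Context {R : realType} {n : nat}.
Local Notation V := 'rV[R]_n.
Variable eps : R.
Hypothesis eps0 : 0 < eps.
Implicit Types (x y v : V) (f g phi : V -> R) (i j : 'I_n).
Local Notation e_ i := (@unit_vec R n i).

(** A class of continuous functions closed under partial derivatives: smoothness of its members
    follows by induction on the list of partials, without a formula for iterated derivatives. *)
Inductive flat_algebra : (V -> R) -> Prop :=
| flat_algebra_cst c : flat_algebra (cst c)
| flat_algebra_atom m i (s c : R) : flat_algebra (fun x => flat eps m (s * x 0 i + c))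
| flat_algebraD f g : flat_algebra f -> flat_algebra g -> flat_algebra (f + g)
| flat_algebraM f g : flat_algebra f -> flat_algebra g -> flat_algebra (f * g).

Lemma flat_algebra_derive f j : flat_algebra f ->
  exists2 g, flat_algebra g & forall x, is_derive x (e_ j) f (g x).
Proof.
elim => [c|m i s c|{}f g _ [f' Ff' df] _ [g' Fg' dg]|{}f g Ff [f' Ff' df] Fg [g' Fg' dg]].
- by exists (cst 0); [exact: flat_algebra_cst|move=> x; exact: is_derive_cst].
- pose b : R := (j == i)%:R.
  pose at_ k := fun x : V => flat eps k (s * x 0 i + c).
  exists (cst (s * b) * (cst (- m%:R) * at_ m.+1 + cst eps * at_ m.+2)).
    do ![apply: flat_algebraM|apply: flat_algebraD];
      by [exact: flat_algebra_cst|exact: flat_algebra_atom].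
  move=> x; apply: is_derive_line.
  pose l (t : R) : R := (s * x 0 i + c) + t * (s * b).
  have dl : is_derive (0 : R) (1 : R) l (s * b).
    have d1 := is_deriveD (is_derive_cst (s * x 0 i + c) (0 : R) (1 : R))
      (is_deriveM (is_derive_id (0 : R) (1 : R)) (is_derive_cst (s * b) (0 : R) (1 : R))).
    apply: (is_derive_eq d1).
    have ZE (a a' : R) : a *: (a' : R) = a * a' by [].
    by rewrite !ZE /=; ring.
  have := is_derive1_comp (is_derive_flat eps0 m (l 0)) dl.
  rewrite (_ : _ \o _ = fun t : R => flat eps m (s * (x + t *: e_ j) 0 i + c)).
    move=> /is_derive_eq; apply.
    by rewrite /l mul0r addr0 mulrC.
  apply/funext => t /=; congr (flat _ _ _).
  by rewrite /l !mxE /= [i == j]eq_sym -/b; ring.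
- exists (f' + g'); first exact: flat_algebraD.
  by move=> x; exact: is_deriveD.
- exists (f * g' + g * f'); first by apply: flat_algebraD; exact: flat_algebraM.
  by move=> x; exact: is_deriveM.
Qed.

Lemma flat_continuous m : continuous (flat eps m).
Proof.
move=> t; apply: differentiable_continuous; apply/derivable1_diffP.
by have [] := is_derive_flat eps0 m t.
Qed.

Lemma flat_algebra_continuous f : flat_algebra f -> continuous f.
Proof.
elim => [c|m i s c|{}f g _ cf _ cg|{}f g _ cf _ cg] x.
- exact: cst_continuous.
- apply: (@continuous_comp _ _ _ (fun y : V => s * y 0 i + c)); last exact: flat_continuous.
  apply: continuousD; last exact: cst_continuous.
  by apply: continuousM; [exact: cst_continuous|exact: coord_continuous].
- exact: (cvgD (cf x) (cg x)).
- exact: (cvgM (cf x) (cg x)).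
Qed.

Lemma flat_algebra_smooth f : flat_algebra f -> smooth f.
Proof.
move=> Ff s; suff Fs : flat_algebra (iter_partial s f).
  split=> [|i x]; first exact: flat_algebra_continuous.
  by have [g _ dg] := flat_algebra_derive i Fs; have [] := dg x.
elim: s => //= i s Fs; have [g Fg dg] := flat_algebra_derive i Fs.
rewrite (_ : 'D_(e_ i) _ = g)//; apply/funext => x.
by have [] := dg x.
Qed.

(** Not normalised to integral 1: its absolute value is at most 1, and as [eps] tends to 0 it
    converges to the indicator of the open box, so testing against it produces integrals over
    boxes. *)
Definition bump (c : V * V) : V -> R := fun x =>
  \prod_i (flat eps 0 (x 0 i - c.1 0 i) * flat eps 0 (c.2 0 i - x 0 i)).

Lemma bump_smooth c : smooth (bump c).
Proof.
apply: flat_algebra_smooth; rewrite /bump.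
have P (s : seq 'I_n) : flat_algebra (fun x => \prod_(i <- s)
    (flat eps 0 (x 0 i - c.1 0 i) * flat eps 0 (c.2 0 i - x 0 i))).
  elim: s => [|i s IH].
    rewrite (_ : (fun _ => _) = cst 1); first exact: flat_algebra_cst.
    by apply/funext => x; rewrite big_nil.
  rewrite (_ : (fun _ => _) = (fun x => flat eps 0 (1 * x 0 i + - c.1 0 i)) *
    (fun x => flat eps 0 (-1 * x 0 i + c.2 0 i)) *
    (fun x => \prod_(i <- s) (flat eps 0 (x 0 i - c.1 0 i) * flat eps 0 (c.2 0 i - x 0 i)))).
    by do ![apply: flat_algebraM => //]; exact: flat_algebra_atom.
  by apply/funext => x; rewrite big_cons !mulrfctE mul1r mulN1r [- _ + _]addrC.
exact: P.
Qed.

Lemma flat0_le1 t : `|flat eps 0 t| <= 1.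
Proof.
rewrite ger0_norm ?flat_ge0// /flat; case: ifP => // t0.
by rewrite expr0 mul1r expR_le1 oppr_le0 mulr_ge0 ?(ltW eps0)// invr_ge0 ltW.
Qed.

Lemma bump_le1 c x : `|bump c x| <= 1.
Proof.
rewrite /bump normr_prod; apply: prodr_ile1 => i _.
by rewrite normr_ge0/= normrM mulr_ile1// flat0_le1.
Qed.

Lemma bump_eq0 c x : ~ obox c x -> bump c x = 0.
Proof.
move=> /existsNP[i /negP]; rewrite negb_and -!leNgt => H.
apply/eqP/prodf_eq0; exists i => //; rewrite mulf_eq0; apply/orP.
by case/orP: H => H; [left|right]; rewrite flat_le0// subr_le0.
Qed.

Lemma bump_test_function (Omega : set V) c : cbox c `<=` Omega -> test_function Omega (bump c).
Proof.
move=> cO; have sub : closure [set x | bump c x != 0] `<=` cbox c.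
  rewrite [X in _ `<=` X](closure_id _).1; last exact: closed_cbox.
  apply: closure_subset => x /= /eqP bx i.
  have : obox c x by apply: contrapT => /bump_eq0.
  by move=> /(_ i) /andP[/ltW-> /ltW->].
split; first exact: bump_smooth.
- by apply: subclosed_compact (@closed_closure _ _) (@compact_cbox _ _ c) sub.
- exact: subset_trans cO.
Qed.

End bump.

Lemma bump_cvg (R : realType) (n : nat) (c : 'rV[R]_n * 'rV[R]_n) x :
  bump (k.+1%:R^-1) c x @[k --> \oo] --> (\1_(obox c) x : R).
Proof.
have [ox|nox] := pselect (obox c x); last first.
  rewrite indicE memNset// (_ : (fun k => _) = cst 0); first exact: cvg_cst.
  by apply/funext => k; rewrite bump_eq0.
rewrite indicE mem_set//.
have flat_cvg (t : R) : 0 < t -> flat (k.+1%:R^-1) 0 t @[k --> \oo] --> (1 : R).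
  move=> t0; rewrite (_ : (fun k => _) = fun k : nat => expR (- (k.+1%:R^-1 * t^-1))).
    rewrite -[X in _ --> X]expR0; apply: continuous_cvg; first exact: continuous_expR.
    rewrite -oppr0; apply: cvgN; rewrite -(mul0r t^-1).
    by apply: cvgM; [exact: cvg_harmonic|exact: cvg_cst].
  by apply/funext => k; rewrite /flat t0 expr0 mul1r.
rewrite /bump [X in _ --> X](_ : _ = \prod_(i < n) 1); last by rewrite big1.
have ccont : continuous (fun p : R * R => p.1 * p.2) by move=> p; exact: mul_continuous.
apply: (cvg_big ccont) => i _; rewrite -[X in _ --> X]mulr1.
by apply: cvgM; apply: flat_cvg; rewrite subr_gt0; have /andP[] := ox i.
Qed.

(** * From integrals over boxes to null sets *)

Section null_on_boxes.
Context {R : realType} {n : nat}.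
Local Notation V := 'rV[R]_n.
Local Notation mu := (@lebesgue_outer R n).
Local Notation T := (caratheodory_type mu).
Local Notation lambda := (lebesgue_n R n).
Implicit Types (x : V) (A B E Q : set V) (v w : V -> R) (c : V * V).

Definition borel_boxes : set (set V) := <<s range (@obox R n) >>.

Lemma borel_boxes_bigcap (F : nat -> set V) : (forall k, borel_boxes (F k)) ->
  borel_boxes (\bigcap_k F k).
Proof.
move=> bF; exact: (@bigcapT_measurable _ (g_sigma_algebraType (range (@obox R n))) F bF).
Qed.

Lemma obox_setI c c' : obox c `&` obox c' =
  obox (\row_i Num.max (c.1 0 i) (c'.1 0 i), \row_i Num.min (c.2 0 i) (c'.2 0 i)).
Proof.
apply/seteqP; split => [x [cx c'x] i|x cx].
  by rewrite !mxE lt_min gt_max; have /andP[-> ->] := cx i; have /andP[-> ->] := c'x i.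
by split=> i; have := cx i; rewrite !mxE lt_min gt_max => /andP[/andP[? ?] /andP[? ?]]; apply/andP.
Qed.

Lemma cbox_setI c c' : cbox c `&` cbox c' =
  cbox (\row_i Num.max (c.1 0 i) (c'.1 0 i), \row_i Num.min (c.2 0 i) (c'.2 0 i)).
Proof.
apply/seteqP; split => [x [cx c'x] i|x cx].
  by rewrite !mxE le_min ge_max; have /andP[-> ->] := cx i; have /andP[-> ->] := c'x i.
by split=> i; have := cx i; rewrite !mxE le_min ge_max => /andP[/andP[? ?] /andP[? ?]]; apply/andP.
Qed.

Lemma box_borel_boxes c : borel_boxes (box c).
Proof.
rewrite (_ : box c = \bigcap_k obox (c.1, c.2 + const_mx k.+1%:R^-1)).
  by apply: borel_boxes_bigcap => k; apply: sub_sigma_algebra; exists (c.1, c.2 + const_mx k.+1%:R^-1).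
apply/seteqP; split => [x cx k _ i|x cx i].
  have /andP[-> c2] := cx i; rewrite !mxE /=.
  by rewrite (le_lt_trans c2)// ltrDl invr_gt0.
have /andP[-> _] /= := cx 0%N I i.
apply/ler_addgt0Pl => e e0.
have /andP[_] := cx (Num.truncn e^-1) I i; rewrite !mxE /= => /ltW/le_trans; apply.
rewrite addrC lerD2r -[leRHS]invrK lef_pV2 ?posrE ?invr_gt0// ltW//.
exact: truncnS_gt.
Qed.

Lemma borel_boxes_countable (C : set (V * V)) : countable C ->
  borel_boxes (\bigcup_(c in C) box c).
Proof.
move=> /countable_injP[f fi].
rewrite (_ : \bigcup_(c in C) _ = \bigcup_k \bigcup_(c in C `&` [set c | f c = k]) box c).
  apply: (@bigcupT_measurable _ (g_sigma_algebraType (range (@obox R n)))) => k.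
  have [[c Cc fc]|nC] := pselect (exists2 c, C c & f c = k).
    rewrite (_ : C `&` _ = [set c]); first by rewrite bigcup_set1; exact: box_borel_boxes.
    apply/seteqP; split => [c' [Cc' fc']|_ ->//].
    by apply: fi; rewrite ?inE// fc'.
  rewrite (_ : C `&` _ = set0); first by rewrite bigcup_set0; exact: measurable0.
  by rewrite -subset0 => c [Cc fc]; apply: nC; exists c.
apply/seteqP; split => [x [c Cc cx]|x [k _ [c [Cc _] cx]]]; last by exists c.
by exists (f c) => //; exists c.
Qed.

(* The covers in the definition of the outer measure are countable unions of
   half-open boxes, hence Borel sets. *)
Lemma borel_hull E : measurable (E : set T) -> (mu E < +oo)%E ->
  exists B, [/\ borel_boxes B, E `<=` B & mu (B `\` E) = 0%E].
Proof.
move=> mE Eoo.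
have Efin : mu E \is a fin_num by rewrite ge0_fin_numE// lebesgue_outer_ge0.
have /choice[C CP] (k : nat) : exists C : set (V * V), box_cover E C /\
    (\esum_(c in C) (box_volume c)%:E <= mu E + (k.+1%:R^-1)%:E)%E.
  have k0 : 0 < k.+1%:R^-1 :> R by rewrite invr_gt0.
  have [_ [C EC <-] /ltW leC] := lb_ereal_inf_adherent k0 Efin.
  by exists C.
pose U k := \bigcup_(c in C k) box c.
have bU k : borel_boxes (U k) by apply: borel_boxes_countable; have [[]] := CP k.
have EU k : E `<=` U k by have [[]] := CP k.
exists (\bigcap_k U k); split.
- exact: borel_boxes_bigcap.
- by move=> x Ex k _; exact: EU.
set B := \bigcap_k U k.
have BE : (mu B <= mu E)%E.
  apply/lee_addgt0Pr => e e0; pose k := Num.truncn e^-1.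
  apply: (@le_trans _ _ (mu (U k))); first by apply: le_lebesgue_outer => x; apply.
  apply: (@le_trans _ _ (\esum_(c in C k) (box_volume c)%:E)).
    by apply: ereal_inf_lbound; exists (C k) => //; split => //; have [[]] := CP k.
  apply: le_trans (CP k).2 _; rewrite leeD2l// lee_fin.
  rewrite -[leRHS]invrK lef_pV2 ?posrE ?invr_gt0// ltW//; exact: truncnS_gt.
have := mE B; rewrite (_ : B `&` E = E); last first.
  by apply/setIidPr => x Ex k _; exact: EU.
rewrite -setDE => BD; have D0 := lebesgue_outer_ge0 (B `\` E).
apply/eqP; rewrite eq_le D0 andbT.
by rewrite -(@leeD2lE _ (mu E)) // adde0 -BD.
Qed.

Lemma open_obox c : open (obox c).
Proof.
rewrite openE => x cx.
apply: (@filter_forall V 'I_n (fun i => [set y : V | c.1 0 i < y 0 i < c.2 0 i]) (nbhs x)) => i.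
have /andP[c1 c2] := cx i.
have n1 : nbhs x [set y : V | c.1 0 i < y 0 i].
  exact: (@coord_continuous R 1 n 0 i x [set t | c.1 0 i < t] (lt_nbhsr c1)).
have n2 : nbhs x [set y : V | y 0 i < c.2 0 i].
  exact: (@coord_continuous R 1 n 0 i x [set t | t < c.2 0 i] (lt_nbhsl c2)).
by apply: filterS2 n1 n2 => y /= -> ->.
Qed.

Lemma borel_boxes_measurable B : borel_boxes B -> measurable (B : set T).
Proof.
move=> bB; apply: (smallest_sub (X := [set A | measurable (A : set T)]) _ _ bB) => /=.
  by split => /= [|A mA|F mF]; [exact: measurable0|rewrite setTD; exact: measurableC|exact: bigcupT_measurable].
by move=> _ [c _ <-]; exact: (measurable_open (@open_obox c)).
Qed.

Lemma indic_integrable Q A w : measurable (Q : set T) -> measurable (A : set T) ->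
  lambda.-integrable Q (EFin \o w) ->
  lambda.-integrable Q (EFin \o (fun x => w x * \1_A x)).
Proof.
move=> mQ mA iw.
have bA : [bounded (\1_A x : R) | x in (Q : set T)].
  by apply: (@bounded_on _ _ 1) => x _; rewrite indicE; case: (_ \in _); rewrite ?normr0 ?normr1.
have := integrableMr mQ (measurable_indic mA) bA iw.
congr (_.-integrable _ _); apply/funext => x /=.
by rewrite mulrC EFinM.
Qed.

(** Open boxes are stable under intersection, and the sets with vanishing integral form a
    lambda-system. The hypothesis on the integral over [Q] puts the whole space into it; dominated
    convergence handles increasing unions. *)
Lemma Rintegral_indic_borel Q w : measurable (Q : set T) ->
  lambda.-integrable Q (EFin \o w) -> \int[lambda]_(x in Q) w x = 0 ->
  (forall c, \int[lambda]_(x in Q) (w x * \1_(obox c) x) = 0) ->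
  forall B, borel_boxes B -> \int[lambda]_(x in Q) (w x * \1_B x) = 0.
Proof.
move=> mQ iw wQ wc.
pose H := [set B | measurable (B : set T) /\ \int[lambda]_(x in Q) (w x * \1_B x) = 0].
suff sub : borel_boxes `<=` H by move=> B /sub[].
apply: lambda_system_subset.
- by move=> _ _ [c _ <-] [c' _ <-]; rewrite obox_setI; eexists.
- split=> //.
  + split; first exact: measurableT.
    by rewrite -[RHS]wQ; apply: eq_Rintegral => x _; rewrite indicT mulr1.
  + move=> A B BA [mA A0] [mB B0]; split; first exact: measurableD.
    rewrite -[RHS](subrr 0) -{1}A0 -B0 -RintegralB//; try exact: indic_integrable.
    apply: eq_Rintegral => x _; rewrite !indicE !in_setD.
    case: (boolP (x \in B)) => xB /=; last by rewrite andbT; ring.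
    by rewrite (_ : x \in A) /=; [ring|move: xB; rewrite !inE; exact: BA].
  + move=> F ndF HF; have mF k : measurable (F k : set T) by have [] := HF k.
    split; first exact: bigcupT_measurable.
    have mw : measurable_fun (Q : set T) w by apply/measurable_EFinP; exact: measurable_int iw.
    have : \int[lambda]_(x in Q) (w x * \1_(F k) x) @[k --> \oo] -->
        \int[lambda]_(x in Q) (w x * \1_(\bigcup_k F k) x).
      apply: (@Rintegral_dominated_cvg _ _ _ _ _ (fun x => `|w x|)).
      - exact: mQ.
      - by move=> k; exact: (@measurable_funM _ T R Q _ _ mw (measurable_indic (mF k))).
      - move=> x _; apply: cvgM; first exact: cvg_cst.
        have [[N _ FNx]|nF] := pselect ((\bigcup_k F k) x).
          rewrite [\1_(\bigcup_k _) x]indicE mem_set; last by exists N.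
          apply: cvg_near_cst; exists N => // k /= Nk.
          by rewrite indicE mem_set//; have /subsetPset/(_ x FNx) := ndF _ _ Nk.
        rewrite indicE memNset// (_ : (fun k => _) = cst 0); first exact: cvg_cst.
        apply/funext => k; rewrite indicE memNset// => Fk; apply: nF; by exists k.
      - exact: (integrable_norm iw).
      - move=> k x _; rewrite normrM indicE; case: (_ \in _); rewrite ?normr1 ?mulr1//.
        by rewrite normr0 mulr0.
    rewrite (_ : (fun k => _) = cst 0); last by apply/funext => k; have [] := HF k.
    by move=> /(cvg_unique (@Rhausdorff R) (cvg_cst (0 : R))) <-.
- by move=> _ [c _ <-]; split; [exact: (measurable_open (@open_obox c))|exact: wc].
- by move=> X _; exact: subsetT.
Qed.

(** The set [P] where [w > 0] is only Caratheodory measurable, so the Borel case is applied to a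
    Borel hull, which differs from [P] by a null set. Then [w] has integral 0 over a set on which it
    is positive. *)
Lemma Rintegral_indic_null Q w : measurable (Q : set T) -> (mu Q < +oo)%E ->
  lambda.-integrable Q (EFin \o w) -> \int[lambda]_(x in Q) w x = 0 ->
  (forall c, \int[lambda]_(x in Q) (w x * \1_(obox c) x) = 0) ->
  lambda.-negligible (Q `&` [set x | 0 < w x]).
Proof.
move=> mQ Qoo iw wQ wc; set P := Q `&` _.
have mw : measurable_fun (Q : set T) w by apply/measurable_EFinP; exact: measurable_int iw.
have mP : measurable (P : set T).
  have := mw mQ _ (measurable_itv `]0, +oo[).
  by congr (measurable (_ `&` _)); apply/seteqP; split => x /=; rewrite in_itv/= andbT.
apply/(negligibleP lambda mP).
have Poo : (mu P < +oo)%E by apply: le_lt_trans Qoo; apply: le_lebesgue_outer => x [].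
have [B [bB PB BP0]] := borel_hull mP Poo.
have mB := borel_boxes_measurable bB.
have wB := Rintegral_indic_borel mQ iw wQ wc bB.
pose f x := w x * \1_P x.
have iP : lambda.-integrable Q (EFin \o f) := indic_integrable mQ mP iw.
have wP : \int[lambda]_(x in Q) f x = 0.
  rewrite -[RHS]wB /Rintegral; congr fine; apply: ae_eq_integral.
  - exact: mQ.
  - exact: measurable_int iP.
  - exact: measurable_int (indic_integrable mQ mB iw).
  - exists (B `\` P); split => //; first exact: measurableD.
    move=> x /= /not_implyP[Qx]; apply: contra_notP => nBP; congr EFin.
    rewrite !indicE; congr (_ * (nat_of_bool _)%:R).
    apply/idP/idP; rewrite !inE; first exact: PB.
    by move=> Bx; apply: contrapT => nPx; apply: nBP.
have h0 x : Q x -> (0 <= (f x)%:E)%E.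
  move=> Qx; rewrite lee_fin /f indicE; have [Px|nPx] := pselect (P x).
    by rewrite mem_set// mulr1 ltW//; case: Px.
  by rewrite memNset// mulr0.
have : (\int[lambda]_(x in Q) `|(EFin \o f) x| = 0)%E.
  transitivity (\int[lambda]_(x in Q) (f x)%:E)%E.
    apply: eq_integral => x; rewrite inE => Qx; rewrite gee0_abs//; exact: h0.
  by rewrite -(fineK (integrable_fin_num mQ iP)); congr EFin.
move=> /(ae_eq_integral_abs lambda mQ (measurable_int _ iP)).
move=> [N [mN N0 sub]]; apply/eqP; rewrite eq_le lebesgue_outer_ge0 andbT.
rewrite -[leRHS]N0; apply: le_lebesgue_outer => x Px; apply: sub => /= H.
have [Qx wx] := Px; have /eqP := H Qx; rewrite eqe /f indicE mem_set// mulr1.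
by rewrite gt_eqF.
Qed.

End null_on_boxes.

Section uniqueness.
Context {R : realType} {n : nat}.
Local Notation V := 'rV[R]_n.
Local Notation mu := (@lebesgue_outer R n).
Local Notation T := (caratheodory_type mu).
Local Notation lambda := (lebesgue_n R n).
Implicit Types (x : V) (v w : V -> R) (c : V * V) (Omega : set V).

Lemma Rintegral_obox_cvg Omega v c : L1loc Omega v -> cbox c `<=` Omega ->
  \int[lambda]_(x in Omega) (v x * bump k.+1%:R^-1 c x) @[k --> \oo] -->
  \int[lambda]_(x in obox c) v x.
Proof.
move=> vL cO; have iv := vL _ (@compact_cbox _ _ c) cO.
have mQ : measurable (cbox c : set T) := @measurable_cbox _ _ c.
have mv : measurable_fun (cbox c : set T) v by apply/measurable_EFinP; exact: measurable_int iv.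
have oc : obox c `<=` cbox c by move=> x ox i; have /andP[/ltW-> /ltW->] := ox i.
have -> : \int[lambda]_(x in obox c) v x = \int[lambda]_(x in cbox c) (v x * \1_(obox c) x).
  rewrite Rintegral_mkcond [RHS]Rintegral_support.
    apply: eq_Rintegral => x _; rewrite patchE indicE.
    by case: (_ \in _); rewrite ?mulr1 ?mulr0.
  by move=> x nx; rewrite indicE memNset ?mulr0// => /oc.
have mb k : measurable_fun (cbox c : set T) (bump (k.+1%:R^-1 : R) c).
  apply: measurable_continuous => //.
  by have [] := @bump_smooth R n k.+1%:R^-1 _ c [::]; rewrite // invr_gt0.
rewrite (_ : (fun k => _) = fun k => \int[lambda]_(x in cbox c) (v x * bump k.+1%:R^-1 c x)).
  apply: (@Rintegral_dominated_cvg _ _ _ _ _ (fun x => `|v x|)).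
  - exact: mQ.
  - by move=> k; exact: (@measurable_funM _ T R (cbox c) _ _ mv (mb k)).
  - by move=> x _; apply: cvgM; [exact: cvg_cst|exact: bump_cvg].
  - exact: (integrable_norm iv).
  - by move=> k x _; rewrite normrM ler_piMr// bump_le1// invr_gt0.
apply/funext => k.
have bc x : ~ cbox c x -> v x * bump (k.+1%:R^-1 : R) c x = 0.
  by move=> nc; rewrite bump_eq0 ?mulr0// => /oc.
have bO x : ~ Omega x -> v x * bump (k.+1%:R^-1 : R) c x = 0 by move=> nO; apply: bc => /cO.
by rewrite (Rintegral_support bc) (Rintegral_support bO).
Qed.

Lemma Rintegral_eq_ae Omega v v' : open Omega -> L1loc Omega v -> L1loc Omega v' ->
  (forall phi, test_function Omega phi ->
    \int[lambda]_(x in Omega) (v x * phi x) = \int[lambda]_(x in Omega) (v' x * phi x)) ->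
  {ae lambda, forall x, Omega x -> v x = v' x}.
Proof.
move=> oO vL v'L vv'.
have [->|/set0P O0] := eqVneq Omega set0; first by apply: aeW => x [].
have eq_obox c : cbox c `<=` Omega ->
    \int[lambda]_(x in obox c) v x = \int[lambda]_(x in obox c) v' x.
  move=> cO; apply: (cvg_unique (@Rhausdorff R) (Rintegral_obox_cvg vL cO)).
  rewrite (_ : (fun k => _) = fun k => \int[lambda]_(x in Omega) (v' x * bump k.+1%:R^-1 c x)).
    exact: Rintegral_obox_cvg.
  by apply/funext => k; apply: vv'; apply: bump_test_function => //; rewrite invr_gt0.
have [c [OcE OoE oc]] := open_bigcup_box oO O0.
have cO k : cbox (c k) `<=` Omega by rewrite OcE => x cx; exists k.
suff H k : {ae lambda, forall x, obox (c k) x -> v x = v' x}.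
  move: (ae_foralln H); apply: negligibleS => x /=; apply: contra_not => Hx.
  by rewrite OoE => -[k _ okx]; exact: Hx okx.
(* On a box whose closure is a compact subset of [Omega] the difference is integrable, not merely
   locally integrable. *)
pose Q := obox (c k).
have mQ : measurable (Q : set T) := measurable_open (@open_obox _ _ (c k)).
have Qoo : (mu Q < +oo)%E.
  by apply: le_lt_trans (compact_lebesgue_outer_lty (@compact_cbox _ _ (c k))); apply: le_lebesgue_outer; exact: oc.
(* Stated for a general pair so that it can be used for [v, v'] and for [v', v], which covers both
   signs of the difference. *)
have null w w' : L1loc Omega w -> L1loc Omega w' ->
    (forall c, cbox c `<=` Omega -> \int[lambda]_(x in obox c) w x = \int[lambda]_(x in obox c) w' x) ->
    lambda.-negligible (Q `&` [set x | 0 < w x - w' x]).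
  move=> wL w'L ww'.
  have iw := wL _ (@compact_cbox _ _ (c k)) (cO k).
  have iw' := w'L _ (@compact_cbox _ _ (c k)) (cO k).
  have iB := @integrableB _ T R lambda _ (measurable_cbox (c k)) _ _ iw iw'.
  have iQ (f : V -> R) : lambda.-integrable (cbox (c k)) (EFin \o f) -> lambda.-integrable Q (EFin \o f).
    exact: (@integrableS _ T R lambda _ _ _ (measurable_cbox (c k)) mQ (@oc k)).
  apply: Rintegral_indic_null => //.
  - exact: (iQ _ iB).
  - by rewrite RintegralB ?ww' ?subrr//; exact: iQ.
  - move=> c'.
    have E (f : V -> R) : \int[lambda]_(x in Q) (f x * \1_(obox c') x) = \int[lambda]_(x in Q `&` obox c') f x.
      rewrite Rintegral_mkcond [RHS]Rintegral_mkcond; apply: eq_Rintegral => x _.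
      rewrite !patchE indicE in_setI; case: (x \in Q) => //=.
      by case: (_ \in _); rewrite ?mulr1 ?mulr0.
    have mI : measurable (Q `&` obox c' : set T).
      by apply: (measurableI _ _ mQ); exact: (measurable_open (@open_obox _ _ c')).
    have iI f (jf : lambda.-integrable Q (EFin \o f)) : lambda.-integrable (Q `&` obox c') (EFin \o f).
      exact: (@integrableS _ T R lambda _ _ _ mQ mI (@subIsetl _ _ _)).
    rewrite E (RintegralB mI (iI _ (iQ _ iw)) (iI _ (iQ _ iw'))).
    by rewrite /Q obox_setI ww' ?subrr// -cbox_setI => x [cx _]; exact: cO cx.
have N1 := null v v' vL v'L eq_obox.
have N2 := null v' v v'L vL (fun c cO => esym (eq_obox c cO)).
apply: negligibleS (negligibleU N1 N2) => x /= /not_implyP[Qx /eqP].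
rewrite neq_lt => /orP[vv|vv]; [right|left]; by split => //=; rewrite subr_gt0.
Qed.

End uniqueness.

(** * The integral estimate *)

Section gradient_integral.
Context {R : realType} {n : nat}.
Local Notation V := 'rV[R]_n.
Local Notation mu := (@lebesgue_outer R n).
Local Notation T := (caratheodory_type mu).
Local Notation lambda := (lebesgue_n R n).
Implicit Types (x y : V) (Omega A : set V) (u f g F : V -> R) (G : V -> V).

Lemma measurable_L1loc Omega F : open Omega -> L1loc Omega F ->
  measurable_fun (Omega : set T) F.
Proof.
move=> oO FL; have [->|/set0P O0] := eqVneq Omega set0; first exact: measurable_fun_set0.
have [c [OcE _ _]] := open_bigcup_box oO O0.
have mF : forall k, measurable_fun (cbox (c k) : set T) F.
  move=> k; apply/measurable_EFinP; apply: (measurable_int lambda).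
  by apply: FL; [exact: compact_cbox|rewrite OcE => x cx; exists k].
rewrite OcE; exact: ((measurable_fun_bigcup _ (fun k => measurable_cbox (c k))).2 mF).
Qed.

Lemma weak_gradient_unique Omega u G G' : open Omega ->
  weak_gradient Omega u G -> weak_gradient Omega u G' ->
  {ae lambda, forall x, Omega x -> G x = G' x}.
Proof.
move=> oO [_ wG] [_ wG'].
have H i : {ae lambda, forall x, Omega x -> G x 0 i = G' x 0 i}.
  have [L1 H1] := wG i; have [L2 H2] := wG' i.
  apply: Rintegral_eq_ae => // phi tphi.
  by apply: oppr_inj; rewrite -H1// -H2.
have := @filter_forall T 'I_n (fun i x => Omega x -> G x 0 i = G' x 0 i) _ (ae_filter_ringOfSetsType lambda) H.
apply: negligibleS => x /=; apply: contra_not => Hx Ox.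
by apply/rowP => i; exact: Hx.
Qed.

Lemma measurable_enorm Omega G : measurable (Omega : set T) ->
  (forall i, measurable_fun (Omega : set T) (fun x => G x 0 i)) ->
  measurable_fun (Omega : set T) (fun x => enorm (G x)).
Proof.
move=> mO mG.
have m1 : measurable_fun (Omega : set T) (fun x => \sum_(i < n) (G x 0 i * G x 0 i)).
  by apply: measurable_sum => i; exact: (@measurable_funM _ T R Omega _ _ (mG i) (mG i)).
exact: (measurableT_comp (continuous_measurable_fun (@sqrt_continuous R)) m1).
Qed.

Lemma weighted_power_integral Omega F (M Cq s p beta : R) : measurable (Omega : set T) ->
  (forall x, Omega x -> 0 < edist_to x (boundary Omega)) ->
  measurable_fun (Omega : set T) F -> (forall x, 0 <= F x) -> 0 <= M -> 0 <= p ->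
  {ae lambda, forall x, Omega x -> F x <= M * edist_to x (boundary Omega) `^ s} ->
  (\int[lambda]_(x in Omega) (edist_to x (boundary Omega) `^ (s * p + beta))%:E <= Cq%:E)%E ->
  (\int[lambda]_(x in Omega) (F x `^ p * edist_to x (boundary Omega) `^ beta)%:E
    <= (M `^ p * Cq)%:E)%E.
Proof.
set d := fun x => edist_to x (boundary Omega).
move=> mO d0 mF F0 M0 p0 FM Cq_le.
have md q : measurable_fun (Omega : set T) (fun x => d x `^ q).
  apply: (measurableT_comp (measurable_powR q)).
  by apply: measurable_continuous => //; exact: edist_to_continuous.
have mFp : measurable_fun (Omega : set T) (fun x => F x `^ p).
  exact: (measurableT_comp (measurable_powR p)).
apply: (@le_trans _ _ (\int[lambda]_(x in Omega) ((M `^ p)%:E * (d x `^ (s * p + beta))%:E))%E).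
  apply: ae_ge0_le_integral.
  - exact: mO.
  - by move=> x _; rewrite lee_fin mulr_ge0// powR_ge0.
  - by apply/measurable_EFinP; exact: (@measurable_funM _ T R Omega _ _ mFp (md beta)).
  - by move=> x _; rewrite -EFinM lee_fin mulr_ge0// powR_ge0.
  - apply/measurable_EFinP.
    exact: (@measurable_funM _ T R Omega _ _ (measurable_cst (M `^ p)) (md (s * p + beta))).
  - move: FM; apply: negligibleS => x /=; apply: contra_not => FM Ox.
    rewrite -EFinM lee_fin; have dx := d0 _ Ox.
    rewrite powRD; last by rewrite (gt_eqF dx) implybT.
    rewrite mulrA ler_wpM2r ?powR_ge0// powRrM -powRM ?powR_ge0//.
    by rewrite ge0_ler_powR ?nnegrE ?mulr_ge0 ?powR_ge0// FM.
have dq0 x : Omega x -> (0 <= (d x `^ (s * p + beta))%:E)%E by rewrite lee_fin powR_ge0.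
have mdq : measurable_fun (Omega : set T) (fun x => (d x `^ (s * p + beta))%:E).
  exact/measurable_EFinP.
rewrite (ge0_integralZl_EFin lambda mO dq0 mdq (powR_ge0 M p)).
by rewrite EFinM lee_wpmul2l// lee_fin powR_ge0.
Qed.

Lemma Lp_on_bound Omega F (p M : R) : measurable (Omega : set T) -> 0 < p ->
  measurable_fun (Omega : set T) F ->
  (\int[lambda]_(x in Omega) (`|F x| `^ p)%:E <= M%:E)%E -> Lp_on p Omega F.
Proof.
move=> mO p0 mF FM; rewrite /Lp_on inE; apply/andP; split; rewrite inE/=.
  exact: ((measurable_restrictT _ mO).1 mF).
rewrite /finite_norm unlock; apply: poweR_lty.
apply: le_lt_trans (ltry M); apply: le_trans FM.
rewrite [leRHS]integral_mkcond (_ : (fun x => _) = (fun x => (`|F x| `^ p)%:E) \_ Omega)//.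
apply/funext => x; rewrite /= !patchE; case: ifP => // _.
by rewrite normr0 powR0// gt_eqF.
Qed.
End gradient_integral.

Section gradient_estimate.
Context {R : realType} {n : nat}.
Local Notation V := 'rV[R]_n.
Local Notation mu := (@lebesgue_outer R n).
Local Notation T := (caratheodory_type mu).
Local Notation lambda := (lebesgue_n R n).
Implicit Types (x y : V) (G : V -> V).

Definition gradient_exponent (alpha : R) : R := Num.min (2 / n%:R) alpha.

(** [sqrt n] passes from the coordinates to the Euclidean norm; the absolute value makes the
    constant nonnegative for all parameters. *)
Definition gradient_constant (r K L alpha : R) : R :=
  Num.sqrt n%:R * `|@slope_constant R n r K L alpha (gradient_exponent alpha)|.

Lemma gradient_constant_ge0 r K L alpha : 0 <= gradient_constant r K L alpha.
Proof. by rewrite mulr_ge0// sqrtr_ge0. Qed.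

Variables (Omega : set V) (r K L alpha : R) (u f g : V -> R).
Hypotheses (Omega_ball : Omega `<=` eball r) (Omega_open : open Omega)
  (Omega_convex : convex_set Omega) (n2 : (2 <= n)%N)
  (intf : lambda.-integrable Omega (EFin \o f))
  (fL : {ae lambda, forall x, Omega x -> 0 <= f x <= L})
  (alpha01 : 0 < alpha < 1) (K0 : 0 <= K) (L0 : 0 <= L)
  (gK : forall x y, closure Omega x -> closure Omega y ->
     `|g x - g y| <= K * enorm (x - y) `^ alpha)
  (g_convex : convex_function (closure Omega) g)
  (u_cont : {within closure Omega, continuous u})
  (u_convex : convex_function Omega u)
  (MA : monge_ampere_eq Omega u f)
  (ug : forall x, boundary Omega x -> u x = g x).
Local Notation bd := (boundary Omega).
Local Notation dist x := (edist_to x bd).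
Local Notation ga := (gradient_exponent alpha).
Local Notation M := (gradient_constant r K L alpha).

Let n0 : (0 < n)%N. Proof. exact: ltnW. Qed.

Let mOmega : measurable (Omega : set T).
Proof. exact: measurable_open. Qed.

Let dist0 x : Omega x -> 0 < dist x.
Proof.
move=> Ox; apply: (dist_gt0 Omega_ball Omega_open) => //.
exact: (boundary_neq0 Omega_ball Omega_open Omega_convex n0 Ox).
Qed.

Lemma enorm_right_gradient x : Omega x ->
  enorm (right_gradient Omega u x) <= M * dist x `^ (ga - 1).
Proof.
move=> Ox; have nR : (0 : R) < n%:R by rewrite ltr0n.
have /andP[al0 al1] := alpha01.
have ga0 : 0 < ga <= alpha by rewrite lt_min al0 divr_gt0//= ge_min lexx orbT.
have nga : n%:R * ga <= 2 by rewrite mulrC -ler_pdivlMr// ge_min lexx.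
rewrite /gradient_constant -mulrA; apply: enorm_le_coord => [|i].
  by rewrite mulr_ge0 ?powR_ge0.
have d0 := dist0 Ox.
apply: (right_gradient_bound Omega_ball Omega_open Omega_convex n0 u_cont u_convex Ox (d := dist x / 2)).
  by rewrite divr_gt0.
move=> h hd; have h0 : 0 < h by case/andP: hd.
apply: le_trans (slope_bound Omega_ball Omega_open Omega_convex n0 i intf fL MA L0 K0
  alpha01 ga0 nga gK g_convex u_cont u_convex ug Ox hd) _.
by rewrite ler_wpM2l ?(ltW h0)// ler_wpM2r ?powR_ge0// ler_norm.
Qed.

(** The pointwise bound is known for the right gradient; uniqueness carries it over to an arbitrary
    weak gradient almost everywhere. *)
Lemma weak_gradient_integral_le G (Cq p beta : R) : weak_gradient Omega u G -> 0 <= p ->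
  (\int[lambda]_(x in Omega) (dist x `^ ((ga - 1) * p + beta))%:E <= Cq%:E)%E ->
  (\int[lambda]_(x in Omega) (enorm (G x) `^ p * dist x `^ beta)%:E <= (M `^ p * Cq)%:E)%E.
Proof.
move=> wG p0 Cq_le.
have mG : measurable_fun (Omega : set T) (fun x => enorm (G x)).
  apply: (measurable_enorm mOmega) => i.
  by apply: (measurable_L1loc Omega_open); have [_ /(_ i)[]] := wG.
apply: (weighted_power_integral mOmega dist0 mG (fun=> enorm_ge0 _)
  (gradient_constant_ge0 r K L alpha) p0 _ Cq_le).
have := weak_gradient_unique Omega_open wG
  (right_gradient_weak Omega_ball Omega_open Omega_convex n0 u_cont u_convex).
apply: negligibleS => x /=; apply: contra_not => GE Ox.
by rewrite GE//; exact: enorm_right_gradient.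
Qed.

Lemma sobolev_W1_of_integral (Cq p : R) : 1 <= p ->
  (\int[lambda]_(x in Omega) (dist x `^ ((ga - 1) * p + 0))%:E <= Cq%:E)%E ->
  sobolev_W1 p Omega u.
Proof.
move=> p1 Cq_le; have p0 : 0 < p by exact: lt_le_trans p1.
have mu_ : measurable_fun (Omega : set T) u := measurable_u Omega_open u_cont.
split.
  have [U U0 uU] := u_bounded Omega_ball u_cont.
  have Oty : (mu Omega < +oo)%E.
    apply: (@lebesgue_outer_lty _ _ _ r) => x i /Omega_ball Ox.
    by apply: le_trans (coord_le_enorm _ _) _; exact: ltW.
  apply: (@Lp_on_bound _ _ _ _ p (U `^ p * fine (mu Omega))) => //.
  have Ofin : mu Omega \is a fin_num by rewrite ge0_fin_numE ?lebesgue_outer_ge0.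
  rewrite EFinM fineK// -[leRHS](integral_cst lambda mOmega).
  apply: ge0_le_integral.
  - exact: mOmega.
  - by move=> x _; rewrite lee_fin powR_ge0.
  - apply/measurable_EFinP; apply: (measurableT_comp (measurable_powR p)).
    exact: measurableT_comp.
  - exact: measurable_cst.
  - move=> x Ox; rewrite lee_fin ge0_ler_powR ?nnegrE ?(ltW p0)//.
    by apply: uU; exact: subset_closure.
exists (right_gradient Omega u); split; first exact: (right_gradient_weak Omega_ball).
move=> i; have mi := right_gradient_measurable Omega_ball Omega_open Omega_convex n0 u_cont u_convex i.
apply: (@Lp_on_bound _ _ _ _ p (M `^ p * Cq)) => //.
have mn : measurable_fun (Omega : set T) (fun x => `|right_gradient Omega u x 0 i|).
  exact: measurableT_comp.
have := @weighted_power_integral _ _ _ (fun x => `|right_gradient Omega u x 0 i|) M Cq (ga - 1) p 0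
  mOmega dist0 mn (fun=> normr_ge0 _) (gradient_constant_ge0 _ _ _ _) (ltW p0) _ Cq_le.
under eq_integral do rewrite powRr0 mulr1.
apply; apply: aeW => x Ox.
by apply: le_trans (coord_le_enorm _ _) _; exact: enorm_right_gradient.
Qed.

End gradient_estimate.

(** * A constant that depends on the modulus of continuity *)

Section modulus.
Context {R : realType} {n : nat}.
Local Notation V := 'rV[R]_n.
Implicit Types (x y : V) (A : set V) (g : V -> R).

(** The Hoelder bound makes the set under [sup] bounded above, without which the real-valued [sup]
    need not dominate its elements. *)
Lemma modulus_of_continuity_ge A g (K alpha : R) x y : 0 < alpha -> 0 <= K ->
  (forall x y, A x -> A y -> `|g x - g y| <= K * enorm (x - y) `^ alpha) ->
  A x -> A y -> `|g x - g y| <= modulus_of_continuity A g (enorm (x - y)).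
Proof.
move=> al0 K0 gK Ax Ay; apply: ub_le_sup; last by exists x, y.
exists (K * enorm (x - y) `^ alpha) => _ [a [b [Aa Ab ab ->]]].
apply: le_trans (gK _ _ Aa Ab) _; apply: (ler_wpM2l K0).
by apply: ge0_ler_powR => //; rewrite ?nnegrE ?enorm_ge0 ?(ltW al0).
Qed.

Lemma modulus_of_continuity_le A g (K alpha delta : R) : 0 < alpha -> 0 <= K -> 0 <= delta ->
  (forall x y, A x -> A y -> `|g x - g y| <= K * enorm (x - y) `^ alpha) -> A !=set0 ->
  modulus_of_continuity A g delta <= K * delta `^ alpha.
Proof.
move=> al0 K0 de0 gK [x Ax]; apply: ge_sup => [|_ [a [b [Aa Ab ab ->]]]].
  by exists `|g x - g x|, x, x; rewrite subrr enorm0.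
apply: le_trans (gK _ _ Aa Ab) _; apply: (ler_wpM2l K0).
by apply: ge0_ler_powR => //; rewrite ?nnegrE ?enorm_ge0 ?(ltW al0).
Qed.

End modulus.

(** [Lambda] carries no sign and may be negative when [Omega] is empty, whereas the barrier needs a
    nonnegative bound. *)
Lemma ae_le_max (R : realType) (n : nat) (Omega : set 'rV[R]_n) (f : 'rV[R]_n -> R) (Lambda : R) :
  {ae lebesgue_n R n, forall x, Omega x -> 0 <= f x <= Lambda} ->
  {ae lebesgue_n R n, forall x, Omega x -> 0 <= f x <= Num.max Lambda 0}.
Proof.
apply: negligibleS => x /=; apply: contra_not => fL Ox.
by have /andP[-> h] := fL Ox; rewrite le_max h.
Qed.

Lemma gradient_integral_constant (R : realType) (n : nat) (r Lambda p beta : R) (omega : R -> R) :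
  exists2 C : R, 0 <= C & forall (alpha : R) (Omega : set 'rV[R]_n)
    (f g u : 'rV[R]_n -> R) (grad_u : 'rV[R]_n -> 'rV[R]_n),
  (2 <= n)%N ->
  Omega `<=` eball r -> open Omega -> convex_set Omega ->
  (lebesgue_n R n).-integrable Omega (EFin \o f) ->
  {ae lebesgue_n R n, forall x, Omega x -> 0 <= f x <= Lambda} ->
  0 < alpha < 1 ->
  hoelder_on alpha (closure Omega) g ->
  convex_function (closure Omega) g ->
  {within closure Omega, continuous u} ->
  convex_function Omega u ->
  monge_ampere_eq Omega u f ->
  (forall x, boundary Omega x -> u x = g x) ->
  modulus_of_continuity (closure Omega) g = omega ->
  weak_gradient Omega u grad_u -> 0 <= p -> 0 <= beta ->
  (1 - gradient_exponent (n := n) alpha) * p - beta < 1 ->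
  (\int[lebesgue_n R n]_(x in Omega)
    (enorm (grad_u x) `^ p * edist_to x (boundary Omega) `^ beta)%:E <= C%:E)%E.
Proof.
pose good (aK : R * R) := [/\ 0 < aK.1 < 1, 0 <= aK.2,
  (1 - gradient_exponent (n := n) aK.1) * p - beta < 1 &
  forall delta, 0 <= delta -> omega delta <= aK.2 * delta `^ aK.1].
have holder (alpha K : R) (Omega : set 'rV[R]_n) (g : 'rV[R]_n -> R) :
    (forall x y, closure Omega x -> closure Omega y ->
    `|g x - g y| <= K * enorm (x - y) `^ alpha) ->
    forall x y, closure Omega x -> closure Omega y ->
    `|g x - g y| <= Num.max K 0 * enorm (x - y) `^ alpha.
  move=> gK x y cx cy; apply: le_trans (gK _ _ cx cy) _.
  by rewrite ler_wpM2r ?powR_ge0// le_max lexx.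
have maxK0 (K : R) : 0 <= Num.max K 0 by rewrite le_max lexx orbT.
(* [C] may not depend on [alpha]: any exponent and Hoelder constant compatible
   with [omega] serve equally well. *)
have [[[a K] [[/= a01 K0 pb omK] n2 r0]]|nogood] :=
  pselect (exists aK, [/\ good aK, (2 <= n)%N & 0 < r]).
  have n0 : (0 < n)%N by exact: ltnW.
  have q1 : -1 < (gradient_exponent (n := n) a - 1) * p + beta by move: pb; lra.
  have [Cq Cq0 CqP] := dist_power_integral n0 r0 q1.
  exists (gradient_constant (n := n) r K (Num.max Lambda 0) a `^ p * Cq).
    by rewrite mulr_ge0 ?powR_ge0.
  move=> alpha Omega f g u G _ Ob Oo Oc intf fL /andP[al0 _] [K' /holder gK'] cg cu convu MA ug om wG p0 _ _.
  apply: (@weak_gradient_integral_le _ _ Omega r K (Num.max Lambda 0) a u f g) => //.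
  - exact: ae_le_max.
  - move=> x y cx cy; apply: le_trans (omK _ (enorm_ge0 _)).
    by rewrite -om; exact: modulus_of_continuity_ge al0 (maxK0 _) gK' cx cy.
  - exact: CqP.
(* Without an admissible pair only the empty domain remains: a nonempty one forces [0 < r], and its
   own exponent and Hoelder constant would form such a pair. *)
exists 0 => // alpha Omega f g u G n2 Ob Oo Oc intf fL al01 [K /holder gK] cg cu convu MA ug om wG p0 be0 pb.
have [->|/set0P[x Ox]] := eqVneq Omega set0; first by rewrite integral_set0.
case: nogood; exists (alpha, Num.max K 0); split => //; last first.
  by apply: le_lt_trans (Ob _ Ox); exact: enorm_ge0.
split=> //= delta de0; rewrite -om; have /andP[al0 _] := al01.
by apply: modulus_of_continuity_le => //; exists x; exact: subset_closure.
Qed.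

Theorem corollary19 (R : realType) :
  exists C : nat -> R -> R -> R -> R -> (R -> R) -> R,
  forall (n : nat) (r Lambda alpha : R) (Omega : set 'rV[R]_n)
    (f g u : 'rV[R]_n -> R),
  (2 <= n)%N ->
  Omega `<=` eball r -> open Omega -> convex_set Omega ->
  (lebesgue_n R n).-integrable Omega (EFin \o f) ->
  {ae lebesgue_n R n, forall x, Omega x -> 0 <= f x <= Lambda} ->
  0 < alpha < 1 ->
  hoelder_on alpha (closure Omega) g ->
  convex_function (closure Omega) g ->
  {within closure Omega, continuous u} ->
  convex_function Omega u ->
  monge_ampere_eq Omega u f ->
  (forall x, boundary Omega x -> u x = g x) ->
  [/\ exists grad_u, weak_gradient Omega u grad_u,
      forall grad_u, weak_gradient Omega u grad_u ->
        forall p beta : R, 0 <= p -> 0 <= beta ->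
        (1 - Num.min (2 / n%:R) alpha) * p - beta < 1 ->
        (\int[lebesgue_n R n]_(x in Omega)
           (enorm (grad_u x) `^ p * edist_to x (boundary Omega) `^ beta)%:E
         <= (C n r Lambda p beta
               (modulus_of_continuity (closure Omega) g))%:E)%E &
      forall p : R, 1 <= p -> p < (1 - Num.min (2 / n%:R) alpha)^-1 ->
        sobolev_W1 p Omega u].
Proof.
pose C_ n r Lambda p beta omega := @gradient_integral_constant R n r Lambda p beta omega.
exists (fun n r Lambda p beta omega => s2val (cid2 (C_ n r Lambda p beta omega))).
move=> n r Lambda alpha Omega f g u n2 Ob Oo Oc intf fL al01 gH cg cu convu MA ug.
have n0 : (0 < n)%N by exact: ltnW.
split.
- exists (right_gradient Omega u); exact: (right_gradient_weak Ob).
- move=> G wG p beta p0 be0 pb.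
  have := s2valP' (cid2 (C_ n r Lambda p beta (modulus_of_continuity (closure Omega) g))).
  by apply; [exact: n2|exact: Ob|exact: Oo|exact: Oc|exact: intf|exact: fL|exact: al01|exact: gH|exact: cg|
    exact: cu|exact: convu|exact: MA|exact: ug|by []|exact: wG|exact: p0|exact: be0|exact: pb].
- move=> p p1 pa.
  (* The bound on [p] says precisely that [dist^((gamma - 1) p)] is integrable; this is the case
     [beta = 0]. *)
  have q1 : -1 < (gradient_exponent (n := n) alpha - 1) * p + 0.
    have /andP[al0 al1] := al01; move: pa; rewrite -/(gradient_exponent (n := n) alpha).
    have ga1 : gradient_exponent (n := n) alpha < 1 by rewrite gt_min al1 orbT.
    by rewrite -[_^-1]mul1r ltr_pdivlMr ?subr_gt0//; lra.
  have [Cq CqP] : exists Cq, (\int[lebesgue_n R n]_(x in Omega)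
      (edist_to x (boundary Omega) `^ ((gradient_exponent (n := n) alpha - 1) * p + 0))%:E <= Cq%:E)%E.
    have [E|/set0P[x Ox]] := eqVneq Omega set0; first by exists 0; rewrite E integral_set0.
    have r0 : 0 < r by apply: le_lt_trans (Ob _ Ox); exact: enorm_ge0.
    by have [Cq _ CqP] := dist_power_integral n0 r0 q1; exists Cq; exact: CqP.
  have [K gK] := gH.
  have gK' x y : closure Omega x -> closure Omega y ->
     `|g x - g y| <= Num.max K 0 * enorm (x - y) `^ alpha.
    move=> cx' cy; apply: le_trans (gK _ _ cx' cy) _.
    by rewrite ler_wpM2r ?powR_ge0// le_max lexx.
  apply: (@sobolev_W1_of_integral _ _ Omega r (Num.max K 0) (Num.max Lambda 0) alpha u f g) => //.
  + exact: ae_le_max.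
  + by rewrite le_max lexx orbT.
  + by rewrite le_max lexx orbT.
  + exact: CqP.
Qed.
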